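(* For any isolated hypersurface singularity $f\in\mathbb{C}[[x,y,z]]$, $$\frac{\mu(f)}{\tau(f)}\le\frac{3}{2}.$$
   Context: A hypersurface singularity at the origin is a power series $f\in\mathfrak m^2\subset R=\mathbb{C}[[x,y,z]]$, where $\mathfrak m=(x,y,z)$. Put $\mu(f)=\dim_{\mathbb C}R/\left(\frac{\partial f}{\partial x},\frac{\partial f}{\partial y},\frac{\partial f}{\partial z}\right)$ and $\tau(f)=\dim_{\mathbb C}R/\left(f,\frac{\partial f}{\partial x},\frac{\partial f}{\partial y},\frac{\partial f}{\partial z}\right)$. The singularity is isolated if $\tau(f)<\infty$ (equivalently $\mu(f)<\infty$). *)

(* Defs.v *)
From HB Require Import structures.
From mathcomp Require Import all_boot all_order all_algebra.
(* mpoly has to be imported before constructive_ereal: in the other order some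
   of their notations clash. *)
From mathcomp Require Import mpoly.
From mathcomp Require Import boolp classical_sets reals constructive_ereal.
From mathcomp Require Import complex.

Set Implicit Arguments.
Unset Strict Implicit.
Unset Printing Implicit Defensive.

Import Order.TTheory GRing.Theory Num.Theory.

Local Open Scope ring_scope.
Local Open Scope quotient_scope.

Record fps (n : nat) (R : Type) := FPS { fcoef :> 'X_{1..n} -> R }.

Notation "{ 'fps' R [ n ] }" := (fps n R)
  (at level 0, R at level 2, n at level 2, format "{ 'fps'  R [ n ] }")
  : type_scope.

HB.instance Definition _ n (R : Type) := gen_eqMixin (fps n R).
HB.instance Definition _ n (R : Type) := gen_choiceMixin (fps n R).

Lemma fpsP n R (f g : {fps R[n]}) : fcoef f =1 fcoef g -> f = g.
Proof. by case: f g => [f] [g] /= /funext->. Qed.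

Section FPSRing.
Variables (n : nat) (R : comNzRingType).
Implicit Types (f g h : {fps R[n]}) (m : 'X_{1..n}).

Definition fps0 : {fps R[n]} := FPS (fun=> 0).
Definition fps_opp f : {fps R[n]} := FPS (fun m => - f m).
Definition fps_add f g : {fps R[n]} := FPS (fun m => f m + g m).

Fact fps_addA : associative fps_add.
Proof. by move=> f g h; apply: fpsP => m; rewrite /= addrA. Qed.
Fact fps_addC : commutative fps_add.
Proof. by move=> f g; apply: fpsP => m; rewrite /= addrC. Qed.
Fact fps_add0 : left_id fps0 fps_add.
Proof. by move=> f; apply: fpsP => m; rewrite /= add0r. Qed.
Fact fps_addN : left_inverse fps0 fps_opp fps_add.
Proof. by move=> f; apply: fpsP => m; rewrite /= addNr. Qed.

HB.instance Definition _ := GRing.isZmodule.Build {fps R[n]}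
  fps_addA fps_addC fps_add0 fps_addN.

Definition fps_const (a : R) : {fps R[n]} :=
  FPS (fun m => if m == 0%MM then a else 0).

(* The Cauchy product, written as in mcoeffM. *)
Definition fps_mul f g : {fps R[n]} := FPS (fun m =>
  \sum_(k : 'X_{1..n < (mdeg m).+1, (mdeg m).+1} | m == (k.1 + k.2)%MM)
    f k.1 * g k.2).

Definition fps_trunc (d : nat) f : {mpoly R[n]} :=
  \sum_(m : 'X_{1..n < d.+1}) f m *: 'X_[m].

Lemma mcoeff_trunc d f m : (mdeg m <= d)%N -> (fps_trunc d f)@_m = f m.
Proof. by move=> md; rewrite (mcoeff_mpoly (fcoef f)). Qed.

Lemma mcoeffM_congr d (p p' q q' : {mpoly R[n]}) m : (mdeg m <= d)%N ->
  (forall k, (mdeg k <= d)%N -> p@_k = p'@_k) ->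
  (forall k, (mdeg k <= d)%N -> q@_k = q'@_k) ->
  (p * q)@_m = (p' * q')@_m.
Proof.
move=> md pp' qq'; rewrite !mcoeffM; apply: eq_bigr => k _.
have lekd (i : 'X_{1..n < (mdeg m).+1}) : (mdeg i <= d)%N.
  by case: i => i /= lti; apply: leq_trans md; rewrite -ltnS.
by rewrite pp' // qq'.
Qed.

Lemma fps_mulE d f g m : (mdeg m <= d)%N ->
  fps_mul f g m = (fps_trunc d f * fps_trunc d g)@_m.
Proof.
move=> md; rewrite mcoeffM; apply: eq_bigr => k _.
have lekd (i : 'X_{1..n < (mdeg m).+1}) : (mdeg i <= d)%N.
  by case: i => i /= lti; apply: leq_trans md; rewrite -ltnS.
by rewrite !mcoeff_trunc.
Qed.

Lemma mcoeff_truncM d f g m : (mdeg m <= d)%N ->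
  (fps_trunc d (fps_mul f g))@_m = (fps_trunc d f * fps_trunc d g)@_m.
Proof. by move=> md; rewrite mcoeff_trunc // (fps_mulE _ _ md). Qed.

Lemma mcoeff_truncC d a m : (mdeg m <= d)%N ->
  (fps_trunc d (fps_const a))@_m = (a%:MP_[n])@_m.
Proof.
move=> md; rewrite mcoeff_trunc // mcoeffC /= eq_sym.
by case: eqP; rewrite ?mulr1 ?mulr0.
Qed.

Fact fps_mulA : associative fps_mul.
Proof.
move=> f g h; apply: fpsP => m; rewrite !(fps_mulE _ _ (leqnn (mdeg m))).
rewrite -(@mcoeffM_congr (mdeg m) _ _ _ _ m (leqnn _)
  (fun k _ => erefl (fps_trunc _ f)@_k) (fun k kd => esym (mcoeff_truncM g h kd))).
rewrite mulrA; apply: (mcoeffM_congr (d := mdeg m)) => // k kd.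
by rewrite mcoeff_truncM.
Qed.

Fact fps_mulC : commutative fps_mul.
Proof.
by move=> f g; apply: fpsP => m; rewrite !(fps_mulE _ _ (leqnn (mdeg m))) mulrC.
Qed.

Lemma fps_constM a f m : fps_mul (fps_const a) f m = a * f m.
Proof.
rewrite (fps_mulE _ _ (leqnn (mdeg m))).
rewrite (@mcoeffM_congr (mdeg m) _ a%:MP _ (fps_trunc (mdeg m) f)) //.
  by rewrite mul_mpolyC mcoeffZ mcoeff_trunc.
by move=> k kd; exact: mcoeff_truncC.
Qed.

Fact fps_mul1 : left_id (fps_const 1) fps_mul.
Proof. by move=> f; apply: fpsP => m; rewrite fps_constM mul1r. Qed.

Fact fps_mulDl : left_distributive fps_mul +%R.
Proof.
move=> f g h; apply: fpsP => m.
by rewrite /= -big_split /=; apply: eq_bigr => k _; rewrite mulrDl.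
Qed.

Fact fps_one_neq0 : fps_const 1 != 0.
Proof.
apply/eqP => /(congr1 (fun f : {fps R[n]} => f 0%MM)) /= /eqP.
by rewrite eqxx oner_eq0.
Qed.

HB.instance Definition _ := GRing.Zmodule_isComNzRing.Build {fps R[n]}
  fps_mulA fps_mulC fps_mul1 fps_mulDl fps_one_neq0.

Definition fps_scale (a : R) f : {fps R[n]} := FPS (fun m => a * f m).

Fact fps_scaleA a b f : fps_scale a (fps_scale b f) = fps_scale (a * b) f.
Proof. by apply: fpsP => m; rewrite /= mulrA. Qed.
Fact fps_scale1 : left_id 1 fps_scale.
Proof. by move=> f; apply: fpsP => m; rewrite /= mul1r. Qed.
Fact fps_scaleDr : right_distributive fps_scale +%R.
Proof. by move=> a f g; apply: fpsP => m; rewrite /= mulrDr. Qed.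
Fact fps_scaleDl f : {morph fps_scale^~ f : a b / a + b}.
Proof. by move=> a b; apply: fpsP => m; rewrite /= mulrDl. Qed.

HB.instance Definition _ := GRing.Zmodule_isLmodule.Build R {fps R[n]}
  fps_scaleA fps_scale1 fps_scaleDr fps_scaleDl.

Fact fps_scaleAl (a : R) f g : a *: (f * g) = (a *: f) * g.
Proof.
apply: fpsP => m /=; rewrite big_distrr /=.
by apply: eq_bigr => k _; rewrite mulrA.
Qed.

HB.instance Definition _ :=
  GRing.Lmodule_isLalgebra.Build R {fps R[n]} fps_scaleAl.
HB.instance Definition _ :=
  GRing.Lalgebra_isComAlgebra.Build R {fps R[n]}.

Definition fpsX (i : 'I_n) : {fps R[n]} := FPS (fun m => (m == U_(i)%MM)%:R).

(* The formal partial derivative, as in mcoeff_deriv. *)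
Definition fps_deriv (i : 'I_n) f : {fps R[n]} :=
  FPS (fun m => f (m + U_(i))%MM *+ (m i).+1).

End FPSRing.

Section Ideals.
Variable A : comNzRingType.
Local Open Scope classical_set_scope.

Definition ideal_span (S : set A) : set A :=
  [set x | exists (k : nat) (a s : 'I_k -> A),
     (forall i, S (s i)) /\ x = \sum_(i < k) a i * s i].

Definition ideal_mul (I J : set A) : set A :=
  ideal_span [set a * b | a in I & b in J].

Lemma ideal_span0 S : ideal_span S 0.
Proof. by exists 0%N, (fun=> 0), (fun=> 0); split; [case|rewrite big_ord0]. Qed.

Lemma ideal_spanD S x y : ideal_span S x -> ideal_span S y ->
  ideal_span S (x + y).
Proof.
move=> [k [a [s [Ss ->]]]] [l [b [t [St ->]]]].
exists (k + l)%N, (fun i => match split i with inl j => a j | inr j => b j end),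
  (fun i => match split i with inl j => s j | inr j => t j end).
split; first by move=> i; case: (split i).
rewrite big_split_ord /=; congr (_ + _); apply: eq_bigr => i _.
  by rewrite (unsplitK (inl _ i)).
by rewrite (unsplitK (inr _ i)).
Qed.

Lemma ideal_spanMl S c x : ideal_span S x -> ideal_span S (c * x).
Proof.
move=> [k [a [s [Ss ->]]]]; exists k, (fun i => c * a i), s; split=> //.
by rewrite big_distrr /=; apply: eq_bigr => i _; rewrite mulrA.
Qed.

Definition ideal_pred (S : set A) : {pred A} := fun x => `[< ideal_span S x >].

End Ideals.

Section IdealSubmod.
Variables (K : nzRingType) (A : comAlgType K) (S : set A).

Fact ideal_pred_submod : submod_closed (ideal_pred S).
Proof.
split=> [|a x y]; first exact/asboolP/ideal_span0.
move=> /asboolP Sx /asboolP Sy; apply/asboolP/ideal_spanD => //.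
by rewrite -mulr_algl; exact: ideal_spanMl.
Qed.

HB.instance Definition _ :=
  GRing.isSubmodClosed.Build K A (ideal_pred S) ideal_pred_submod.

End IdealSubmod.

Section LmodQuotient.
Variables (K : nzRingType) (V : lmodType K) (I : submodClosed V).

Fact submod_zmod_closed : zmod_closed (I : {pred V}).
Proof.
split=> [|x y Ix Iy]; first exact: rpred0.
by apply: rpredD => //; rewrite -scaleN1r; apply: rpredZ.
Qed.

Definition submod_zmod : {pred V} := I.
HB.instance Definition _ :=
  GRing.isZmodClosed.Build V submod_zmod submod_zmod_closed.

(* ring_quotient only provides the additive group structure of the quotient
   by an additive subgroup; the scaling is added here. *)
Definition lmod_quot := Quotient.quot submod_zmod.
HB.instance Definition _ := GRing.Zmodule.on lmod_quot.
HB.instance Definition _ := EqQuotient.on lmod_quot.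

Definition quot_scale (a : K) : lmod_quot -> lmod_quot :=
  lift_op1 lmod_quot ( *:%R a).

Lemma pi_scale a x :
  quot_scale a (\pi_lmod_quot x) = \pi_lmod_quot (a *: x).
Proof.
rewrite /quot_scale; unlock; apply/eqP; rewrite -Quotient.idealrBE -scalerBr.
by apply: rpredZ; rewrite -[_ \in _]/(_ \in submod_zmod) Quotient.idealrBE reprK.
Qed.

Lemma pi_add x y : \pi_lmod_quot x + \pi_lmod_quot y = \pi_lmod_quot (x + y).
Proof. exact: (esym (@Quotient.pi_add V submod_zmod x y)). Qed.

Fact quot_scaleA a b u : quot_scale a (quot_scale b u) = quot_scale (a * b) u.
Proof. by rewrite -[u]reprK !pi_scale scalerA. Qed.
Fact quot_scale1 : left_id 1 quot_scale.
Proof. by move=> u; rewrite -[u]reprK pi_scale scale1r. Qed.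
Fact quot_scaleDr : right_distributive quot_scale +%R.
Proof.
move=> a u v; rewrite -[u]reprK -[v]reprK.
by rewrite pi_add !pi_scale pi_add scalerDr.
Qed.
Fact quot_scaleDl u : {morph quot_scale^~ u : a b / a + b}.
Proof.
by move=> a b; rewrite -[u]reprK !pi_scale pi_add scalerDl.
Qed.

HB.instance Definition _ := GRing.Zmodule_isLmodule.Build K lmod_quot
  quot_scaleA quot_scale1 quot_scaleDr quot_scaleDl.

End LmodQuotient.

Section Dimension.
Variables (R : realType) (K : fieldType).

Definition has_dim (V : lmodType K) (n : nat) : Prop :=
  inhabited (Vector.axiom n V).

Definition edim (V : lmodType K) : \bar R :=
  if pselect (exists n, has_dim V n) is left ex then (projT1 (cid ex))%:R%:E
  else +oo%E.

Lemma has_dim_leq (V : lmodType K) m n : has_dim V m -> has_dim V n -> (m <= n)%N.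
Proof.
move=> [[f flin [f' fK f'K]]] [[g glin [g' gK g'K]]].
pose F := HB.pack_for {linear V -> 'rV[K]_m} f (GRing.isLinear.Build _ _ _ _ f flin).
pose G := HB.pack_for {linear V -> 'rV[K]_n} g (GRing.isLinear.Build _ _ _ _ g glin).
have f'lin : linear f'.
  by move=> a x y; apply: (can_inj fK); rewrite f'K flin !f'K.
pose F' := HB.pack_for {linear 'rV[K]_m -> V} f'
  (GRing.isLinear.Build _ _ _ _ f' f'lin).
have g'lin : linear g'.
  by move=> a x y; apply: (can_inj gK); rewrite g'K glin !g'K.
pose G' := HB.pack_for {linear 'rV[K]_n -> V} g'
  (GRing.isLinear.Build _ _ _ _ g' g'lin).
have MN : lin1_mx (G \o F') *m lin1_mx (F \o G') = 1%:M.
  apply/row_matrixP => i; rewrite rowE mulmxA mul_rV_lin1 mul_rV_lin1 /=.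
  by rewrite gK f'K rowE mulmx1.
by rewrite -[m](mxrank1 K) -MN (leq_trans (mxrankM_maxr _ _)) // rank_leq_row.
Qed.

Lemma edimE V n : has_dim V n -> edim V = n%:R%:E.
Proof.
move=> Vn; rewrite /edim; case: pselect => [ex|]; last by case; exists n.
case: cid => /= m Vm; congr (_%:R%:E); apply/eqP.
by rewrite eqn_leq !(has_dim_leq Vm, has_dim_leq Vn).
Qed.

Lemma edim_infty V : (forall n, ~ has_dim V n) -> edim V = +oo%E.
Proof.
by move=> Vn; rewrite /edim; case: pselect => // -[n Vn']; case: (Vn n).
Qed.

End Dimension.

Section Singularities.
Variable R : realType.
Local Open Scope classical_set_scope.
Local Notation C := R[i].

Definition quot_dim (S : set {fps C[3]}) : \bar R :=
  edim R (lmod_quot (ideal_pred S)).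

Definition max_ideal : set {fps C[3]} := ideal_span (range (@fpsX 3 C)).

Definition hypersurface_singularity (f : {fps C[3]}) : Prop :=
  ideal_mul max_ideal max_ideal f.

Definition milnor (f : {fps C[3]}) : \bar R :=
  quot_dim (range (fun i => fps_deriv i f)).

Definition tjurina (f : {fps C[3]}) : \bar R :=
  quot_dim (f |` range (fun i => fps_deriv i f)).

Definition isolated (f : {fps C[3]}) : Prop := (tjurina f < +oo)%E.

End Singularities.

(* Main.v *)
(** Modulo a large prime [p], after multiplication by a generic unit
    [E = 1 - sum_i c_i x_i] the series [h = E f] is integral over its Jacobian
    ideal [I = (U_1, U_2, U_3)]: with [F = (f, d_1 f, d_2 f, d_3 f)] one has
    [F^(d+1) = I F^d] for some [d].  The power series ring is free over
    [A = k[[U_1, U_2, U_3]]], of rank [nu = dim R/I].  Consider the Legendre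
    transform [w = sum_i x_i U_i - h]: since [dw = sum_i x_i dU_i], the partial
    derivatives of [Tr (w^j)] over [A] are the traces of [j w^(j-1) x_i], and
    comparison with [q]-th powers shows that [Tr (w^j)] has order [> j].  By
    Newton's identities the characteristic polynomial of [w] then forces
    [w^q], hence also [h^q], into [I^(q+1)] for [q = p^e] large.

    A basis of [R] modulo [(U_i^q)] has [q^3 nu] elements.  On the other hand
    modulo [(U_i^q)] the ring is spanned by [q^3 tau] elements that span it
    modulo all [q]-th powers of [F], by the products of [h^q] with monomials of
    degree [< q] in the [U_i], and by the monomials of degree [>= 2q].  The box
    contains at most about [q^3 / 6] monomials of either kind, whence
    [2 nu <= 3 tau].  Moreover [U_i^q] lies in [I^(q+1)] up to the [q]-th powers
    of the partial derivatives of [f], which gives [mu <= nu].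

    The inequality in characteristic zero follows because both dimensions are
    witnessed by finitely many coefficients, which lie in the image of a ring
    that has specializations in almost all characteristics. *)

Require Import Defs.
From HB Require Import structures.
From mathcomp Require Import all_boot all_order all_algebra perm closed_field.
From mathcomp Require Import mpoly.
From mathcomp Require Import boolp classical_sets reals constructive_ereal complex.
From mathcomp Require Import zify.
Set Implicit Arguments.
Unset Strict Implicit.
Unset Printing Implicit Defensive.
Import Order.TTheory GRing.Theory Num.Theory.
Local Open Scope ring_scope.

(** * Independent and spanning families modulo a subspace *)

(** In characteristic zero a series is integral over its Jacobian ideal, even over [m] times that
    ideal; in characteristic [p] this fails, since derivatives of [p]-th powers vanish. Hence the
    unit [E]: as [U_i = E d_i f - c_i f], the [U_i] are, up to elements of [m F], the combinations
    [d_i f - c_i f], three general elements of the four-generated ideal [F], and such elements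
    generate a reduction of [F]. Integrality alone only puts [h^q] into [I^(q-c)]; it is the extra
    power in [I^(q+1)] that makes [f^q] negligible when [mu] is compared with [nu]. As
    [h + w = sum_i x_i U_i], and [x_i^q] lies in [I] for large [q], only [w^q] has to be controlled.
    Characteristic [p] also supplies the freeness over [A]: the ring is free over its [q]-th powers,
    so dimensions modulo [(U_i^q)] can be counted without the theory of regular sequences. Newton's
    identities and the integration of the derivatives of traces divide by integers up to [nu];
    therefore [p] has to exceed a bound on [nu] that does not depend on the characteristic. *)

Section ModSub.
Variables (K : fieldType) (V : lmodType K).
Implicit Types (I : V -> Prop).

Definition submodP I := I 0 /\ forall a x y, I x -> I y -> I (a *: x + y).

Definition spans I (T : finType) (e : T -> V) :=
  forall z, exists c : T -> K, I (z - \sum_t c t *: e t).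
Definition indep I (T : finType) (e : T -> V) :=
  forall c : T -> K, I (\sum_t c t *: e t) -> forall t, c t = 0.

Section Fixed.
Variables (I : V -> Prop) (Isub : submodP I).

Lemma submodP0 : I 0. Proof. by case: Isub. Qed.
Lemma submodPD x y : I x -> I y -> I (x + y).
Proof. by move=> Ix Iy; rewrite -[x]scale1r; case: Isub => _; apply. Qed.
Lemma submodPZ a x : I x -> I (a *: x).
Proof. by move=> Ix; rewrite -[_ *: _]addr0; case: Isub => I0; apply. Qed.
Lemma submodPN x : I x -> I (- x).
Proof. by move=> Ix; rewrite -scaleN1r; apply: submodPZ. Qed.
Lemma submodPB x y : I x -> I y -> I (x - y).
Proof. by move=> Ix Iy; apply/submodPD/submodPN. Qed.
Lemma submodP_sum (T : Type) (r : seq T) (P : pred T) (F : T -> V) :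
  (forall t, P t -> I (F t)) -> I (\sum_(t <- r | P t) F t).
Proof. by move=> IF; elim/big_ind: _; [exact: submodP0|exact: submodPD|]. Qed.
Lemma submodP_congr x y : I (x - y) -> I y -> I x.
Proof. by move=> Ixy Iy; rewrite -[x](subrK y); apply: submodPD. Qed.

(** If [S] were larger than [T], the coefficients expressing the [e s] through the [v t] would have
    a nonzero left kernel vector, which is a relation between the [e s] modulo [I]. *)
Lemma indep_leq_spans (S T : finType) (e : S -> V) (v : T -> V) :
  indep I e -> spans I v -> (#|S| <= #|T|)%N.
Proof.
move=> ie sv; rewrite leqNgt; apply/negP => ltTS.
have [c Hc] := choice (fun s => sv (e s)).
pose C := \matrix_(i < #|S|, j < #|T|) c (enum_val i) (enum_val j).
have : kermx C != 0.
  by rewrite -mxrank_eq0 mxrank_ker subn_eq0 -ltnNge (leq_ltn_trans (rank_leq_col _)).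
case/rowV0Pn => u; rewrite sub_kermx => /eqP uC u0.
have Iu : I (\sum_s u 0 (enum_rank s) *: e s).
  apply: (submodP_congr (y := \sum_s u 0 (enum_rank s) *: \sum_t c s t *: v t)).
    rewrite -sumrB; apply: submodP_sum => s _; rewrite -scalerBr.
    exact/submodPZ/Hc.
  under eq_bigr do rewrite scaler_sumr.
  rewrite exchange_big big1 => [|t _]; first exact: submodP0.
  under eq_bigr do rewrite scalerA.
  rewrite -scaler_suml [X in X *: _](_ : _ = 0) ?scale0r //.
  have /rowP/(_ (enum_rank t)) := uC; rewrite !mxE => uCt.
  rewrite -[RHS]uCt [LHS](big_enum_val (A := S) (fun s => u 0 (enum_rank s) * c s t)).
  by apply: eq_bigr => j _; rewrite !mxE enum_valK enum_rankK.
case/negP: u0; apply/eqP/rowP => j; rewrite mxE -(enum_valK j).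
exact: (ie _ Iu).
Qed.

Lemma spans_drop (T : finType) (e : T -> V) (c : T -> K) (t0 : T) :
  spans I e -> c t0 != 0 -> I (\sum_t c t *: e t) ->
  spans I (fun t : {t | t \in predC1 t0} => e (val t)).
Proof.
move=> se c0 Ic z; have [a Ha] := se z.
pose b t := a t - a t0 / c t0 * c t.
exists (fun t => b (val t)); rewrite -(big_sub (predC1 t0) (fun t => b t *: e t)).
apply: (submodP_congr (y := z - \sum_t a t *: e t)) => //.
have -> : \sum_(t in predC1 t0) b t *: e t = \sum_t b t *: e t.
  by rewrite [RHS](bigD1 t0) //= /b divfK // subrr scale0r add0r.
rewrite opprB addrC addrA subrK -sumrB.
under eq_bigr do rewrite -scalerBl opprB addrC subrK -scalerA.
by rewrite -scaler_sumr; exact: submodPZ.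
Qed.

Lemma indep_of_spans (S T : finType) (e : S -> V) (v : T -> V) :
  indep I e -> spans I v -> (#|T| <= #|S|)%N -> indep I v.
Proof.
move=> ie sv leTS c Ic t0; apply/eqP/negPn/negP => c0.
have := indep_leq_spans ie (spans_drop sv c0 Ic).
rewrite card_sig cardC1 => leS; have := leq_trans leTS leS.
by rewrite leqNgt prednK ?leqnn //; apply/card_gt0P; exists t0.
Qed.

Lemma spans_basis (T : finType) (v : T -> V) : spans I v ->
  exists (S : finType) (e : S -> V), [/\ (#|S| <= #|T|)%N, spans I e & indep I e].
Proof.
have [n leTn] := ubnP #|T|; elim: n => // n IHn in T v leTn * => sv.
have [iv|niv] := pselect (indep I v); first by exists T, v.
have [c [Ic [t0 c0]]] : exists c : T -> K, I (\sum_t c t *: v t) /\ exists t, c t <> 0.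
  apply: contrapT => H; apply: niv => c Ic t; apply: contrapT => ct.
  by apply: H; exists c; split=> //; exists t.
have /eqP c0' := c0.
have Ts : #|{: {t | t \in predC1 t0}}| = #|T|.-1 by rewrite card_sig cardC1.
have T0 : (0 < #|T|)%N by apply/card_gt0P; exists t0.
have lt' : (#|{: {t | t \in predC1 t0}}| < n)%N by rewrite Ts prednK.
have [S [e [leS se ie]]] := IHn _ _ lt' (spans_drop sv c0' Ic).
by exists S, e; split=> //; rewrite (leq_trans leS) // Ts leq_pred.
Qed.

Lemma spans_sub (J : V -> Prop) (T : finType) (v : T -> V) :
  (forall z, I z -> J z) -> spans I v -> spans J v.
Proof. by move=> IJ sv z; have [c /IJ] := sv z; exists c. Qed.

End Fixed.

Lemma indep_sub (I J : V -> Prop) (T : finType) (v : T -> V) :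
  (forall z, I z -> J z) -> indep J v -> indep I v.
Proof. by move=> IJ iv c /IJ; apply: iv. Qed.

End ModSub.

(** * Powers of ideals *)

Section IdealPowers.
Variable A : comNzRingType.

Definition idealP (L : A -> Prop) :=
  [/\ L 0, forall x y, L x -> L y -> L (x + y) & forall a x, L x -> L (a * x)].

Lemma idealP_sum (L : A -> Prop) (T : Type) (r : seq T) (P : pred T) (F : T -> A) :
  idealP L -> (forall t, P t -> L (F t)) -> L (\sum_(t <- r | P t) F t).
Proof. by case=> L0 LD _ LF; elim/big_ind: _. Qed.
Lemma idealPD (L : A -> Prop) x y : idealP L -> L x -> L y -> L (x + y).
Proof. by case=> _ LD _; exact: LD. Qed.
Lemma idealPM (L : A -> Prop) a x : idealP L -> L x -> L (a * x).
Proof. by case=> _ _; apply. Qed.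
Lemma idealPN (L : A -> Prop) x : idealP L -> L x -> L (- x).
Proof. by move=> Li Lx; rewrite -mulN1r; apply: idealPM. Qed.
Lemma idealPB (L : A -> Prop) x y : idealP L -> L x -> L y -> L (x - y).
Proof. by move=> Li Lx Ly; apply: idealPD => //; exact: idealPN. Qed.
Lemma idealP_congr (L : A -> Prop) x y : idealP L -> L (x - y) -> L y -> L x.
Proof. by move=> Li Lxy Ly; rewrite -[x](subrK y); apply: idealPD. Qed.

Definition iadd (L L' : A -> Prop) z := exists x y, [/\ L x, L' y & z = x + y].

Lemma iadd_ideal L L' : idealP L -> idealP L' -> idealP (iadd L L').
Proof.
move=> iL iL'; split.
- by exists 0, 0; rewrite addr0; split=> //; [case: iL|case: iL'].
- move=> _ _ [x [y [Lx Ly ->]]] [x' [y' [Lx' Ly' ->]]].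
  by exists (x + x'), (y + y'); rewrite addrACA; split=> //; exact: idealPD.
- move=> a _ [x [y [Lx Ly ->]]]; exists (a * x), (a * y); rewrite mulrDr.
  by split=> //; exact: idealPM.
Qed.
Lemma iaddl L L' x : idealP L' -> L x -> iadd L L' x.
Proof. by move=> [L0 _ _] Lx; exists x, 0; rewrite addr0. Qed.
Lemma iaddr L L' x : idealP L -> L' x -> iadd L L' x.
Proof. by move=> [L0 _ _] Lx; exists 0, x; rewrite add0r. Qed.

Section Powers.
Variables (r : nat) (G : 'I_r -> A).

(** The [d]-th power of the ideal generated by the [G i], peeling off one generator at a time. *)
Fixpoint ipow d (z : A) : Prop :=
  if d is d'.+1 then
    exists s : 'I_r -> A, (forall i, ipow d' (s i)) /\ z = \sum_i G i * s i
  else True.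

Lemma ipow_ideal d : idealP (ipow d).
Proof.
elim: d => [|d IHd] //=; split.
- exists (fun=> 0); split=> [i|]; first by case: IHd.
  by rewrite big1 // => i _; rewrite mulr0.
- move=> _ _ [s [Hs ->]] [t [Ht ->]]; exists (fun i => s i + t i).
  split=> [i|]; first by apply: idealPD.
  by rewrite -big_split; apply: eq_bigr => i _; rewrite mulrDr.
- move=> a _ [s [Hs ->]]; exists (fun i => a * s i).
  split=> [i|]; first by apply: idealPM.
  by rewrite mulr_sumr; apply: eq_bigr => i _; rewrite mulrCA.
Qed.
Hint Resolve ipow_ideal : core.

Lemma ipow_gen d i x : ipow d x -> ipow d.+1 (G i * x).
Proof.
move=> Hx; exists (fun j => if j == i then x else 0); split=> [j|].
  by case: eqP => // _; case: (ipow_ideal d).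
rewrite (bigD1 i) //= eqxx big1 ?addr0 // => j /negPf ->; exact: mulr0.
Qed.

Lemma ipow_gen1 i : ipow 1 (G i).
Proof. by rewrite -[G i]mulr1; apply: (@ipow_gen 0). Qed.

(** The induction generalizes over [L]: a generator [G i] is moved into the set
    [fun y => L (G i * y)]. *)
Lemma ipow_prod_ind a b (L : A -> Prop) :
  L 0 -> (forall x y, L x -> L y -> L (x + y)) ->
  (forall s t, ipow a s -> ipow b t -> L (s * t)) ->
  forall z, ipow (a + b) z -> L z.
Proof.
elim: a L => [|a IHa] L L0 LD LM z; first by move=> Hz; rewrite -[z]mul1r; apply: LM.
move=> [s [Hs ->]]; elim/big_ind: _ => [|x y|i _]; [exact: L0|exact: LD|].
apply: (IHa (fun y => L (G i * y))); rewrite ?mulr0 //.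
- by move=> x y Lx Ly; rewrite mulrDr; apply: LD.
- by move=> u t Hu Ht; rewrite mulrA; apply: LM => //; exact: ipow_gen.
- exact: Hs.
Qed.

Lemma ipowM a b x y : ipow a x -> ipow b y -> ipow (a + b) (x * y).
Proof.
elim: a x => [|a IHa] x; first by move=> _ Hy; exact: (idealPM x (ipow_ideal b) Hy).
move=> [s [Hs ->]] Hy; exists (fun i => s i * y); split=> [i|]; first exact: IHa (Hs i) Hy.
by rewrite mulr_suml; apply: eq_bigr => i _; rewrite mulrA.
Qed.

Lemma ipowX a x d : ipow a x -> ipow (a * d) (x ^+ d).
Proof.
move=> Hx; elim: d => [|d IHd]; first by rewrite muln0.
by rewrite mulnS exprS; apply: ipowM.
Qed.

Lemma ipowS d x : ipow d.+1 x -> ipow d x.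
Proof.
case=> s [Hs ->]; apply: (idealP_sum _ (ipow_ideal d)) => i _.
exact: (idealPM _ (ipow_ideal d) (Hs i)).
Qed.

Lemma ipow_leq a b x : (a <= b)%N -> ipow b x -> ipow a x.
Proof. by move=> /subnK <-; elim: (b - a)%N => // d IHd /ipowS. Qed.

Lemma ipow1_sub (L : A -> Prop) : idealP L -> (forall i, L (G i)) ->
  forall z, ipow 1 z -> L z.
Proof.
move=> iL LG z [s [_ ->]]; apply: idealP_sum => // i _.
by rewrite mulrC; apply: idealPM.
Qed.

Lemma ipow_fg d : exists (T : finType) (Y : T -> A), (forall t, ipow d (Y t)) /\
  forall z, ipow d z -> exists s : T -> A, z = \sum_t s t * Y t.
Proof.
elim: d => [|d [T [Y [HY gY]]]].
  exists 'I_1, (fun=> 1); split=> // z _; exists (fun=> z).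
  by rewrite big_ord1 mulr1.
exists ('I_r * T)%type, (fun it => G it.1 * Y it.2); split=> [[i t]|z [s [Hs ->]]].
  exact: ipow_gen.
have [u Hu] := choice (fun i => gY (s i) (Hs i)).
exists (fun it => u it.1 it.2).
rewrite -(pair_bigA _ (fun i t => u i t * (G i * Y t))) /=.
apply: eq_bigr => i _; rewrite [in LHS](Hu i) mulr_sumr.
by apply: eq_bigr => t _; rewrite mulrCA.
Qed.
End Powers.
End IdealPowers.

(** * Formal power series *)

Section FpsBasics.
Variables (n : nat) (R : comNzRingType).
Implicit Types (f g h : {fps R[n]}) (m : 'X_{1..n}).

Lemma fpsD f g m : (f + g) m = f m + g m. Proof. by []. Qed.
Lemma fpsB f g m : (f - g) m = f m - g m. Proof. by []. Qed.
Lemma fpsZ a f m : (a *: f) m = a * f m. Proof. by []. Qed.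
Lemma fps0E m : (0 : {fps R[n]}) m = 0. Proof. by []. Qed.
Lemma fps1E m : (1 : {fps R[n]}) m = (m == 0%MM)%:R.
Proof. by rewrite [LHS]/=; case: eqP. Qed.
Lemma fps_sumE (I : Type) (r : seq I) (P : pred I) (F : I -> {fps R[n]}) m :
  (\sum_(i <- r | P i) F i) m = \sum_(i <- r | P i) F i m.
Proof. exact: (big_morph (fun f => f m) (fun f g => fpsD f g m) (fps0E m)). Qed.

Lemma fpsME d f g m : (mdeg m <= d)%N ->
  (f * g) m = (fps_trunc d f * fps_trunc d g)@_m.
Proof. exact: fps_mulE. Qed.

(** Order at least [d]; by [ordge_ipow] and [ipow_ordge] this is the [d]-th power of the maximal
    ideal. *)
Definition ordge d f := forall m, (mdeg m < d)%N -> f m = 0.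

Lemma ordge_idealP d : idealP (ordge d).
Proof.
split=> [//|f g Hf Hg m md|a f Hf m md]; first by rewrite fpsD Hf // Hg // addr0.
rewrite (fpsME _ _ (leqnn _)) (@mcoeffM_congr _ _ (mdeg m) _ (fps_trunc (mdeg m) a) _ 0) //.
  by rewrite mulr0 mcoeff0.
by move=> l ld; rewrite mcoeff_trunc // mcoeff0 Hf // (leq_ltn_trans ld).
Qed.

Lemma ordge0 d : ordge d 0. Proof. by []. Qed.

Lemma ordge_leq d e f : (d <= e)%N -> ordge e f -> ordge d f.
Proof. by move=> de Hf m md; apply: Hf; apply: leq_trans de. Qed.

Lemma ordge_eq0 f : (forall d, ordge d f) -> f = 0.
Proof. by move=> Hf; apply: fpsP => m; apply: (Hf (mdeg m).+1). Qed.

Lemma fps_cauchy f g m : (f * g) m =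
  \sum_(k : 'X_{1..n < (mdeg m).+1, (mdeg m).+1} | m == (k.1 + k.2)%MM) f k.1 * g k.2.
Proof. by []. Qed.

Lemma ordgeM a b f g : ordge a f -> ordge b g -> ordge (a + b) (f * g).
Proof.
move=> Hf Hg m md; rewrite fps_cauchy big1 // => -[[k1 ?] [k2 ?]] /= /eqP mE.
have {}md : (mdeg k1 + mdeg k2 < a + b)%N by rewrite -mdegD -mE.
have [ka|ka] := ltnP (mdeg k1) a; first by rewrite Hf // mul0r.
rewrite Hg ?mulr0 // -(ltn_add2l a); apply: leq_ltn_trans md.
by rewrite leq_add2r.
Qed.

Lemma ordgeX a f d : ordge a f -> ordge (a * d) (f ^+ d).
Proof.
by move=> Hf; elim: d => [|d IHd]; [rewrite muln0|rewrite mulnS exprS; exact: ordgeM].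
Qed.

Definition fmon m : {fps R[n]} := FPS (fun l => (l == m)%:R).

Lemma fpsX_mon (i : 'I_n) : fpsX R i = fmon U_(i)%MM. Proof. by []. Qed.

Lemma trunc_mon d m : (mdeg m <= d)%N -> fps_trunc d (fmon m) = 'X_[m].
Proof.
move=> md; apply/mpolyP => l; rewrite mcoeffX eq_sym.
have [ld|ld] := leqP (mdeg l) d; first by rewrite mcoeff_trunc.
have /negPf-> : l != m by apply: contraTneq ld => ->; rewrite -leqNgt.
rewrite /fps_trunc raddf_sum big1 // => k _ /=; rewrite mcoeffZ mcoeffX.
case: (_ =P l) => [kl|]; rewrite ?mulr0 //.
by move: (bmdeg k); rewrite kl ltnS => ld'; rewrite ltnNge ld' in ld.
Qed.

Lemma fmonM m f l :
  (fmon m * f) l = if (m <= l)%MM then f (l - m)%MM else 0.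
Proof.
rewrite fps_cauchy; case: ifP => [ml|ml]; last first.
  rewrite big1 // => -[[k1 ?] [k2 ?]] /= /eqP lE; case: eqP => [km|]; rewrite ?mul0r //.
  by have := lem_addr k1 k2; rewrite -lE km ml.
have m1 : (mdeg m < (mdeg l).+1)%N.
  by rewrite ltnS !mdegE leq_sum // => i _; move/mnm_lepP: ml.
have m2 : (mdeg (l - m)%MM < (mdeg l).+1)%N by rewrite ltnS mdegB.
rewrite (bigD1 (BMultinom m1, BMultinom m2)) /=; last by rewrite addmC submK.
rewrite eqxx mul1r big1 ?addr0 // => -[k1 k2] /= /andP[/eqP lE kn].
case: eqP => [km|]; rewrite ?mul0r //; case/negP: kn.
have k2E : (l - m)%MM = k2 by rewrite [X in (X - _)%MM]lE km addmC addmK.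
by rewrite xpair_eqE !bmeqP /= km k2E !eqxx.
Qed.

Lemma fmonD m m' : fmon m * fmon m' = fmon (m + m').
Proof.
apply: fpsP => l; rewrite fmonM /=; case: ifP => [ml|/negP ml].
  suff -> : ((l - m)%MM == m') = (l == (m + m')%MM) by [].
  apply/eqP/eqP => [<-|->]; first by rewrite addmC submK.
  by rewrite addmC addmK.
by case: eqP => // lE; case: ml; rewrite lE lem_addr.
Qed.

Lemma fmon0 : fmon 0 = 1. Proof. by apply: fpsP => m; rewrite fps1E. Qed.

Lemma fmon_ord m : ordge (mdeg m) (fmon m).
Proof. by move=> l /=; case: eqP => // ->; rewrite ltnn. Qed.

Lemma fps_taylor d f :
  ordge d (f - \sum_(m : 'X_{1..n < d}) f m *: fmon m).
Proof.
move=> l ld; rewrite fpsB fps_sumE (bigD1 (BMultinom ld)) //= eqxx mulr1 big1 ?addr0 ?subrr //.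
move=> k; rewrite -(inj_eq val_inj) /= eq_sym => /negPf ->; exact: mulr0.
Qed.

Lemma fps_scaleAl' a f : a *: f = fps_const n a * f.
Proof. by apply: fpsP => m; exact: (esym (fps_constM a f m)). Qed.

Lemma fps_derivE i f m : fps_deriv i f m = f (m + U_(i))%MM *+ (m i).+1.
Proof. by []. Qed.

Fact fps_deriv_linear i : linear (@fps_deriv n R i).
Proof.
move=> a f g; apply: fpsP => m.
by rewrite fps_derivE !fpsD !fpsZ fps_derivE mulrnDl mulrnAr.
Qed.
HB.instance Definition _ i := GRing.isLinear.Build R {fps R[n]} {fps R[n]} _
  (@fps_deriv n R i) (fps_deriv_linear i).

Lemma trunc_deriv d i f m : (mdeg m <= d)%N ->
  ((fps_trunc d.+1 f)^`M(i))@_m = fps_deriv i f m.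
Proof. by move=> md; rewrite mcoeff_deriv mcoeff_trunc // mdegD mdeg1 addn1. Qed.

Lemma fps_derivM i f g :
  fps_deriv i (f * g) = fps_deriv i f * g + f * fps_deriv i g.
Proof.
apply: fpsP => m; pose d := mdeg m.
have md : (mdeg (m + U_(i))%MM <= d.+1)%N by rewrite mdegD mdeg1 addn1.
rewrite fps_derivE (fpsME _ _ md) -mcoeff_deriv mderivM mcoeffD fpsD.
congr (_ + _); rewrite (fpsME _ _ (leqnn d)); apply: (@mcoeffM_congr _ _ d) => // l ld.
- by rewrite trunc_deriv // mcoeff_trunc.
- by rewrite !mcoeff_trunc // (leq_trans ld).
- by rewrite !mcoeff_trunc // (leq_trans ld).
- by rewrite trunc_deriv // mcoeff_trunc.
Qed.

Lemma fps_derivX (i j : 'I_n) : fps_deriv i (fpsX R j) = (i == j)%:R.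
Proof.
apply: fpsP => m; rewrite fps_derivE /=.
have -> : (i == j)%:R = (i == j)%:R *: (1 : {fps R[n]}) by rewrite scaler_nat.
rewrite fpsZ fps1E; case: (eqVneq i j) => [->|ij].
  rewrite mul1r -[X in _ == X]add0m eqm_add2r; case: eqP => [->|]; rewrite ?mul0rn //.
  by rewrite mnm0E.
rewrite mul0r; case: eqP => [/mnmP/(_ i)|]; rewrite ?mul0rn //.
by rewrite mnmDE !mnm1E eqxx addn1 eq_sym (negPf ij).
Qed.

Lemma ordge_deriv d i f : ordge d.+1 f -> ordge d (fps_deriv i f).
Proof.
by move=> Hf m md; rewrite fps_derivE Hf ?mul0rn // mdegD mdeg1 addn1 ltnS.
Qed.

End FpsBasics.
Arguments ordge {n R}.
Arguments ordge_idealP {n R}.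
Arguments ordge0 {n R}.
Arguments fmon {n R}.
Arguments fmon_ord {n R}.
Arguments fmonD {n R}.
Arguments fmon0 {n R}.

(** * The maximal ideal, units and Nakayama's lemma *)

Section FpsMax.
Variables (n : nat) (R : comNzRingType).
Implicit Types (f g : {fps R[n]}) (m : 'X_{1..n}).

Lemma ordge_ipow d f : ordge d f -> ipow (@fpsX n R) d f.
Proof.
elim: d f => [|d IHd] f Hf //=.
(* [pick] assigns every monomial to a single variable dividing it, so that no term is counted
   twice. *)
pose s i : {fps R[n]} := FPS (fun m => if [pick j | (m + U_(i))%MM j != 0%N] == Some i
  then f (m + U_(i))%MM else 0).
exists s; split=> [i|].
  apply: IHd => m md /=; case: ifP => // _; apply: Hf.
  by rewrite mdegD mdeg1 addn1.
apply: fpsP => m; rewrite fps_sumE.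
have sE i : (fpsX R i * s i) m =
    if [pick j | m j != 0%N] == Some i then f m else 0.
  rewrite fpsX_mon fmonM; case: ifP => [im|im] /=; first by rewrite submK.
  case: pickP => [j mj|//]; case: eqP => // -[ji]; move: mj; rewrite ji.
  case/negP; apply/eqP; apply/eqP; rewrite eqn0Ngt lt0n; apply/negP => mi.
  by case/negP: im; rewrite lep1mP.
under eq_bigr do rewrite sE.
case: pickP => [j mj|m0].
  rewrite (bigD1 j) //= eqxx big1 ?addr0 // => i ij.
  by rewrite (inj_eq Some_inj) eq_sym (negPf ij).
rewrite big1 // Hf //; suff -> : m = 0%MM by rewrite mdeg0.
by apply/mnmP => i; rewrite mnm0E; apply/eqP; have := m0 i; move/negbFE.
Qed.

Lemma ipow_ordge r (G : 'I_r -> {fps R[n]}) d f :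
  (forall i, ordge 1 (G i)) -> ipow G d f -> ordge d f.
Proof.
move=> HG; elim: d f => [|d IHd] f //= [s [Hs ->]].
apply: (idealP_sum _ (ordge_idealP _)) => i _.
by rewrite -add1n; apply: ordgeM; [exact: HG|exact: IHd].
Qed.

Lemma fpsX_ord (i : 'I_n) : ordge 1 (fpsX R i).
Proof. by rewrite fpsX_mon -(mdeg1 i); exact: fmon_ord. Qed.

Lemma ordge1P f : ordge 1 f <-> f 0%MM = 0.
Proof.
split=> [->//|f0 m]; first by rewrite mdeg0.
by rewrite ltnS leqn0 mdeg_eq0 => /eqP ->.
Qed.

Lemma fps_const_coef (a : R) : (fps_const n a) 0%MM = a.
Proof. by rewrite /= eqxx. Qed.

Fact fps_const_additive : additive (@fps_const n R).
Proof.
by move=> a b; apply: fpsP => m; rewrite fpsB /=; case: eqP; rewrite ?subr0.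
Qed.
HB.instance Definition _ := GRing.isAdditive.Build R {fps R[n]} (@fps_const n R)
  fps_const_additive.
Fact fps_const_multiplicative : multiplicative (@fps_const n R).
Proof.
split=> [a b|//]; apply: fpsP => m; rewrite [RHS]fps_constM /=.
by case: eqP; rewrite ?mulr0.
Qed.
HB.instance Definition _ := GRing.isMultiplicative.Build R {fps R[n]}
  (@fps_const n R) fps_const_multiplicative.

Definition fps_ev0 f : R := f 0%MM.
Fact fps_ev0_additive : additive fps_ev0. Proof. by []. Qed.
HB.instance Definition _ := GRing.isAdditive.Build {fps R[n]} R fps_ev0
  fps_ev0_additive.
Fact fps_ev0_multiplicative : multiplicative fps_ev0.
Proof.
split=> [f g|]; last by rewrite /fps_ev0 fps1E eqxx.
rewrite /fps_ev0 -[f in LHS](subrK (fps_const n (f 0%MM))) mulrDl fpsD.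
have -> : (fps_const n (f 0%MM) * g) 0%MM = f 0%MM * g 0%MM by exact: fps_constM.
rewrite -[RHS]add0r; congr (_ + _); apply/ordge1P; rewrite mulrC.
apply: (idealPM _ (ordge_idealP _)); apply/ordge1P.
by rewrite fpsB fps_const_coef subrr.
Qed.
HB.instance Definition _ := GRing.isMultiplicative.Build {fps R[n]} R fps_ev0
  fps_ev0_multiplicative.

Lemma fps_geom f : ordge 1 f -> exists g, (1 - f) * g = 1.
Proof.
move=> Hf; pose S d := \sum_(i < d) f ^+ i.
(* The coefficient at [m] of the geometric series is already that of its partial sum of
   [(mdeg m).+1] terms. *)
pose g : {fps R[n]} := FPS (fun m => S (mdeg m).+1 m).
have gS d : ordge d (g - S d).
  move=> m md; rewrite fpsB /= /S -(subnK md) addnC.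
  rewrite [X in _ - fcoef X m](_ : _ = S (mdeg m).+1 + \sum_(i < d - (mdeg m).+1) f ^+ ((mdeg m).+1 + i)).
    rewrite fpsD opprD addrA subrr add0r fps_sumE big1 ?oppr0 // => i _.
    have := @ordgeX _ _ 1 f ((mdeg m).+1 + i) Hf; rewrite mul1n; apply.
    by rewrite ltnS leq_addr.
  by rewrite big_split_ord.
exists g; apply/eqP; rewrite -subr_eq0; apply/eqP/ordge_eq0 => d.
have -> : (1 - f) * g - 1 = (1 - f) * (g - S d) - f ^+ d.
  rewrite mulrBr; have -> : (1 - f) * S d = 1 - f ^+ d.
    by rewrite -opprB mulNr -subrX1 opprB.
  by rewrite opprB -[RHS]addrA; congr (_ + _); rewrite addrAC subrr add0r.
apply: (idealPB (ordge_idealP d)); first exact: (idealPM _ (ordge_idealP d)).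
by have := @ordgeX _ _ 1 f d Hf; rewrite mul1n.
Qed.

(** Determinant trick: with [B = 1 - C] the entries of [B Y] lie in [L], hence so do those of
    [det B] times [Y], and [det B] is a unit because its constant term is 1. *)
Lemma nakayama (T : finType) (Y : T -> {fps R[n]}) (L : {fps R[n]} -> Prop) :
  idealP L ->
  (forall t, exists c : T -> {fps R[n]}, (forall t', ordge 1 (c t')) /\
     L (Y t - \sum_t' c t' * Y t')) ->
  forall t, L (Y t).
Proof.
move=> iL HY; have [c Hc] := choice HY.
pose C := \matrix_(i < #|T|, j < #|T|) c (enum_val i) (enum_val j).
pose B := 1%:M - C; pose y := \col_(i < #|T|) Y (enum_val i).
have By i : L ((B *m y) i 0).
  rewrite mulmxBl mul1mx !mxE; have [_] := Hc (enum_val i).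
  congr (L (_ - _)); rewrite (big_enum_val (A := T)) /=.
  by apply: eq_bigr => j _; rewrite !mxE.
have detB : ordge 1 (1 - \det B).
  apply/ordge1P; rewrite fpsB fps1E eqxx -[_ 0%MM]/(fps_ev0 _) -det_map_mx.
  suff -> : map_mx fps_ev0 B = 1%:M by rewrite det1 subrr.
  rewrite map_mxB map_mx1; apply/matrixP => i j; rewrite !mxE.
  rewrite [X in _ - X](_ : _ = 0) ?subr0 //.
  by have [/(_ (enum_val j)) /ordge1P] := Hc (enum_val i).
have [g] := fps_geom detB; rewrite opprB addrC subrK => gB t.
have Ly i : L (\det B * y i 0).
  have -> : \det B * y i 0 = (\adj B *m (B *m y)) i 0.
    by rewrite mulmxA mul_adj_mx mul_scalar_mx [RHS]mxE.
  by rewrite mxE; apply: (idealP_sum _ iL) => j _; apply: (idealPM _ iL).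
have := idealPM g iL (Ly (enum_rank t)).
by rewrite mulrA [g * _]mulrC gB mul1r mxE enum_rankK.
Qed.

(** Nakayama for the ideal of series of order at least [K]: on its finitely many generators, an
    element of order [K.+1] has coefficients without constant term. *)
Lemma ord_nakayama (L : {fps R[n]} -> Prop) K : idealP L ->
  (forall z, ordge K z -> exists y, L (z - y) /\ ordge K.+1 y) ->
  forall z, ordge K z -> L z.
Proof.
move=> iL HL z /ordge_ipow Hz.
have [T [Y [HY gY]]] := ipow_fg (@fpsX n R) K.
suff LY t : L (Y t).
  by have [s ->] := gY _ Hz; apply: (idealP_sum _ iL) => t _; exact: idealPM.
apply: (nakayama (Y := Y) iL) => {}t.
have [|y [Ly /ordge_ipow [s [Hs yE]]]] := HL (Y t).
  exact: ipow_ordge fpsX_ord (HY t).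
have [u Hu] := choice (fun i => gY (s i) (Hs i)).
exists (fun t' => \sum_i fpsX R i * u i t'); split=> [t'|].
  apply: (idealP_sum _ (ordge_idealP _)) => i _; rewrite mulrC.
  exact: (idealPM _ (ordge_idealP _) (fpsX_ord i)).
move: Ly; congr (L (_ - _)); rewrite yE.
under [RHS]eq_bigr do rewrite mulr_suml.
rewrite exchange_big; apply: eq_bigr => i _; rewrite [in LHS](Hu i) mulr_sumr.
by apply: eq_bigr => t' _; rewrite mulrA.
Qed.

End FpsMax.
Arguments ordge_ipow {n R}.
Arguments fpsX_ord {n R}.

(** * Power series over a domain form a domain *)

Section FpsDomain.
Variables (n : nat) (R : idomainType).
Implicit Types (f g : {fps R[n]}) (m : 'X_{1..n}).

Lemma fps_neq0 f : f != 0 -> exists m, f m != 0 /\ ordge (mdeg m) f.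
Proof.
move=> f0.
have ex : exists d, `[< exists m, f m != 0 /\ mdeg m = d >].
  apply: contrapT => H; case/eqP: f0; apply: fpsP => m; rewrite fps0E.
  apply/eqP/negPn/negP => fm; apply: H; exists (mdeg m); apply/asboolP.
  by exists m.
case: (ex_minnP ex) => d /asboolP[m [fm md]] dmin; exists m; split=> // l ld.
apply/eqP/negPn/negP => fl; suff : (d <= mdeg l)%N by rewrite leqNgt -md ld.
by apply: dmin; apply/asboolP; exists l.
Qed.

Lemma trunc_low d f m : ordge d f -> (mdeg m <> d) ->  (fps_trunc d f)@_m = 0.
Proof.
move=> Hf md; have [lt|le] := ltnP (mdeg m) d.
  by rewrite mcoeff_trunc ?Hf // ltnW.
rewrite /fps_trunc raddf_sum big1 // => k _ /=; rewrite mcoeffZ mcoeffX.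
case: (_ =P m) => [kl|]; rewrite ?mulr0 //.
move: (bmdeg k); rewrite kl ltnS => le'; case: md.
by apply/eqP; rewrite eqn_leq le le'.
Qed.

(** Truncated at its order, a nonzero series is its initial form. The product of the initial forms
    is the part of [f * g] of lowest possible degree, and it is nonzero in the polynomial ring. *)
Fact fps_integral f g : f * g = 0 -> (f == 0) || (g == 0).
Proof.
move=> fg0; apply/norP => -[] /fps_neq0[a [fa Ha]] /fps_neq0[b [gb Hb]].
pose d := mdeg a; pose e := mdeg b.
have : fps_trunc d f * fps_trunc e g != 0.
  rewrite mulf_neq0 //; apply/eqP => /(congr1 (mcoeff _)).
    by move/(_ a)/eqP; rewrite mcoeff_trunc // mcoeff0 (negPf fa).
  by move/(_ b)/eqP; rewrite mcoeff_trunc // mcoeff0 (negPf gb).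
case/eqP; apply/mpolyP => m; rewrite mcoeff0 mcoeffM.
have [mde|mde] := eqVneq (mdeg m) (d + e)%N; last first.
  rewrite big1 // => -[[k1 ?] [k2 ?]] /= /eqP mE.
  have [k1d|k1d] := eqVneq (mdeg k1) d; last by rewrite trunc_low ?mul0r //; apply/eqP.
  rewrite [X in _ * X]trunc_low ?mulr0 // => k2e.
  by case/eqP: mde; rewrite mE mdegD k1d k2e.
have := congr1 (fun h : {fps R[n]} => h m) fg0.
rewrite fps0E fps_cauchy => fgm; rewrite -[RHS]fgm.
apply: eq_bigr => -[[k1 ?] [k2 ?]] /= /eqP mE.
have : (mdeg k1 + mdeg k2 = d + e)%N by rewrite -mdegD -mE.
have [k1d|k1d|k1d] := ltngtP (mdeg k1) d.
- by rewrite Ha // mcoeff_trunc ?(ltnW k1d) // Ha // !mul0r.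
- move=> kde; have k2e : (mdeg k2 < e)%N.
    by rewrite -(ltn_add2l d) -kde ltn_add2r.
  by rewrite (mcoeff_trunc _ (ltnW k2e)) (Hb k2) // !mulr0.
- by rewrite -k1d => /addnI k2e; rewrite !mcoeff_trunc // ?k1d ?k2e.
Qed.

Definition fps_unit : pred {fps R[n]} := fun f => `[< exists g, g * f = 1 >].
Definition fps_inv f : {fps R[n]} :=
  if pselect (exists g, g * f = 1) is left ex then projT1 (cid ex) else f.
Fact fps_mulVf : {in fps_unit, left_inverse 1 fps_inv *%R}.
Proof.
move=> f /asboolP Uf; rewrite /fps_inv; case: pselect => // ex.
by case: cid.
Qed.
Fact fps_unitP f g : g * f = 1 -> fps_unit f.
Proof. by move=> gf; apply/asboolP; exists g. Qed.
Fact fps_inv_out : {in [predC fps_unit], fps_inv =1 id}.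
Proof.
move=> f /negP Uf; rewrite /fps_inv; case: pselect => // ex.
by case: Uf; apply/asboolP.
Qed.
HB.instance Definition _ := GRing.ComNzRing_hasMulInverse.Build {fps R[n]}
  fps_mulVf fps_unitP fps_inv_out.
HB.instance Definition _ := GRing.ComUnitRing_isIntegral.Build {fps R[n]}
  fps_integral.
End FpsDomain.

Lemma idealP_submodP (k : fieldType) n (L : {fps k[n]} -> Prop) :
  idealP L -> submodP L.
Proof.
move=> iL; split=> [|a x y Lx Ly]; first by case: iL.
by apply: idealPD => //; rewrite fps_scaleAl'; apply: idealPM.
Qed.

(** * Frobenius *)

Lemma fps_pchar n (k : comNzRingType) p : p \in [pchar k] -> p \in [pchar {fps k[n]}].
Proof. exact: (rmorph_pchar (@fps_const n k)). Qed.

Section Frobenius.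
Variables (n p e : nat) (k : closedFieldType).
Hypothesis pP : p \in [pchar k].
Let q := (p ^ e)%N.

Lemma q_gt0 : (0 < q)%N.
Proof. by rewrite expn_gt0 prime_gt0 // (pcharf_prime pP). Qed.

Lemma pnat_q (A : comNzRingType) : p \in [pchar A] -> [pchar A].-nat q.
Proof. by move=> pA; rewrite pnatX pnatE ?(pcharf_prime pP) // pA. Qed.

Lemma frobD (A : comNzRingType) (x y : A) : p \in [pchar A] ->
  (x + y) ^+ q = x ^+ q + y ^+ q.
Proof. by move=> pA; rewrite exprDn_pchar // pnat_q. Qed.

Lemma frob_sum (A : comNzRingType) (I : Type) (r : seq I) (P : pred I) (F : I -> A) :
  p \in [pchar A] -> (\sum_(i <- r | P i) F i) ^+ q = \sum_(i <- r | P i) F i ^+ q.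
Proof.
move=> pA; apply: (big_morph (fun x => x ^+ q)) => [x y|]; first exact: frobD.
by rewrite expr0n eqn0Ngt q_gt0.
Qed.

Lemma frob_inj (A : idomainType) (x y : A) : p \in [pchar A] ->
  x ^+ q = y ^+ q -> x = y.
Proof.
move=> pA xy; apply/eqP; rewrite -subr_eq0.
have : (x - y) ^+ q = 0.
  by apply: (addIr (y ^+ q)); rewrite -frobD // subrK add0r.
by move/eqP; rewrite expf_eq0 => /andP[].
Qed.

Fact root_ex (a : k) : exists c, c ^+ q == a.
Proof.
have [c Hc] := @solve_monicpoly k q (fun i => if i is 0%N then a else 0) q_gt0.
exists c; rewrite Hc; have := q_gt0; case: q => // q' _.
by rewrite big_ord_recl expr0 mulr1 big1 ?addr0 // => i _; rewrite mul0r.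
Qed.
(** The inverse of the [q]-th power map of [k], which exists because [k] is algebraically closed. *)
Definition rt a := xchoose (root_ex a).
Lemma rtK a : rt a ^+ q = a. Proof. exact/eqP/(xchooseP (root_ex a)). Qed.
Lemma rt_pow a : rt (a ^+ q) = a. Proof. by apply: (frob_inj pP); rewrite rtK. Qed.
Lemma rtD a b : rt (a + b) = rt a + rt b.
Proof. by apply: (frob_inj pP); rewrite frobD // !rtK. Qed.
Lemma rtM a b : rt (a * b) = rt a * rt b.
Proof. by apply: (frob_inj pP); rewrite exprMn !rtK. Qed.
Lemma rt0 : rt 0 = 0.
Proof. by apply: (frob_inj pP); rewrite rtK expr0n eqn0Ngt q_gt0. Qed.
Lemma rt1 : rt 1 = 1.
Proof. by apply: (frob_inj pP); rewrite rtK expr1n. Qed.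

Let pF : p \in [pchar {fps k[n]}] := fps_pchar n pP.
Local Notation box := {ffun 'I_n -> 'I_q}.
Implicit Types (f y z : {fps k[n]}) (a b : box).

Definition bm a : 'X_{1..n} := [multinom (a i : nat) | i < n].

Lemma bmE a i : bm a i = a i. Proof. by rewrite mnmE. Qed.

Lemma bm_inj : injective bm.
Proof.
move=> a b /mnmP ab; apply/ffunP => i; apply/val_inj.
by have := ab i; rewrite !bmE.
Qed.

(** The coordinates of [z] on the monomials [bm a], a basis of the ring over its [q]-th powers, with
    the [q]-th root already taken (Cartier operators); see [delta_rec]. *)
Definition delta a z : {fps k[n]} := FPS (fun m => rt (z (m *+ q + bm a)%MM)).

Lemma deltaE a z m : delta a z m = rt (z (m *+ q + bm a)%MM). Proof. by []. Qed.

Lemma deltaD a y z : delta a (y + z) = delta a y + delta a z.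
Proof. by apply: fpsP => m; rewrite fpsD !deltaE fpsD rtD. Qed.
Lemma delta0 a : delta a 0 = 0.
Proof. by apply: fpsP => m; rewrite deltaE fps0E rt0. Qed.
Lemma delta_sum a (I : Type) (r : seq I) (P : pred I) (F : I -> {fps k[n]}) :
  delta a (\sum_(i <- r | P i) F i) = \sum_(i <- r | P i) delta a (F i).
Proof. exact: (big_morph (delta a) (deltaD a) (delta0 a)). Qed.
Lemma deltaN a y : delta a (- y) = - delta a y.
Proof. by apply: (addrI (delta a y)); rewrite -deltaD !subrr delta0. Qed.
Lemma deltaZ a c z : delta a (c *: z) = rt c *: delta a z.
Proof. by apply: fpsP => m; rewrite fpsZ !deltaE fpsZ rtM. Qed.

Lemma delta_fmon a m z : delta a (fmon (m *+ q) * z) = fmon m * delta a z.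
Proof.
apply: fpsP => l; rewrite deltaE !fmonM.
have -> : (m *+ q <= l *+ q + bm a)%MM = (m <= l)%MM.
  apply/mnm_lepP/mnm_lepP => ml i; have := ml i; rewrite !(mnmDE, mulmnE, bmE).
    move=> H; rewrite -ltnS -(ltn_pmul2r q_gt0); apply: leq_ltn_trans H _.
    by rewrite mulSn addnC ltn_add2r.
  by move=> H; apply: leq_trans (leq_addr _ _); rewrite leq_mul2r H orbT.
case: ifP => ml; last by rewrite rt0.
rewrite deltaE; congr (rt (z _)); apply/mnmP => i.
rewrite !(mnmBE, mnmDE, mulmnE, bmE) mulnBl addnBAC // leq_mul2r.
by move/mnm_lepP: ml => /(_ i) ->; rewrite orbT.
Qed.

Lemma fmonXq m : fmon m ^+ q = fmon (m *+ q) :> {fps k[n]}.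
Proof.
elim: q => [|r IHr]; first by rewrite mulm0n fmon0.
by rewrite exprS IHr fmonD mulmS.
Qed.

Lemma delta_ord a d z : ordge (d * q + n * q) z -> ordge d (delta a z).
Proof.
move=> Hz m md; rewrite deltaE Hz ?rt0 //.
rewrite mdegD mdegMn -addSn leq_add // ?ltn_mul2r ?q_gt0 //.
rewrite mdegE -[X in (_ <= X * _)%N]card_ord -sum_nat_const leq_sum // => i _.
by rewrite bmE ltnW.
Qed.

(** For a polynomial [y] this is checked on monomials; the general case follows by continuity with
    respect to the order. *)
Lemma delta_pow a y z : delta a (y ^+ q * z) = y * delta a z.
Proof.
apply/eqP; rewrite -subr_eq0; apply/eqP/ordge_eq0 => d.
(* Box monomials may have degree close to [n * q], so [delta_ord] loses [n] orders. *)
pose D := (d + n)%N; pose t := \sum_(m : 'X_{1..n < D}) y m *: fmon m.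
have yt : ordge D (y - t) := @fps_taylor _ _ D y.
have Ht : delta a (t ^+ q * z) = t * delta a z.
  rewrite /t frob_sum // !mulr_suml delta_sum; apply: eq_bigr => m _.
  rewrite exprZn fmonXq -!scalerAl deltaZ delta_fmon.
  by congr (_ *: _); exact: rt_pow.
have -> : delta a (y ^+ q * z) - y * delta a z =
    delta a ((y - t) ^+ q * z) - (y - t) * delta a z.
  rewrite -{1 2}(subrK t y); set u := y - t.
  by rewrite frobD // !mulrDl deltaD Ht opprD addrACA subrr addr0.
apply: (idealPB (ordge_idealP d)).
  apply: delta_ord; rewrite mulrC; apply: (idealPM _ (ordge_idealP _)).
  by rewrite -mulnDl; exact: ordgeX.
rewrite mulrC; apply: (idealPM _ (ordge_idealP _)).
by apply: ordge_leq yt; exact: leq_addr.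
Qed.

Lemma delta_bm a b : delta a (fmon (bm b)) = (a == b)%:R.
Proof.
apply: fpsP => m; rewrite deltaE /=.
have -> : (a == b)%:R = (a == b)%:R *: (1 : {fps k[n]}) by rewrite scaler_nat.
rewrite fpsZ fps1E.
case: (eqVneq m 0%MM) => [->|m0].
  rewrite (_ : (0 *+ q + bm a)%MM = bm a); last first.
    by apply/mnmP => i; rewrite mnmDE mulmnE mnm0E.
  rewrite (inj_eq bm_inj) mulr1.
  by case: (a == b); rewrite ?rt1 ?rt0.
rewrite mulr0; case: eqP => [/mnmP E|]; rewrite ?rt0 //.
case/eqP: m0; apply/mnmP => i; have := E i; rewrite mnmDE mulmnE !bmE mnm0E => Ei.
have := ltn_ord (b i); rewrite -Ei; case: (m i) => // l; rewrite mulSn -addnA.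
by rewrite ltnNge leq_addr.
Qed.

Lemma delta_inj y z : (forall a, delta a y = delta a z) -> y = z.
Proof.
move=> yz; apply: fpsP => m.
pose a : box := [ffun i => Ordinal (ltn_pmod (m i) q_gt0)].
pose l : 'X_{1..n} := [multinom (m i %/ q)%N | i < n].
have mE : m = (l *+ q + bm a)%MM.
  by apply/mnmP => i; rewrite mnmDE mulmnE bmE mnmE ffunE /= -divn_eq.
have := congr1 (fun f : {fps k[n]} => f l) (yz a); rewrite !deltaE -mE => E.
by rewrite -(rtK (y m)) E rtK.
Qed.

Lemma delta_rec z : z = \sum_a delta a z ^+ q * fmon (bm a).
Proof.
apply: delta_inj => b; rewrite delta_sum.
under eq_bigr do rewrite delta_pow delta_bm.
rewrite (bigD1 b) //= eqxx mulr1 big1 ?addr0 // => a ab.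
by rewrite eq_sym (negPf ab) mulr0.
Qed.

(* The ideal generated by the [q]-th powers of the elements of [L]. *)
Definition frob (L : {fps k[n]} -> Prop) z := forall a, L (delta a z).

Lemma frob_ideal L : idealP L -> idealP (frob L).
Proof.
move=> iL; split=> [a|y z Hy Hz a|y z Hz a].
- by rewrite delta0; case: iL.
- by rewrite deltaD; apply: idealPD.
rewrite [z]delta_rec mulr_sumr delta_sum; apply: (idealP_sum _ iL) => b _.
by rewrite mulrCA delta_pow mulrC; apply: idealPM.
Qed.

Lemma frob_pow (L : {fps k[n]} -> Prop) y : idealP L -> L y -> frob L (y ^+ q).
Proof.
by move=> iL Ly a; rewrite -[y ^+ q]mulr1 delta_pow mulrC; apply: idealPM.
Qed.

Lemma frob_gen r (G : 'I_r -> {fps k[n]}) z :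
  frob (ipow G 1) z <-> ipow (fun i => G i ^+ q) 1 z.
Proof.
split=> [Hz|]; last first.
  apply: ipow1_sub => [|i]; first exact/frob_ideal/ipow_ideal.
  exact: (frob_pow (ipow_ideal _ _) (ipow_gen1 _ _)).
rewrite [z]delta_rec; apply: (idealP_sum _ (ipow_ideal _ _)) => a _.
rewrite mulrC; apply: (idealPM _ (ipow_ideal _ _)).
have [s [_ ->]] := Hz a; exists (fun i => s i ^+ q); split=> //.
by rewrite frob_sum //; apply: eq_bigr => i _; rewrite exprMn.
Qed.

Definition frob_fam (T : finType) (v : T -> {fps k[n]}) (at_ : box * T) :=
  v at_.2 ^+ q * fmon (bm at_.1).

Lemma delta_fam (T : finType) (v : T -> {fps k[n]}) (c : box * T -> k) a :
  delta a (\sum_u c u *: frob_fam v u) = \sum_t rt (c (a, t)) *: v t.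
Proof.
rewrite delta_sum (_ : \sum_u _ =
    \sum_b \sum_t delta a (c (b, t) *: frob_fam v (b, t))); last first.
  by rewrite pair_bigA; apply: eq_bigr => -[b t].
rewrite (bigD1 a) //= [X in _ + X]big1 ?addr0 => [|b ba].
  by apply: eq_bigr => t _; rewrite deltaZ delta_pow delta_bm eqxx mulr1.
rewrite big1 // => t _; rewrite deltaZ delta_pow delta_bm eq_sym (negPf ba).
by rewrite mulr0 scaler0.
Qed.

(** Membership in [frob L] is tested on each coordinate [delta a] separately, so a basis modulo [L]
    yields one modulo [frob L] with [q ^ n] times as many elements. *)
Lemma frob_spans (L : {fps k[n]} -> Prop) (T : finType) (v : T -> {fps k[n]}) :
  spans L v -> spans (frob L) (frob_fam v).
Proof.
move=> sv z; have [c Hc] := choice (fun a => sv (delta a z)).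
exists (fun u => c u.1 u.2 ^+ q) => a; rewrite deltaD deltaN delta_fam.
by have := Hc a; congr (L (_ - _)); apply: eq_bigr => t _; rewrite rt_pow.
Qed.

Lemma frob_indep (L : {fps k[n]} -> Prop) (T : finType) (v : T -> {fps k[n]}) :
  indep L v -> indep (frob L) (frob_fam v).
Proof.
move=> iv c Hc [a t]; rewrite -[c _]rtK.
by have := Hc a; rewrite delta_fam => /iv ->; rewrite expr0n eqn0Ngt q_gt0.
Qed.

Lemma card_frob_fam (T : finType) : #|{: box * T}| = (q ^ n * #|T|)%N.
Proof. by rewrite card_prod card_ffun !card_ord. Qed.

End Frobenius.

(** * Substitution of power series *)

Section Composition.
Variables (n : nat) (k : comNzRingType) (U : 'I_n -> {fps k[n]}).
Hypothesis U1 : forall i, ordge 1 (U i).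

Definition lowdeg d (P : {mpoly k[n]}) := forall m, (mdeg m < d)%N -> P@_m = 0.

Lemma lowdeg0 d : lowdeg d 0. Proof. by move=> m _; rewrite mcoeff0. Qed.
Lemma lowdegD d P Q : lowdeg d P -> lowdeg d Q -> lowdeg d (P + Q).
Proof. by move=> HP HQ m md; rewrite mcoeffD HP // HQ // addr0. Qed.
Lemma lowdegXM d i P : lowdeg d P -> lowdeg d.+1 ('X_i * P).
Proof.
move=> HP m md; rewrite mcoeffM big1 // => -[[k1 ?] [k2 ?]] /= /eqP mE.
rewrite mcoeffX; case: eqP => [k1E|]; rewrite ?mul0r // HP ?mulr0 //.
by move: md; rewrite mE -k1E mdegD mdeg1 add1n ltnS.
Qed.

Definition evU : {mpoly k[n]} -> {fps k[n]} := mmap (@fps_const n k) U.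
HB.instance Definition _ := GRing.RMorphism.on evU.

Lemma evUX i : evU 'X_i = U i. Proof. by rewrite /evU mmapX mmap1U. Qed.
Lemma evUC c : evU c%:MP = fps_const n c. Proof. exact: mmapC. Qed.
Lemma evUXm m : evU 'X_[m] = mmap1 U m. Proof. exact: mmapX. Qed.
Lemma evUZ c P : evU (c *: P) = c *: evU P.
Proof. by rewrite -mul_mpolyC rmorphM /= evUC fps_scaleAl'. Qed.

Lemma ipow_mmap1 m : ipow U (mdeg m) (mmap1 U m).
Proof.
rewrite mdegE /mmap1; elim/big_rec2: _ => // i d x _ Hx.
apply: ipowM => //; have := @ipowX _ _ U 1 (U i) (m i) (ipow_gen1 U i).
by rewrite mul1n.
Qed.

Lemma ipow_ev d P : lowdeg d P -> ipow U d (evU P).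
Proof.
move=> HP; rewrite /evU /mmap; apply: (idealP_sum _ (ipow_ideal _ _)) => m _.
have [md|md] := ltnP (mdeg m) d.
  by rewrite HP // rmorph0 mul0r; case: (ipow_ideal U d).
by apply: (idealPM _ (ipow_ideal _ _)); apply: ipow_leq md _; exact: ipow_mmap1.
Qed.

Lemma ordge_ev d P : lowdeg d P -> ordge d (evU P).
Proof. by move=> HP; apply: ipow_ordge U1 _; exact: ipow_ev. Qed.

Lemma ipow_mon_ind d (L : {fps k[n]} -> Prop) : idealP L ->
  (forall m, mdeg m = d -> L (mmap1 U m)) -> forall z, ipow U d z -> L z.
Proof.
elim: d L => [|d IHd] L iL HL z.
  by move=> _; rewrite -[z]mulr1; apply: (idealPM _ iL); rewrite -(mmap11 U); apply: HL; rewrite mdeg0.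
move=> [s [Hs ->]]; apply: (idealP_sum _ iL) => i _.
apply: (IHd (fun y => L (U i * y))) (Hs i) => [|m md].
  split=> [|x y|a x]; first by rewrite mulr0; case: iL.
    by rewrite mulrDr; exact: idealPD.
  by rewrite mulrCA; exact: idealPM.
rewrite -(mmap1U U i) -commr_mmap1_M; last by move=> *; exact: mulrC.
by apply: HL; rewrite mdegD mdeg1 md.
Qed.

(* The coefficients of degree [d] depend only on the truncation of [a] at [d],
   because the [U i] have no constant term. *)
Definition fps_comp (a : {fps k[n]}) : {fps k[n]} :=
  FPS (fun m => evU (fps_trunc (mdeg m) a) m).

Lemma trunc_diff d d' a : (d <= d')%N -> lowdeg d.+1 (fps_trunc d a - fps_trunc d' a).
Proof.
move=> dd' m; rewrite ltnS => md.
by rewrite mcoeffB !mcoeff_trunc ?subrr // (leq_trans md).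
Qed.

Lemma comp_ev d a : ordge d.+1 (fps_comp a - evU (fps_trunc d a)).
Proof.
move=> m; rewrite ltnS => md; rewrite fpsB /= -fpsB -rmorphB /=.
by apply: (ordge_ev (trunc_diff a md)).
Qed.

Lemma comp_uniq a z : (forall d, ordge d.+1 (z - evU (fps_trunc d a))) -> fps_comp a = z.
Proof.
move=> Hz; apply/eqP; rewrite -subr_eq0; apply/eqP/ordge_eq0 => -[|d]; first by [].
have -> : fps_comp a - z = (fps_comp a - evU (fps_trunc d a)) - (z - evU (fps_trunc d a)).
  by rewrite opprB addrA subrK.
by apply: (idealPB (ordge_idealP _)) (Hz d); exact: comp_ev.
Qed.

Fact comp_additive : additive fps_comp.
Proof.
move=> a b; apply: comp_uniq => d.
have -> : fps_trunc d (a - b) = fps_trunc d a - fps_trunc d b.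
  by rewrite /fps_trunc -sumrB; apply: eq_bigr => m _; rewrite fpsB scalerBl.
rewrite rmorphB opprD addrACA -opprD.
by apply: (idealPB (ordge_idealP _)); exact: comp_ev.
Qed.
HB.instance Definition _ := GRing.isAdditive.Build {fps k[n]} {fps k[n]} fps_comp
  comp_additive.

Fact comp_multiplicative : multiplicative fps_comp.
Proof.
split=> [a b|]; apply: comp_uniq => d; last first.
  rewrite (_ : fps_trunc d 1 = 1) ?rmorph1 ?subrr; first exact: ordge0.
  apply/mpolyP => m; have [md|md] := leqP (mdeg m) d.
    by rewrite mcoeff_trunc // fps1E mcoeff1.
  rewrite mcoeff1 /fps_trunc raddf_sum big1 => [|l _].
    by case: eqP md => // ->; rewrite mdeg0.
  rewrite /= mcoeffZ mcoeffX; case: (_ =P m) => [lm|]; rewrite ?mulr0 //.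
  by move: (bmdeg l); rewrite lm ltnS leqNgt md.
pose ta := fps_trunc d a; pose tb := fps_trunc d b.
have -> : fps_comp a * fps_comp b - evU (fps_trunc d (a * b)) =
   (fps_comp a - evU ta) * fps_comp b + evU ta * (fps_comp b - evU tb)
   + evU (ta * tb - fps_trunc d (a * b)).
  rewrite mulrBl mulrBr !rmorphB /= rmorphM /=.
  by rewrite -!addrA; congr (_ + _); rewrite addKr addrA addNr add0r.
apply: (idealPD (ordge_idealP _)).
  apply: (idealPD (ordge_idealP _)); last first.
    by apply: (idealPM _ (ordge_idealP _)); exact: comp_ev.
  by rewrite mulrC; apply: (idealPM _ (ordge_idealP _)); exact: comp_ev.
apply: ordge_ev => m; rewrite ltnS => md.
by rewrite mcoeffB -mcoeff_truncM // subrr.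
Qed.
HB.instance Definition _ := GRing.isMultiplicative.Build {fps k[n]} {fps k[n]} fps_comp
  comp_multiplicative.

Lemma compX i : fps_comp (fpsX k i) = U i.
Proof.
apply: comp_uniq => -[|d].
  rewrite (_ : fps_trunc 0 _ = 0) ?rmorph0 ?subr0 //.
  rewrite /fps_trunc big1 // => -[m /= md].
  by case: eqP => [mU|]; rewrite ?scale0r //; move: md; rewrite mU mdeg1.
by rewrite fpsX_mon trunc_mon ?mdeg1 // evUX subrr; exact: ordge0.
Qed.

Variable K : nat.
Hypothesis HK : forall z, ordge K z -> ipow U 1 z.

Lemma ordge_ipowU d z : ordge (K * d) z -> ipow U d z.
Proof.
move=> /ordge_ipow; elim: d z => [|d IHd] z //; rewrite mulnS => Hz.
have [L0 LD LM] := ipow_ideal U d.+1.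
apply: (ipow_prod_ind (L := ipow U d.+1) _ _ _ Hz) => [|x y|s t Hs Ht].
- exact: L0.
- exact: LD.
rewrite -add1n; apply: ipowM (IHd _ Ht).
exact/HK/(ipow_ordge fpsX_ord Hs).
Qed.

(** [comp_ev] bounds this error only in the order. Cutting at a far larger degree [D] makes the tail
    fall into [ipow U d.+1] by [ordge_ipowU], and the polynomial between the two truncations has
    only monomials of degree above [d] in the [U i]. *)
Lemma comp_ipow d a : ipow U d.+1 (fps_comp a - evU (fps_trunc d a)).
Proof.
pose D := (K * d.+1 + d)%N.
have -> : fps_comp a - evU (fps_trunc d a) = (fps_comp a - evU (fps_trunc D a)) +
   evU (fps_trunc D a - fps_trunc d a) by rewrite rmorphB /= addrA subrK.
apply: (idealPD (ipow_ideal _ _)).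
  apply: ordge_ipowU; apply: (@ordge_leq _ _ _ D.+1); last exact: comp_ev.
  by rewrite leqW // leq_addr.
rewrite -opprB rmorphN /=; apply: (idealPN (ipow_ideal U d.+1)).
by apply/ipow_ev/trunc_diff/leq_addl.
Qed.

Lemma ipow_comp d a : ordge d a -> ipow U d (fps_comp a).
Proof.
case: d => [//|d] Ha; apply: (idealP_congr (ipow_ideal _ _) (comp_ipow d a)).
by apply: ipow_ev => m md; rewrite mcoeff_trunc // Ha.
Qed.

End Composition.

Lemma sub_via (V : zmodType) (x y z : V) : x - y = (z - y) - (z - x).
Proof. by rewrite opprB [RHS]addrC addrA subrK. Qed.

(** * Freeness of the power series ring over the series in the [U i] *)

Section Freeness.
Variables (n p : nat) (k : closedFieldType).
Hypothesis pP : p \in [pchar k].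
Variables (U : 'I_n -> {fps k[n]}) (T : finType) (b : T -> {fps k[n]}) (K : nat).
Hypothesis U1 : forall i, ordge 1 (U i).
Hypothesis HK : forall z, ordge K z -> ipow U 1 z.
Hypothesis sb : spans (ipow U 1) b.
Hypothesis ib : indep (ipow U 1) b.
Local Notation ev := (evU U).
Local Notation mp := {mpoly k[n]}.

Lemma ipow_step d z : ipow U d z -> exists P : T -> mp,
  (forall t, lowdeg d (P t)) /\ ipow U d.+1 (z - \sum_t ev (P t) * b t).
Proof.
elim: d z => [|d IHd] z.
  move=> _; have [c Hc] := sb z; exists (fun t => (c t)%:MP); split=> //.
  by under eq_bigr do rewrite evUC -fps_scaleAl'.
move=> [s [Hs ->]]; have [P HP] := choice (fun i => IHd _ (Hs i)).
exists (fun t => \sum_i 'X_i * P i t); split=> [t|].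
  elim/big_ind: _ => [|x y|i _]; [exact: lowdeg0|exact: lowdegD|].
  by have [HPi _] := HP i; exact: lowdegXM.
exists (fun i => s i - \sum_t ev (P i t) * b t); split=> [i|].
  by have [_] := HP i.
under [RHS]eq_bigr do rewrite mulrBr.
rewrite sumrB; congr (_ - _).
under eq_bigr do rewrite rmorph_sum mulr_suml.
rewrite exchange_big; apply: eq_bigr => i _; rewrite mulr_sumr.
by apply: eq_bigr => t _; rewrite rmorphM /= evUX mulrA.
Qed.

Lemma ipow_steps d M z : ipow U d z -> exists P : T -> mp,
  (forall t, lowdeg d (P t)) /\ ipow U (d + M) (z - \sum_t ev (P t) * b t).
Proof.
elim: M => [|M IHM] Hz.
  exists (fun=> 0); split=> [t|]; first exact: lowdeg0.
  by rewrite big1 ?subr0 ?addn0 // => t _; rewrite rmorph0 mul0r.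
have [P [HP Hd]] := IHM Hz; have [Q [HQ HM]] := ipow_step Hd.
exists (fun t => P t + Q t); split=> [t|].
  by apply: lowdegD => // m md; apply: HQ; apply: leq_trans md (leq_addr _ _).
rewrite addnS; move: HM; congr (ipow U _ _); rewrite -addrA -opprD -big_split.
by congr (_ - _); apply: eq_bigr => t _; rewrite rmorphD mulrDl.
Qed.

Section Box.
Variable e : nat.
Let q := (p ^ e)%N.
Local Notation box := {ffun 'I_n -> 'I_q}.
Definition boxfam (u : box * T) : {fps k[n]} := mmap1 U (bm u.1) * b u.2.
Local Notation Iq := (ipow (fun i => U i ^+ q) 1).

Lemma mmap1_notbox m : (forall a : box, m <> bm a) -> Iq (mmap1 U m).
Proof.
move=> Hm; have [i mi] : exists i, (q <= m i)%N.
  apply: contrapT => H.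
  have mq i : (m i < q)%N by rewrite ltnNge; apply/negP => mi; apply: H; exists i.
  by apply: (Hm [ffun i => Ordinal (mq i)]); apply/mnmP => i; rewrite bmE ffunE.
have iI := ipow_ideal (fun i => U i ^+ q) 1.
rewrite /mmap1 (bigD1 i) //= -(subnK mi) exprD mulrC.
by apply/(idealPM _ iI)/(idealPM _ iI)/(ipow_gen1 (fun i => U i ^+ q)).
Qed.

Lemma ev_box (L : {fps k[n]} -> Prop) d P : idealP L ->
  (forall m, (d <= mdeg m)%N -> (forall a : box, m <> bm a) -> L (mmap1 U m)) ->
  lowdeg d P -> L (ev P - \sum_(a : box) P@_(bm a) *: mmap1 U (bm a)).
Proof.
move=> iL HL; elim/mpolyind: P => [|c m P mP c0 IH] HP.
  rewrite rmorph0 big1 ?subr0 => [|a _]; last by rewrite mcoeff0 scale0r.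
  by case: iL.
have Pm : P@_m = 0 by apply: memN_msupp_eq0.
have dm : (d <= mdeg m)%N.
  rewrite leqNgt; apply/negP => /HP.
  by rewrite mcoeffD mcoeffZ mcoeffX eqxx mulr1 Pm addr0 => /eqP; rewrite (negPf c0).
have lP : lowdeg d P.
  move=> l ld; have [->//|lm] := eqVneq l m.
  by have := HP l ld; rewrite mcoeffD mcoeffZ mcoeffX eq_sym (negPf lm) mulr0 add0r.
have -> : ev (c *: 'X_[m] + P) - \sum_(a : box) (c *: 'X_[m] + P)@_(bm a) *: mmap1 U (bm a)
  = c *: (mmap1 U m - \sum_(a : box) (m == bm a :> 'X_{1..n})%:R *: mmap1 U (bm a)) +
    (ev P - \sum_(a : box) P@_(bm a) *: mmap1 U (bm a)).
  rewrite rmorphD /= evUZ evUXm scalerBr [RHS]addrACA -opprD; congr (_ - _).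
  rewrite scaler_sumr -big_split; apply: eq_bigr => a _.
  by rewrite mcoeffD mcoeffZ mcoeffX scalerDl scalerA.
apply: (idealPD iL); last exact: IH.
rewrite fps_scaleAl'; apply: (idealPM _ iL).
have [[a mE]|mN] := pselect (exists a : box, m = bm a).
  rewrite (bigD1 a) //= mE eqxx scale1r big1 ?addr0 ?subrr; first by case: iL.
  by move=> a' a'a; rewrite (inj_eq (@bm_inj _ _ _)) eq_sym (negPf a'a) scale0r.
rewrite big1 ?subr0 => [|a _]; first by apply: HL => // a mE; apply: mN; exists a.
by case: eqP => [mE|]; rewrite ?scale0r //; case: mN; exists a.
Qed.

Lemma ev_boxfam_gen (L : {fps k[n]} -> Prop) d (P : T -> mp) : idealP L ->
  (forall m, (d <= mdeg m)%N -> (forall a : box, m <> bm a) -> L (mmap1 U m)) ->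
  (forall t, lowdeg d (P t)) ->
  L (\sum_t ev (P t) * b t - \sum_(u : box * T) (P u.2)@_(bm u.1) *: boxfam u).
Proof.
move=> iL HL HP.
have -> : \sum_(u : box * T) (P u.2)@_(bm u.1) *: boxfam u =
   \sum_t (\sum_(a : box) (P t)@_(bm a) *: mmap1 U (bm a)) * b t.
  rewrite [RHS](eq_bigr _ (fun t _ => mulr_suml _ _ _ _)) exchange_big pair_bigA.
  by apply: eq_bigr => -[a t] _; rewrite /boxfam /= -scalerAl.
rewrite -sumrB; apply: (idealP_sum _ iL) => t _; rewrite -mulrBl mulrC.
by apply: (idealPM _ iL); exact: (ev_box iL HL (HP t)).
Qed.

Lemma ev_boxfam (P : T -> mp) :
  Iq (\sum_t ev (P t) * b t - \sum_(u : box * T) (P u.2)@_(bm u.1) *: boxfam u).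
Proof.
apply: (@ev_boxfam_gen _ 0); first exact: ipow_ideal.
  by move=> m _; exact: mmap1_notbox.
by move=> t m.
Qed.

Lemma ipow_big_box d z : (n * q < d)%N -> ipow U d z -> Iq z.
Proof.
move=> nd; apply: ipow_mon_ind => [|m md]; first exact: ipow_ideal.
apply: mmap1_notbox => a mE; move: nd; rewrite -md mE mdegE ltnNge.
rewrite -[X in (_ <= X * _)%N]card_ord -sum_nat_const leq_sum // => i _.
by rewrite bmE ltnW.
Qed.

Lemma ipow_boxspan d z : ipow U d z -> exists c : box * T -> k,
  (forall u, (mdeg (bm u.1) < d)%N -> c u = 0) /\ Iq (z - \sum_u c u *: boxfam u).
Proof.
move=> Hz; have [P [HP Hd]] := ipow_steps (n * q).+1 Hz.
exists (fun u => (P u.2)@_(bm u.1)); split=> [u|]; first exact: HP.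
have iI := ipow_ideal (fun i => U i ^+ q) 1.
apply: (idealP_congr iI) (ev_boxfam P).
rewrite opprB addrA subrK.
by apply: ipow_big_box Hd; rewrite addnS ltnS leq_addl.
Qed.

Lemma boxfam_spans : spans Iq boxfam.
Proof. by move=> z; have [//|c [_ Hc]] := @ipow_boxspan 0 z; exists c. Qed.

Lemma frob_indep_Iq : indep Iq (frob_fam (p := p) (e := e) b).
Proof.
have ie := @frob_indep n p e k pP _ _ _ ib.
by apply: (indep_sub _ ie) => z; rewrite frob_gen.
Qed.

(** The heart of freeness: [boxfam] spans modulo the [U i ^+ q] and has as many elements as
    [frob_fam b], which is independent because the ring is free over its [q]-th powers. *)
Lemma boxfam_indep : indep Iq boxfam.
Proof.
apply: (indep_of_spans (idealP_submodP (ipow_ideal _ 1)) frob_indep_Iq boxfam_spans).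
by rewrite leqnn.
Qed.

End Box.

Lemma ev_uniq d (P : T -> mp) : ipow U d (\sum_t ev (P t) * b t) ->
  forall t, lowdeg d (P t).
Proof.
(* With [e = d] one has [d < q], so every monomial of degree below [d] lies in the box and its
   coefficient is visible modulo the [U i ^+ q]. *)
move=> Hz t m md; pose e := d; pose q := (p ^ e)%N.
have dq : (d < q)%N by rewrite ltn_expl // prime_gt1 // (pcharf_prime pP).
have iI := ipow_ideal (fun i => U i ^+ q) 1.
have [c [c0 Hc]] := ipow_boxspan e Hz.
have H : ipow (fun i => U i ^+ q) 1
    (\sum_u (c u - (P u.2)@_(bm u.1)) *: boxfam (e := e) u).
  under eq_bigr do rewrite scalerBl.
  rewrite sumrB.
  rewrite (sub_via _ _ (\sum_t ev (P t) * b t)).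
  exact: (idealPB iI (ev_boxfam e P) Hc).
have mq i : (m i < q)%N.
  apply: leq_ltn_trans dq; apply: leq_trans (ltnW md).
  by rewrite mdegE (bigD1 i) //= leq_addr.
pose a : {ffun 'I_n -> 'I_q} := [ffun i => Ordinal (mq i)].
have ma : bm a = m by apply/mnmP => i; rewrite bmE ffunE.
have /eqP := boxfam_indep H (a, t).
by rewrite c0 /= ma // sub0r oppr_eq0 => /eqP.
Qed.

Lemma comp_uniq0 (a : T -> {fps k[n]}) :
  \sum_t fps_comp U (a t) * b t = 0 -> forall t, a t = 0.
Proof.
move=> Ha t; apply: fpsP => m; pose d := mdeg m.
have H : ipow U d.+1 (\sum_t ev (fps_trunc d (a t)) * b t).
  have -> : \sum_t ev (fps_trunc d (a t)) * b t =
     - \sum_t (fps_comp U (a t) - ev (fps_trunc d (a t))) * b t.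
    under [in RHS]eq_bigr do rewrite mulrBl.
    by rewrite sumrB Ha sub0r opprK.
  apply: (idealPN (ipow_ideal U d.+1)).
  apply: (idealP_sum _ (ipow_ideal U d.+1)) => {}t _; rewrite mulrC.
  by apply: (idealPM _ (ipow_ideal U d.+1)); apply: comp_ipow HK _ _.
have := ev_uniq H t (leqnn (mdeg m).+1); rewrite mcoeff_trunc // => ->.
Qed.

Lemma comp_coord z : exists a : T -> {fps k[n]}, z = \sum_t fps_comp U (a t) * b t.
Proof.
have /choice[P HP] d : exists P : T -> mp, ipow U d (z - \sum_t ev (P t) * b t).
  by have [//|P [_ HP]] := @ipow_steps 0 d z; exists P.
(* By [ev_uniq] the coefficient at [m] no longer changes after the approximation [(mdeg m).+1],
   where the limit is read off. *)
pose a t : {fps k[n]} := FPS (fun m => (P (mdeg m).+1 t)@_m).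
have agree d t m : (mdeg m < d)%N -> (P d t)@_m = a t m.
  move=> md /=; apply/eqP; rewrite -subr_eq0 -mcoeffB; apply/eqP.
  apply: (@ev_uniq (mdeg m).+1 (fun t => P d t - P (mdeg m).+1 t)) => //.
  under eq_bigr do rewrite rmorphB mulrBl.
  rewrite sumrB.
  rewrite (sub_via _ _ z).
  apply: (idealPB (ipow_ideal U _) (HP _)); exact: ipow_leq md (HP d).
exists a; apply/eqP; rewrite -subr_eq0; apply/eqP/ordge_eq0 => -[|d]; first by [].
apply: (ipow_ordge U1); apply: (idealP_congr (ipow_ideal U d.+1)) (HP d.+1).
rewrite opprB addrC addrA subrK -sumrB.
apply: (idealP_sum _ (ipow_ideal U d.+1)) => t _; rewrite -mulrBl mulrC.
apply: (idealPM _ (ipow_ideal U d.+1)).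
have -> : ev (P d.+1 t) - fps_comp U (a t) =
   ev (P d.+1 t - fps_trunc d (a t)) - (fps_comp U (a t) - ev (fps_trunc d (a t))).
  by rewrite rmorphB /= opprB addrA subrK.
apply: (idealPB (ipow_ideal U d.+1)); last exact: comp_ipow HK _ _.
apply: ipow_ev => m md; rewrite mcoeffB agree // mcoeff_trunc ?subrr //.
Qed.

End Freeness.

(** * Traces of powers *)

Section Newton.
Variable A : comNzRingType.

Lemma deriv_prod (I : eqType) (r : seq I) (F : I -> {poly A}) : uniq r ->
  (\prod_(i <- r) F i)^`() = \sum_(i <- r) (F i)^`() * \prod_(j <- r | j != i) F j.
Proof.
elim: r => [|i r IHr] /=; first by rewrite !big_nil derivC.
case/andP=> ir ur; rewrite !big_cons derivM eqxx /= IHr //; congr (_ * _ + _).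
  rewrite big_seq [RHS]big_seq_cond; apply: eq_bigl => j.
  by case jr: (j \in r) => //=; apply/esym; apply: contraNneq ir => <-.
rewrite mulr_sumr; apply: eq_big_seq => j jr.
rewrite big_cons; have -> : i != j by apply: contraNneq ir => ->.
exact: mulrCA.
Qed.

Variable n' : nat.
Local Notation n := n'.+1.
Implicit Types (M : 'M[A]_n).

(** Jacobi's formula for the derivative of a determinant, the derivative of [char_poly_mx M] being
    the identity matrix. *)
Lemma tr_adj_char_poly M : \tr (\adj (char_poly_mx M)) = (char_poly M)^`().
Proof.
set B := char_poly_mx M; rewrite /char_poly -/B /determinant raddf_sum /=.
have dB i j : (B i j)^`() = (j == i)%:R%:P.
  rewrite !mxE derivB derivC subr0 eq_sym; case: eqP => _.
    by rewrite mulr1n derivX.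
  by rewrite mulr0n deriv0 polyC0.
rewrite /mxtrace; under [LHS]eq_bigr do rewrite mxE expand_cofactor.
under [RHS]eq_bigr => s _.
  have -> : ((-1) ^+ s * \prod_i B i (s i))^`() =
      \sum_i if s i == i then (-1) ^+ s * \prod_(k | i != k) B k (s k) else 0.
    rewrite derivM (_ : ((-1) ^+ s)^`() = 0) ?mul0r ?add0r; last first.
      by case: (odd_perm s); rewrite ?expr1 ?expr0 ?derivN derivC ?oppr0.
    rewrite deriv_prod ?index_enum_uniq // mulr_sumr; apply: eq_bigr => i _.
    rewrite dB; case: eqP => _; last by rewrite polyC0 mul0r mulr0.
    by rewrite mul1r; congr (_ * _); apply: eq_bigl => j; rewrite eq_sym.
  over.
by rewrite [RHS]exchange_big; apply: eq_bigr => i _; rewrite big_mkcond.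
Qed.

(** Newton's identities without division. Comparing coefficients in [(X - M) adj(X - M) = P]
    expresses the coefficients of the adjugate as polynomials in [M], and their traces are the
    coefficients of the derivative of [P]. Beyond the degrees of the entries of the adjugate the
    remainder vanishes, whence [D]. *)
Lemma newton_step M m : exists D, forall d, (D <= d)%N ->
  (char_poly M)`_m.+1 *+ m.+1 = \sum_(i < d) (char_poly M)`_(m.+1 + i) * \tr (M ^+ i).
Proof.
set P := char_poly M; set B := \adj (char_poly_mx M).
pose Bk j : 'M[A]_n := \matrix_(r, c) (B r c)`_j.
have BkS j : Bk j = (P`_j.+1)%:M + M * Bk j.+1.
  have : char_poly_mx M *m B = P%:M by rewrite mul_mx_adj.
  move/matrixP => E; apply/matrixP => r c; have := E r c.
  rewrite mulmxBl mul_scalar_mx !mxE => /(congr1 (fun Q : {poly A} => Q`_j.+1)).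
  rewrite coefB coefXM coef_sum coefMn /= => /eqP; rewrite subr_eq => /eqP ->.
  by congr (_ + _); apply: eq_bigr => l _; rewrite !mxE coefCM.
have Bkd d j : Bk j = \sum_(i < d) P`_(j.+1 + i) *: M ^+ i + M ^+ d * Bk (j + d)%N.
  elim: d => [|d IHd]; first by rewrite big_ord0 add0r expr0 mul1r addn0.
  rewrite big_ord_recr /= [LHS]IHd BkS mulrDr addrA addnS addSn exprSr mulrA.
  congr (_ + _ + _); rewrite -mulmxE mul_mx_scalar //.
exists (\max_r \max_c size (B r c)) => d Dd.
have Bk0 : Bk (m + d)%N = 0.
  apply/matrixP => r c; rewrite mxE [RHS]mxE nth_default // (leq_trans _ (leq_addl m d)) //.
  apply: leq_trans Dd.
  apply: leq_trans (@leq_bigmax _ (fun r => \max_c size (B r c)) r).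
  exact: (@leq_bigmax _ (fun c => size (B r c)) c).
have := congr1 mxtrace (Bkd d m); rewrite Bk0 mulr0 addr0 raddf_sum /=.
under eq_bigr do rewrite mxtraceZ.
move=> <-; rewrite -coef_deriv -tr_adj_char_poly -/B /mxtrace coef_sum.
by apply: eq_bigr => r _; rewrite [RHS]mxE.
Qed.

End Newton.

(** * Traces of [p]-th powers in characteristic [p] *)

Section FrobTrace.
Variables (A : comNzRingType) (p : nat) (n' : nat).
Hypothesis pA : p \in [pchar A].
Local Notation n := n'.+1.
Implicit Types (M : 'M[A]_n).

Let F := pFrobenius_aut pA.

Lemma poly_frob (P : {poly A}) : P ^+ p = map_poly F P \Po 'X^p.
Proof.
have pP : p \in [pchar {poly A}] := rmorph_pchar polyC pA.
elim/poly_ind: P => [|P c IHP].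
  by rewrite map_poly0 comp_poly0 expr0n eqn0Ngt prime_gt0 ?(pcharf_prime pA).
rewrite -(pFrobenius_autE pP) rmorphD rmorphM /= !pFrobenius_autE IHP.
rewrite rmorphD rmorphM /= map_polyX map_polyC comp_polyD comp_polyM comp_polyX comp_polyC.
by rewrite -polyC_exp.
Qed.

(** [X] and [M] commute, so [(X - M)^p = X^p - M^p]; take determinants. *)
Lemma char_poly_exp M : char_poly M ^+ p = char_poly (M ^+ p) \Po 'X^p.
Proof.
have pP : p \in [pchar {poly A}] := rmorph_pchar polyC pA.
have pM : p \in [pchar 'M[{poly A}]_n] := rmorph_pchar (@scalar_mx _ n) pP.
have detX (B : 'M[{poly A}]_n) d : \det B ^+ d = \det (B ^+ d).
  elim: d => [|d IHd]; first by rewrite !expr0 det1.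
  by rewrite !exprS IHd -mulmxE det_mulmx.
have E : char_poly_mx M ^+ p = map_mx (comp_poly 'X^p) (char_poly_mx (M ^+ p)).
  rewrite /char_poly_mx map_mxB map_scalar_mx /= comp_polyX.
  rewrite [X in _ = _ - X](_ : _ = map_mx (@polyC A) (M ^+ p)); last first.
    by apply/matrixP => i j; rewrite [LHS]mxE mxE comp_polyC.
  rewrite -(pFrobenius_autE pM) pFrobenius_autB_comm; last first.
    by rewrite /GRing.comm -!mulmxE scalar_mxC.
  rewrite !pFrobenius_autE; congr (_ - _).
    by rewrite -(rmorphXn (@scalar_mx _ n)).
  by rewrite -(rmorphXn (map_mx (@polyC A))).
by rewrite /char_poly detX E det_map_mx.
Qed.

Lemma mxtrace_pexp M : \tr (M ^+ p) = \tr M ^+ p.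
Proof.
have p0 : (0 < p)%N by rewrite prime_gt0 ?(pcharf_prime pA).
(* As [n' = n - 1], the coefficient at [n' * p] is [(- tr M)^p] on one side and [- tr (M^p)] on the
   other. *)
have := congr1 (fun P : {poly A} => P`_(n' * p)) (char_poly_exp M).
rewrite poly_frob !coef_comp_poly_Xn // dvdn_mull // mulnK // coef_map /=.
rewrite -[n']/(n.-1) !char_poly_trace // => E.
by rewrite -(pFrobenius_autE pA) -[LHS]opprK -E pFrobenius_autN opprK.
Qed.

Lemma mxtrace_qexp M e : \tr (M ^+ (p ^ e)) = \tr M ^+ (p ^ e).
Proof.
elim: e => [|e IHe]; first by rewrite expn0 !expr1.
by rewrite expnSr !exprM mxtrace_pexp IHe.
Qed.

End FrobTrace.

(** * The Legendre transform *)

Section ChainRule.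
Variables (n : nat) (k : comNzRingType) (U : 'I_n -> {fps k[n]}).
Hypothesis U1 : forall i, ordge 1 (U i).

Lemma deriv_evU j P :
  fps_deriv j (evU U P) = \sum_l evU U (P^`M(l)) * fps_deriv j (U l).
Proof.
pose S Q := fps_deriv j (evU U Q) = \sum_l evU U (Q^`M(l)) * fps_deriv j (U l).
have S1 : S 1.
  rewrite /S -mpolyC1 evUC rmorph1.
  have -> : fps_deriv j (1 : {fps k[n]}) = 0.
    apply: (addIr (fps_deriv j (1 : {fps k[n]}))).
    by rewrite add0r -{3}[1]mulr1 fps_derivM mul1r mulr1.
  by rewrite big1 // => l _; rewrite mderivC rmorph0 mul0r.
have SX i Q : S Q -> S ('X_i * Q).
  rewrite /S => SQ; rewrite rmorphM /= evUX fps_derivM SQ.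
  under [RHS]eq_bigr => l _.
    rewrite mderivM rmorphD !rmorphM /= evUX mulrDl mderivX mnm1E evUZ.
    over.
  rewrite big_split /= [U i * _]mulr_sumr; congr (_ + _); last first.
    by apply: eq_bigr => l _; rewrite mulrA.
  rewrite (bigD1 i) //= eqxx scale1r (_ : (U_(i) - U_(i))%MM = 0%MM) ?mpolyX0 ?rmorph1; last first.
    by apply/mnmP => l; rewrite mnmBE mnm0E subnn.
  rewrite big1 ?addr0.
    by rewrite mul1r mulrC.
  by move=> l li; rewrite eq_sym (negPf li) scale0r !mul0r.
have SXm m : S 'X_[m].
  have [d] := ubnP (mdeg m); elim: d m => // d IHd m md.
  have [m0|] := eqVneq m 0%MM; first by rewrite m0 mpolyX0.
  rewrite -mdeg_eq0 mdegE sum_nat_eq0 negb_forall => /existsP[i mi].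
  have mE : m = (U_(i) + (m - U_(i)))%MM by rewrite addmC submK // lep1mP.
  have dE : mdeg m = (mdeg (m - U_(i))%MM).+1 by rewrite {1}mE mdegD mdeg1.
  by rewrite mE mpolyXD; apply/SX/IHd; rewrite -ltnS -dE.
elim/mpolyind: P => [|c m P _ _ IH].
  by rewrite !rmorph0 raddf0 big1 // => l _; rewrite raddf0 rmorph0 mul0r.
rewrite rmorphD /= evUZ raddfD /= linearZ /= IH (SXm m) scaler_sumr -big_split.
apply: eq_bigr => l _; rewrite raddfD /= rmorphD mderivZ /= evUZ.
by rewrite mulrDl scalerAl.
Qed.

Lemma deriv_comp j a :
  fps_deriv j (fps_comp U a) = \sum_l fps_comp U (fps_deriv l a) * fps_deriv j (U l).
Proof.
apply/eqP; rewrite -subr_eq0; apply/eqP/ordge_eq0 => -[|d]; first by [].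
pose P := fps_trunc d.+1 a.
have H1 : ordge d.+1 (fps_deriv j (fps_comp U a) - fps_deriv j (evU U P)).
  by rewrite -raddfB; apply: ordge_deriv; exact: comp_ev.
rewrite -(subrK (fps_deriv j (evU U P)) (fps_deriv j (fps_comp U a))) -addrA.
apply: (idealPD (ordge_idealP d.+1) H1).
rewrite deriv_evU -sumrB; apply: (idealP_sum _ (ordge_idealP d.+1)) => l _.
rewrite -mulrBl mulrC; apply: (idealPM _ (ordge_idealP d.+1)).
have -> : evU U P^`M(l) - fps_comp U (fps_deriv l a) =
   evU U (P^`M(l) - fps_trunc d (fps_deriv l a)) -
   (fps_comp U (fps_deriv l a) - evU U (fps_trunc d (fps_deriv l a))).
  by rewrite rmorphB /= opprB addrA subrK.
apply: (idealPB (ordge_idealP d.+1)); last exact: comp_ev.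
apply: ordge_ev => // m; rewrite ltnS => md.
by rewrite mcoeffB trunc_deriv // mcoeff_trunc // subrr.
Qed.

End ChainRule.

Definition fps_der n (k : comNzRingType) (xi : 'I_n -> {fps k[n]}) z :=
  \sum_j xi j * fps_deriv j z.

Lemma fps_derD n (k : comNzRingType) (xi : 'I_n -> {fps k[n]}) y z :
  fps_der xi (y + z) = fps_der xi y + fps_der xi z.
Proof.
by rewrite /fps_der -big_split; apply: eq_bigr => j _; rewrite raddfD mulrDr.
Qed.

Lemma fps_derM n (k : comNzRingType) (xi : 'I_n -> {fps k[n]}) y z :
  fps_der xi (y * z) = fps_der xi y * z + y * fps_der xi z.
Proof.
rewrite /fps_der mulr_suml mulr_sumr -big_split; apply: eq_bigr => j _.
by rewrite fps_derivM mulrDr mulrA mulrCA.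
Qed.

Lemma fps_derX n (k : comNzRingType) (xi : 'I_n -> {fps k[n]}) i :
  fps_der xi (fpsX k i) = xi i.
Proof.
rewrite /fps_der (bigD1 i) //= fps_derivX eqxx mulr1 big1 ?addr0 // => j ji.
by rewrite fps_derivX (negPf ji) mulr0.
Qed.

Lemma fps_der_comp n (k : comNzRingType) (U : 'I_n -> {fps k[n]})
    (xi : 'I_n -> {fps k[n]}) a : (forall i, ordge 1 (U i)) ->
  fps_der xi (fps_comp U a) = \sum_l fps_comp U (fps_deriv l a) * fps_der xi (U l).
Proof.
move=> U1; rewrite /fps_der.
under eq_bigr do rewrite deriv_comp // mulr_sumr.
rewrite exchange_big; apply: eq_bigr => l _; rewrite mulr_sumr.
by apply: eq_bigr => j _; rewrite mulrCA.
Qed.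

(** * Traces and norms of a finite free extension *)

Section MultMatrix.
Variables (A R : idomainType) (comp : {rmorphism A -> R}) (N : nat).
Variable (b : 'I_N.+1 -> R).
Hypothesis co_ex : forall z, exists a : 'I_N.+1 -> A, z = \sum_t comp (a t) * b t.
Hypothesis co_uniq0 : forall a : 'I_N.+1 -> A,
  \sum_t comp (a t) * b t = 0 -> forall t, a t = 0.

Definition co z : 'I_N.+1 -> A := projT1 (cid (co_ex z)).
Lemma coE z : z = \sum_t comp (co z t) * b t.
Proof. exact: (projT2 (cid (co_ex z))). Qed.
Lemma co_uniq (a c : 'I_N.+1 -> A) :
  \sum_t comp (a t) * b t = \sum_t comp (c t) * b t -> forall t, a t = c t.
Proof.
move=> E t; apply/eqP; rewrite -subr_eq0; apply/eqP.
apply: (co_uniq0 (a := fun t => a t - c t)).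
under eq_bigr do rewrite rmorphB mulrBl.
by rewrite sumrB E subrr.
Qed.

Definition mulmat z : 'M[A]_N.+1 := \matrix_(i, l) co (z * b i) l.
Lemma mulmatE z i : z * b i = \sum_l comp (mulmat z i l) * b l.
Proof. by rewrite [LHS]coE; apply: eq_bigr => l _; rewrite mxE. Qed.
Lemma mulmat_uniq z (M : 'M[A]_N.+1) :
  (forall i, z * b i = \sum_l comp (M i l) * b l) -> mulmat z = M.
Proof.
move=> HM; apply/matrixP => i; apply: (@co_uniq (mulmat z i) (M i)).
by rewrite -HM -mulmatE.
Qed.

Lemma mulmat_additive : additive mulmat.
Proof.
move=> y z; apply: mulmat_uniq => i; rewrite mulrBl !mulmatE -sumrB.
by apply: eq_bigr => l _; rewrite !mxE rmorphB mulrBl.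
Qed.
HB.instance Definition _ := GRing.isAdditive.Build R 'M[A]_N.+1 mulmat mulmat_additive.

Lemma comp_mulmx (B C : 'M[A]_N.+1) i :
  \sum_l comp ((B *m C) i l) * b l =
  \sum_j comp (B i j) * \sum_l comp (C j l) * b l.
Proof.
under [RHS]eq_bigr do rewrite mulr_sumr.
rewrite [RHS]exchange_big; apply: eq_bigr => l _.
rewrite mxE rmorph_sum mulr_suml; apply: eq_bigr => j _.
by rewrite rmorphM mulrA.
Qed.

Lemma comp_addmx (B C : 'M[A]_N.+1) i :
  \sum_l comp ((B + C) i l) * b l =
  \sum_l comp (B i l) * b l + \sum_l comp (C i l) * b l.
Proof.
by rewrite -big_split; apply: eq_bigr => l _; rewrite mxE rmorphD mulrDl.
Qed.

Lemma mulmat_comp a : mulmat (comp a) = a%:M.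
Proof.
apply: mulmat_uniq => i; rewrite (bigD1 i) //= mxE eqxx big1 ?addr0 // => l li.
by rewrite mxE eq_sym (negPf li) mulr0n rmorph0 mul0r.
Qed.

Lemma mulmat_multiplicative : multiplicative mulmat.
Proof.
split=> [y z|]; last by rewrite -(rmorph1 comp) mulmat_comp.
apply: mulmat_uniq => i; rewrite comp_mulmx.
under eq_bigr do rewrite -mulmatE mulrCA.
by rewrite -mulr_sumr -mulmatE mulrCA mulrA.
Qed.
HB.instance Definition _ := GRing.isMultiplicative.Build R 'M[A]_N.+1 mulmat
  mulmat_multiplicative.

Lemma mulmat_inj0 z : mulmat z = 0 -> z = 0.
Proof.
move=> z0; rewrite -[z]mulr1 [1]coE mulr_sumr big1 // => t _.
rewrite mulrCA mulmatE z0 big1 ?mulr0 // => l _.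
by rewrite mxE rmorph0 mul0r.
Qed.

Definition Tr z : A := \tr (mulmat z).

Lemma mulmatM y z : mulmat (y * z) = mulmat y *m mulmat z.
Proof. by rewrite rmorphM. Qed.
Lemma mulmat_sum (I : Type) (r : seq I) (P : pred I) (F : I -> R) :
  mulmat (\sum_(i <- r | P i) F i) = \sum_(i <- r | P i) mulmat (F i).
Proof. by rewrite raddf_sum. Qed.
Lemma mulmat_compM a z i l : mulmat (comp a * z) i l = a * mulmat z i l.
Proof. by rewrite mulmatM mulmat_comp mul_scalar_mx mxE. Qed.
Lemma mulmat0 : mulmat 0 = 0. Proof. by rewrite raddf0. Qed.
Lemma Tr_compM a z : Tr (comp a * z) = a * Tr z.
Proof. by rewrite /Tr mulmatM mulmat_comp mul_scalar_mx mxtraceZ. Qed.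
Lemma Tr_sum (I : Type) (r : seq I) (P : pred I) (F : I -> R) :
  Tr (\sum_(i <- r | P i) F i) = \sum_(i <- r | P i) Tr (F i).
Proof. by rewrite /Tr mulmat_sum raddf_sum. Qed.
Lemma Tr0 : Tr 0 = 0. Proof. by rewrite /Tr mulmat0 mxtrace0. Qed.
Lemma Tr1 : Tr 1 = N.+1%:R.
Proof. by rewrite /Tr rmorph1 mxtrace_scalar. Qed.

Lemma Tr_comp a : Tr (comp a) = a *+ N.+1.
Proof. by rewrite /Tr mulmat_comp mxtrace_scalar. Qed.

Lemma TrX p z e : p \in [pchar A] -> Tr (z ^+ (p ^ e)) = Tr z ^+ (p ^ e).
Proof. by move=> pA; rewrite /Tr rmorphXn /= mxtrace_qexp. Qed.

Lemma mulmat_CH d : \sum_(i < N.+2) comp (char_poly (mulmat d))`_i * d ^+ i = 0.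
Proof.
apply: mulmat_inj0; set P := char_poly _.
rewrite -[RHS](Cayley_Hamilton (mulmat d)) -/P.
rewrite -[in RHS](coefK P) poly_def rmorph_sum /= rmorph_sum /= size_char_poly.
apply: eq_bigr => i _; rewrite rmorphM rmorphXn /= mulmat_comp.
by rewrite linearZ /= rmorphXn /= horner_mx_X -mul_scalar_mx mulmxE.
Qed.

Lemma char_poly_lead (M : 'M[A]_N.+1) : (char_poly M)`_N.+1 = 1.
Proof. by have := monicP (char_poly_monic M); rewrite lead_coefE size_char_poly. Qed.

(** By Cayley-Hamilton [d] satisfies a monic equation over [A]. In a domain the power of [d] below
    the lowest nonzero coefficient can be divided out, which leaves that coefficient as a multiple
    of [d]. *)
Lemma norm_ex d : d != 0 -> exists d' a, a != 0 /\ d * d' = comp a.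
Proof.
move=> d0; pose P := char_poly (mulmat d).
have P0 : exists i, P`_i != 0 by exists N.+1; rewrite char_poly_lead oner_neq0.
case: (ex_minnP P0) => s Ps smin.
have CH := mulmat_CH d.
have sP : (s < N.+2)%N by apply: smin; rewrite char_poly_lead oner_neq0.
have E : d ^+ s * (\sum_(i < N.+2) comp P`_i * (if (s <= i)%N then d ^+ (i - s) else 0)) = 0.
  rewrite -[RHS]CH mulr_sumr; apply: eq_bigr => i _.
  case: ifP => [si|/negbT]; first by rewrite mulrCA -exprD subnKC.
  rewrite -ltnNge => si; rewrite !mulr0.
  have [/eqP E|/smin] := boolP (P`_i == 0); first by rewrite -/P E rmorph0 mul0r.
  by rewrite leqNgt si.
move/eqP: E; rewrite mulf_eq0 expf_eq0 (negPf d0) andbF /= (bigD1 (Ordinal sP)) //=.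
rewrite leqnn subnn expr0 mulr1 addr_eq0 => /eqP E.
exists (- \sum_(i < N.+2 | i != Ordinal sP) comp P`_i * (if (s < i)%N then d ^+ (i - s).-1 else 0)).
exists P`_s; split=> //; rewrite mulrN E; congr (- _).
rewrite mulr_sumr; apply: eq_bigr => i iN; rewrite mulrCA; congr (_ * _).
have [si|si|si] := ltngtP s i; last by case/eqP: iN; apply/val_inj.
  by rewrite -exprS prednK ?subn_gt0.
by rewrite mulr0.
Qed.

Section Derivation.
Variables (D : R -> R) (dA : A -> A) (e0 : R).
Hypothesis DD : forall x y, D (x + y) = D x + D y.
Hypothesis DM : forall x y, D (x * y) = D x * y + x * D y.
Hypothesis Dcomp : forall a, D (comp a) = comp (dA a) * e0.

(** Applying [D] to the equations that define the matrix [M] of [z] gives [mulmat (D z) = dM *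
    mulmat e0 + (M G - G M)], where [G] holds the coordinates of the [D (b i)]. Multiplied by
    [mulmat y], which commutes with [M], the commutator has trace zero. *)
Lemma trace_der z y :
  Tr (y * D z) = \tr (map_mx dA (mulmat z) *m mulmat (e0 * y)).
Proof.
have D0 : D 0 = 0 by apply: (addIr (D 0)); rewrite -DD !add0r.
have Dsum (F : 'I_N.+1 -> R) : D (\sum_i F i) = \sum_i D (F i).
  exact: (big_morph D DD D0).
pose G : 'M[A]_N.+1 := \matrix_(i, l) co (D (b i)) l.
have GE i : D (b i) = \sum_l comp (G i l) * b l.
  by rewrite [LHS]coE; apply: eq_bigr => l _; rewrite mxE.
pose M := mulmat z; pose dM := map_mx dA M.
have E : mulmat (D z) + G *m M = dM *m mulmat e0 + M *m G.
  apply/matrixP => i; apply: (@co_uniq ((mulmat (D z) + G *m M) i)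
    ((dM *m mulmat e0 + M *m G) i)).
  rewrite !comp_addmx !comp_mulmx -mulmatE.
  have -> : \sum_j comp (G i j) * (\sum_l comp (M j l) * b l) = z * D (b i).
    rewrite GE mulr_sumr; apply: eq_bigr => j _.
    by rewrite -mulmatE mulrCA.
  rewrite -DM (mulmatE z i) Dsum -big_split.
  apply: eq_bigr => j _; rewrite DM Dcomp -GE -mulmatE mulrA.
  by rewrite [dM i j]mxE.
have /= := congr1 (fun B => \tr (B *m mulmat y)) E.
rewrite !mulmxDl !mxtraceD -!mulmxA.
have -> : \tr (M *m (G *m mulmat y)) = \tr (G *m (M *m mulmat y)).
  rewrite mxtrace_mulC -mulmxA; congr (\tr (_ *m _)).
  by rewrite !mulmxE -!rmorphM mulrC.
by move/addIr; rewrite !mulmxE -!rmorphM /= => <-; rewrite mulrC.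
Qed.

End Derivation.

(** Removes the factor [d] carried by derivations that exist only after multiplication by a Jacobian
    determinant: tested against [d' * y], both sides are multiples of [a]. *)
Lemma Tr_cancel (Mx : 'M[A]_N.+1) (d d' x y : R) a : a != 0 -> d * d' = comp a ->
  Tr (d' * y * (d * x)) = \tr (Mx *m mulmat (d * (d' * y))) ->
  Tr (y * x) = \tr (Mx *m mulmat y).
Proof.
move=> a0 E; rewrite mulrACA [d' * d]mulrC [d * (d' * y)]mulrA E Tr_compM.
rewrite [mulmat (comp a * y)]mulmatM mulmat_comp mul_scalar_mx -scalemxAr mxtraceZ.
exact: mulfI.
Qed.

Hypothesis charN : forall a : A, a *+ N.+1 = 0 -> a = 0.

(** A nonzero [d] has a multiple [comp a] with [a] nonzero, and its trace is [a *+ N.+1]. *)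
Lemma Tr_nondeg d : (forall y, Tr (y * d) = 0) -> d = 0.
Proof.
move=> Hd; apply/eqP/negPn/negP => /norm_ex[d' [a [a0 E]]].
have := Hd d'; rewrite mulrC E Tr_comp => /charN /eqP.
by rewrite (negPf a0).
Qed.

Section TracePowers.
Variables (dA : A -> A) (w x : R).
Hypothesis dAD : forall a c, dA (a + c) = dA a + dA c.
Hypothesis dAM : forall a c, dA (a * c) = dA a * c + a * dA c.
Hypothesis Hx : forall y, Tr (y * x) = \tr (map_mx dA (mulmat w) *m mulmat y).

(** [W] and [map_mx dA W] need not commute, but under the trace all factors [W] can be gathered on
    one side of the differentiated one; [Hx] then replaces that factor by [x]. *)
Lemma dTr_pow j : dA (Tr (w ^+ j.+1)) = Tr (w ^+ j * x) *+ j.+1.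
Proof.
have dA0 : dA 0 = 0 by apply: (addIr (dA 0)); rewrite -dAD !add0r.
have dsum (F : 'I_N.+1 -> A) : dA (\sum_i F i) = \sum_i dA (F i).
  exact: (big_morph dA dAD dA0).
have dmul (B C : 'M[A]_N.+1) :
    map_mx dA (B *m C) = map_mx dA B *m C + B *m map_mx dA C.
  apply/matrixP => i l; rewrite !mxE dsum -big_split; apply: eq_bigr => t _.
  by rewrite dAM !mxE.
pose W := mulmat w; pose dW := map_mx dA W.
have key i l : \tr (W ^+ i *m map_mx dA (W ^+ l)) = \tr (dW *m W ^+ (i + l).-1) *+ l.
  elim: l i => [|l IHl] i.
    have -> : map_mx dA (W ^+ 0) = 0.
      have dA1 : dA 1 = 0.
        by apply: (addIr (dA 1)); rewrite add0r -{3}[1]mulr1 dAM mul1r mulr1.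
      apply/matrixP => r c; rewrite expr0 !mxE; case: (r == c) => /=.
        by rewrite mulr1n.
      by rewrite mulr0n.
    by rewrite mulmx0 mxtrace0 mulr0n.
  rewrite exprS -mulmxE dmul mulmxDr mxtraceD mulrS addnS /=; congr (_ + _).
    by rewrite mxtrace_mulC -mulmxA mulmxE -exprD addnC.
  by rewrite mulmxA mulmxE -exprSr IHl addSn.
have -> : dA (Tr (w ^+ j.+1)) = \tr (map_mx dA (W ^+ j.+1)).
  rewrite /Tr rmorphXn /= /mxtrace dsum.
  by apply: eq_bigr => i _; rewrite [RHS]mxE.
have := key 0%N j.+1; rewrite expr0 mul1mx add0n /= => ->.
by congr (_ *+ _); rewrite Hx rmorphXn.
Qed.

End TracePowers.

Lemma Tr_newton0 w : \sum_(i < N.+2) (char_poly (mulmat w))`_i * Tr (w ^+ i) = 0.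
Proof.
rewrite -[RHS]Tr0 -[in RHS](mulmat_CH w) Tr_sum.
by apply: eq_bigr => i _; rewrite Tr_compM.
Qed.

Lemma Tr_newton w m : exists D, forall d, (D <= d)%N ->
  (char_poly (mulmat w))`_m.+1 *+ m.+1 =
  \sum_(i < d) (char_poly (mulmat w))`_(m.+1 + i) * Tr (w ^+ i).
Proof.
have [D HD] := newton_step (mulmat w) m; exists D => d /HD ->.
by apply: eq_bigr => i _; rewrite /Tr rmorphXn.
Qed.

End MultMatrix.

Lemma ipow1X (A : comNzRingType) r (G : 'I_r -> A) x d :
  ipow G 1 x -> ipow G d (x ^+ d).
Proof. by move=> Gx; have := @ipowX _ _ G 1 x d Gx; rewrite mul1n. Qed.

(** * Powers of [h] and of its Legendre transform [w] *)

Section Legendre.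
Variables (n p : nat) (k : closedFieldType).
Hypothesis pP : p \in [pchar k].
Variables (h : {fps k[n]}) (N : nat) (b : 'I_N.+1 -> {fps k[n]}) (K c : nat).
Local Notation R := {fps k[n]}.
Let U i : R := fps_deriv i h.
Hypothesis U1 : forall i, ordge 1 (U i).
Hypothesis HK : forall z, ordge K z -> ipow U 1 z.
Hypothesis sb : spans (ipow U 1) b.
Hypothesis ib : indep (ipow U 1) b.
Hypothesis charN : (N.+1 < p)%N.
Hypothesis Hh : forall m, ipow U (m - c) (h ^+ m).

Definition compU : R -> R := fps_comp U.
HB.instance Definition _ := GRing.isAdditive.Build R R compU (comp_additive U1).
HB.instance Definition _ := GRing.isMultiplicative.Build R R compU
  (comp_multiplicative U1).
Let comp : {rmorphism R -> R} := compU.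

Let co_ex : forall z : R, exists a : 'I_N.+1 -> R, z = \sum_t comp (a t) * b t.
Proof. by move=> z; have [a Ha] := comp_coord pP U1 HK sb ib z; exists a. Qed.
Let co_un : forall a : 'I_N.+1 -> R, \sum_t comp (a t) * b t = 0 -> forall t, a t = 0.
Proof. by move=> a; apply: (comp_uniq0 pP U1 HK sb ib). Qed.
Let Mat := mulmat co_ex.
Let T := Tr co_ex.

Let pR : p \in [pchar R] := fps_pchar n pP.

Lemma natr_neq0 j : (0 < j < p)%N -> (j%:R : k) != 0.
Proof.
case/andP=> j0 jp; rewrite -(dvdn_pcharf pP); apply/negP => /dvdn_leq.
by move/(_ j0); rewrite leqNgt jp.
Qed.

Lemma fps_mulrn_ord d j (a : R) : (0 < j < p)%N -> ordge d (a *+ j) -> ordge d a.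
Proof.
move=> /natr_neq0 j0 aj m md; have := aj m md.
by rewrite -scaler_nat fpsZ => /eqP; rewrite mulf_eq0 (negPf j0) => /eqP.
Qed.

Lemma mulrn_eq0 (a : R) : a *+ N.+1 = 0 -> a = 0.
Proof.
move=> a0; apply: ordge_eq0 => d; apply: (@fps_mulrn_ord d N.+1) => //.
by rewrite a0.
Qed.

Lemma ipow_Mat d z : ipow U d z -> forall i l, ordge d (Mat z i l).
Proof.
elim: d z => [//|d IHd] z [s [Hs ->]] i l.
rewrite /Mat mulmat_sum // summxE; apply: (idealP_sum _ (ordge_idealP d.+1)) => j _.
have -> : U j * s j = comp (fpsX k j) * s j by congr (_ * _); rewrite /= /compU compX.
rewrite mulmat_compM //.
by rewrite -add1n; apply: ordgeM; [exact: fpsX_ord|exact: (IHd _ (Hs j))].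
Qed.

Lemma ipow_T d z : ipow U d z -> ordge d (T z).
Proof.
move=> Hz; apply: (idealP_sum _ (ordge_idealP d)) => i _.
exact: ipow_Mat.
Qed.

(** The coefficient of [z] at [m] is a [q]-th root of the coefficient of its [q]-th power at
    [m *+ q]. *)
Lemma ord_root e d (z : R) : ordge (d * p ^ e).+1 (z ^+ (p ^ e)) -> ordge d.+1 z.
Proof.
move=> Hz m; rewrite ltnS => md.
pose a0 : {ffun 'I_n -> 'I_(p ^ e)} := [ffun i => Ordinal (q_gt0 e pP)].
have a0E : bm a0 = 0%MM by apply/mnmP => i; rewrite bmE ffunE mnm0E.
have fps1_bm : (1 : R) = fmon (bm a0) by rewrite a0E fmon0.
have zE : z = delta pP a0 (z ^+ (p ^ e)).
  by rewrite -[_ ^+ _]mulr1 delta_pow fps1_bm delta_bm eqxx mulr1.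
rewrite zE deltaE a0E addm0 Hz ?rt0 //.
by rewrite ltnS mdegMn leq_mul2r md orbT.
Qed.

Let w : R := \sum_i fpsX k i * U i - h.

Lemma w_pow m : ipow U (m - c) (w ^+ m).
Proof.
rewrite /w exprDn; apply: (idealP_sum _ (ipow_ideal U _)) => i _.
have iI := ipow_ideal U (m - c).
rewrite -mulr_natr mulrC; apply: (idealPM _ iI).
have im : (i <= m)%N by rewrite -ltnS.
apply: (@ipow_leq _ _ _ _ ((m - i) + (i - c))).
  by move: im; lia.
apply: ipowM.
  apply: ipow1X; apply: (idealP_sum _ (ipow_ideal U 1)) => l _.
  exact/(idealPM _ (ipow_ideal U 1))/ipow_gen1.
by rewrite exprNn; apply: (idealPM _ (ipow_ideal U _)).
Qed.

Lemma dw j : fps_deriv j w = \sum_l fpsX k l * fps_deriv j (U l).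
Proof.
rewrite /w raddfB raddf_sum /=.
under eq_bigr do rewrite fps_derivM fps_derivX.
rewrite big_split /= (bigD1 j) //= eqxx mul1r [X in _ + X + _ - _]big1 ?addr0.
  by rewrite addrC addrA addNr add0r.
by move=> i ij; rewrite eq_sym (negPf ij) mul0r.
Qed.

Let jac : 'M[R]_n := \matrix_(l, j) fps_deriv j (U l).

Lemma der_trace (xi : 'I_n -> R) i0 e0 : (forall l, fps_der xi (U l) = (l == i0)%:R * e0) ->
  forall z y, T (y * fps_der xi z) =
    \tr (map_mx (fps_deriv i0) (Mat z) *m Mat (e0 * y)).
Proof.
move=> Hxi z y; apply: (trace_der co_ex co_un (D := fps_der xi)) => [u v|u v|a].
- exact: fps_derD.
- exact: fps_derM.
rewrite /= /compU fps_der_comp // (bigD1 i0) //= Hxi eqxx mul1r big1 ?addr0 // => l li.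
by rewrite Hxi (negPf li) mul0r mulr0.
Qed.

(** By [der_trace] with [e0 = 0], a vector field killing all [U l] sends every series to one that is
    orthogonal to everything under the trace, hence to zero. This is separability of the extension,
    and it rests on [N.+1 < p]. *)
Lemma det_jac : \det jac != 0.
Proof.
rewrite -det_tr; apply/det0P => -[v v0 vJ]; case/eqP: v0.
apply/rowP => j; rewrite mxE.
have v0 l : fps_der (fun j => v 0 j) (U l) = 0.
  have /rowP/(_ l) := vJ; rewrite !mxE => E; rewrite -[RHS]E.
  by apply: eq_bigr => i _; rewrite !mxE.
rewrite -(fps_derX (fun j => v 0 j) j); apply: (Tr_nondeg co_un mulrn_eq0) => y.
rewrite -/T (@der_trace _ j 0) => [|l]; last by rewrite mulr0.
by rewrite mul0r /Mat mulmat0 // mulmx0 mxtrace0.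
Qed.

(** The [i]-th column of the adjugate of [jac] is the vector field [det jac] times the derivative
    along [U i]. By [dw] it maps [w] to [det jac * x_i], and [Tr_cancel] removes the determinant. *)
Lemma trace_dw i y :
  T (y * fpsX k i) = \tr (map_mx (fps_deriv i) (Mat w) *m Mat y).
Proof.
have [d' [a [a0 E]]] := norm_ex co_ex co_un det_jac.
pose xi j := (\adj jac) j i.
have adjE l : \sum_j xi j * fps_deriv j (U l) = (l == i)%:R * \det jac.
  have /matrixP/(_ l i) := mul_mx_adj jac; rewrite [LHS]mxE [in RHS]mxE => EE.
  rewrite mulr_natl -[RHS]EE; apply: eq_bigr => j _.
  by rewrite [jac l j]mxE mulrC.
have Dw : fps_der xi w = \det jac * fpsX k i.
  rewrite /fps_der; under eq_bigr do rewrite dw mulr_sumr.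
  rewrite exchange_big (bigD1 i) //= [X in _ + X]big1 ?addr0.
    by under eq_bigr do rewrite mulrCA; rewrite -mulr_sumr adjE eqxx mul1r mulrC.
  move=> l li; under eq_bigr do rewrite mulrCA.
  by rewrite -mulr_sumr adjE (negPf li) mul0r mulr0.
have := @der_trace xi i (\det jac) adjE w (d' * y).
by rewrite Dw; apply: (Tr_cancel co_un a0 E).
Qed.

(** The additive loss [c] disappears on passing to [q]-th powers, which commute with the trace:
    [w^(jq)] lies in [I^(jq-c)], and [x_i^q] makes up for [c] and for one power more. *)
Lemma T_pow_ord j i : ordge j.+1 (T (w ^+ j * fpsX k i)).
Proof.
pose s := (maxn K 1 * c.+1)%N; pose q := (p ^ s)%N.
have sq : (s < q)%N by rewrite ltn_expl // prime_gt1 // (pcharf_prime pP).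
apply: (@ord_root s); rewrite -/q /T -(TrX co_ex co_un _ _ pR) exprMn -exprM -/q.
apply: ipow_T.
have X1 : ipow U 1 (fpsX k i ^+ maxn K 1).
  apply: HK; apply: (@ordge_leq _ _ K (maxn K 1)); first exact: leq_maxl.
  by have := @ordgeX _ _ 1 _ (maxn K 1) (fpsX_ord i); rewrite mul1n.
have Xq : ipow U c.+1 (fpsX k i ^+ q).
  rewrite -(subnK (ltnW sq)) exprD; apply: (idealPM _ (ipow_ideal U _)).
  by rewrite exprM; exact: ipow1X.
apply: ipow_leq (ipowM (w_pow (j * q)) Xq).
by rewrite addnS ltnS addnC -leq_subLR.
Qed.

Lemma T_ord1 j : ordge 1 (T (w ^+ j.+1)).
Proof.
pose s := c.+1; pose q := (p ^ s)%N.
have sq : (s < q)%N by rewrite ltn_expl // prime_gt1 // (pcharf_prime pP).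
apply: (@ord_root s); rewrite -/q /T -(TrX co_ex co_un _ _ pR) -exprM -/q mul0n.
apply: ipow_T; apply: ipow_leq (w_pow (j.+1 * q)).
by rewrite subn_gt0 mulSn ltn_addr // (ltn_trans _ sq).
Qed.

(** Integration: the [i]-th derivative is [j.+1] times [T (w ^+ j * x_i)], of order above [j], and
    the exponents to divide by are at most [j.+1], hence below [p]. [T_ord1] deals with the constant
    term. *)
Lemma T_ord j : (j < N.+1)%N -> ordge j.+2 (T (w ^+ j.+1)).
Proof.
move=> jN m; rewrite ltnS => mj.
have [->|m0] := eqVneq m 0%MM; first by rewrite T_ord1 // mdeg0.
have [i mi] : exists i, (0 < m i)%N.
  apply: contrapT => H; case/eqP: m0; apply/mnmP => i; rewrite mnm0E.
  by apply/eqP; rewrite eqn0Ngt; apply/negP => mi; apply: H; exists i.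
have mE : (m - U_(i) + U_(i))%MM = m by rewrite submK // lep1mP -lt0n.
have := @dTr_pow _ _ comp N b co_ex co_un (fps_deriv i) w (fpsX k i)
  (raddfD (@fps_deriv n k i)) (fps_derivM i) (trace_dw i) j.
rewrite -/T => E.
have : fps_deriv i (T (w ^+ j.+1)) (m - U_(i))%MM = 0.
  rewrite E -scaler_nat fpsZ T_pow_ord ?mulr0 //.
  suff <- : mdeg m = (mdeg (m - U_(i))%MM).+1 by [].
  by rewrite -{1}mE mdegD mdeg1 addn1.
rewrite fps_derivE mE mnmBE mnm1E eqxx subn1 prednK // -mulr_natl => /eqP.
rewrite mulf_eq0 (negPf (natr_neq0 _)) /=; first by move/eqP.
rewrite mi /=; apply: leq_ltn_trans charN; apply: leq_trans jN.
by rewrite (leq_trans _ mj) // mdegE (bigD1 i) //= leq_addr.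
Qed.

Let P := char_poly (Mat w).

Lemma P_nth i : (N.+1 < i)%N -> P`_i = 0.
Proof. by move=> Ni; rewrite nth_default // size_char_poly. Qed.

Lemma P_newton r : exists D, forall d, (D <= d)%N ->
  P`_r *+ r = \sum_(i < d) P`_(r + i) * T (w ^+ i).
Proof.
case: r => [|r]; last exact: (Tr_newton co_ex co_un).
exists N.+2 => d Nd; rewrite mulr0n.
rewrite -[LHS](Tr_newton0 co_ex co_un w) -(subnK Nd) addnC big_split_ord /=.
rewrite [X in _ = _ + X]big1 ?addr0 // => i _.
by rewrite P_nth ?mul0r // add0n ltnS leq_addr.
Qed.

(** After cancellation Newton's identity reads [j P_(N+1-j) = - sum_(i > 0) P_(N+1-j+i) T(w^i)]. For
    [i < j] induction gives the product order at least [(j - i + 1) + (i + 1)]; for [i = j] the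
    factor [T(w^j)] has order at least [j + 1] by itself. *)
Lemma charpoly_ord j : (0 < j <= N.+1)%N -> ordge j.+1 P`_(N.+1 - j).
Proof.
have [l] := ubnP j; elim: l j => // l IHl j jl /andP[j0 jN].
have iO := ordge_idealP (n := n) (R := k) j.+1.
set r := (N.+1 - j)%N; have [D HD] := P_newton r.
have := HD (maxn D 1) (leq_maxl _ _).
rewrite -(prednK (leq_maxr D 1)) big_ord_recl addn0 expr0.
have -> : T 1 = N.+1%:R by exact: (Tr1 co_ex co_un).
rewrite mulr_natr (_ : P`_r *+ N.+1 = P`_r *+ r + P`_r *+ j); last first.
  by rewrite -mulrnDr subnK.
rewrite -addrA -{1}[P`_r *+ r]addr0 => /addrI E.
apply: (@fps_mulrn_ord _ j); first by rewrite j0 (leq_ltn_trans jN).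
have -> : P`_r *+ j = - \sum_(i < (maxn D 1).-1) P`_(r + lift ord0 i) * T (w ^+ lift ord0 i).
  by apply/eqP; rewrite -addr_eq0 -E.
apply: (idealPN iO); apply: (idealP_sum _ iO) => i _; rewrite lift0.
have [ij|ij|ij] := ltngtP i.+1 j.
- have -> : (r + i.+1)%N = (N.+1 - (j - i.+1))%N by rewrite /r; lia.
  have H1 : ordge (j - i.+1).+1 P`_(N.+1 - (j - i.+1)) by apply: IHl; lia.
  have H2 : ordge i.+2 (T (w ^+ i.+1)) by apply: T_ord; lia.
  by apply: ordge_leq (ordgeM H1 H2); lia.
- by rewrite P_nth ?mul0r; [exact: ordge0|rewrite /r; lia].
by apply: (idealPM _ iO); rewrite ij; have := @T_ord i; rewrite ij; apply.
Qed.

(** The equation of [w] trades [j = N.+1 - i] factors [w] for [j.+1] powers of the ideal. The least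
    favourable rate is [N.+2] powers for [N.+1] factors, still above 1. The additive term guarantees
    that [w ^+ N.+1] can be split off. *)
Lemma w_gain m a : (N.+1 * a + N.+2 * N.+1 <= N.+2 * m)%N -> ipow U a (w ^+ m).
Proof.
have [l] := ubnP m; elim: l m a => // l IHl m a ml Ha.
have Nm : (N.+1 <= m)%N.
  by rewrite -(leq_pmul2l (ltn0Sn N.+1)) (leq_trans _ Ha) // leq_addl.
have iI := ipow_ideal U a.
have wN : w ^+ N.+1 = - \sum_(i < N.+1) comp P`_i * w ^+ i.
  have := mulmat_CH co_ex co_un w; rewrite big_ord_recr /= char_poly_lead.
  rewrite (rmorph1 comp) mul1r addrC => /eqP; rewrite addr_eq0 => /eqP.
  exact.
rewrite -(subnK Nm) exprD wN mulrN; apply: (idealPN iI); rewrite mulr_sumr.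
apply: (idealP_sum _ iI) => i _; rewrite mulrCA -exprD.
pose j := (N.+1 - i)%N.
have Hi := ltn_ord i.
have HP : ipow U j.+1 (comp P`_i).
  apply: (ipow_comp U1 HK).
  have -> : nat_of_ord i = (N.+1 - j)%N by rewrite /j; lia.
  by apply: charpoly_ord; rewrite /j; lia.
have Hw : ipow U (a - j.+1) (w ^+ (m - N.+1 + i)).
  have [ja|ja] := leqP j.+1 a; last by rewrite (eqP (ltnW ja : (_ <= _)%N)).
  by apply: IHl; rewrite /j in ja *; nia.
by apply: ipow_leq (ipowM HP Hw); lia.
Qed.

Lemma legendre_gain : exists e0, forall e, (e0 <= e)%N ->
  ipow U (p ^ e).+1 (h ^+ (p ^ e)).
Proof.
(* Since [e < q], the first bound puts [x_i ^+ q] into the ideal, and the second is what [w_gain]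
   asks for [m = q] and [a = q + 1]. *)
exists (maxn (maxn K 1 * 2) (N.+1 + N.+2 * N.+1)) => e He.
have p1 : (1 < p)%N by rewrite prime_gt1 // (pcharf_prime pP).
have eq_ : (e < p ^ e)%N by rewrite ltn_expl.
have iI := ipow_ideal U (p ^ e).+1.
have hw : h + w = \sum_i fpsX k i * U i by rewrite /w addrC subrK.
have -> : h ^+ (p ^ e) = (h + w) ^+ (p ^ e) - w ^+ (p ^ e).
  by rewrite (frobD e pP _ _ pR) addrK.
apply: (idealPB iI); last by apply: w_gain; move: He eq_; rewrite geq_max; nia.
rewrite hw (frob_sum e pP) //; apply: (idealP_sum _ iI) => i _.
rewrite exprMn -add1n; apply: ipowM; last exact/ipow1X/ipow_gen1.
have Kq : (maxn K 1 <= p ^ e)%N by move: He eq_; rewrite geq_max; lia.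
rewrite -(subnK Kq) exprD; apply: (idealPM _ (ipow_ideal U 1)); apply: HK.
apply: (@ordge_leq _ _ K (maxn K 1)); first exact: leq_maxl.
by have := @ordgeX _ _ 1 _ (maxn K 1) (fpsX_ord i); rewrite mul1n.
Qed.

End Legendre.

(** * A generic multiple of the series *)

Lemma base_digits_inj m b b' x x' : (b < m)%N -> (b' < m)%N ->
  (b + m * x = b' + m * x')%N -> b = b' /\ x = x'.
Proof.
move=> bm b'm; have m0 : (0 < m)%N by apply: leq_trans bm.
rewrite ![(m * _)%N]mulnC ![(_ + _ * m)%N]addnC => E; split.
  by have := congr1 (fun y => y %% m)%N E; rewrite !modnMDl !modn_small.
by have := congr1 (fun y => y %/ m)%N E; rewrite !divnMDl // !divn_small // !addn0.
Qed.

(** A root of [Q - 1], which exists unless [Q] is constant, is not a root of [Q]. *)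
Lemma closed_nonroot (k : closedFieldType) (Q : {poly k}) : Q != 0 -> exists s, Q.[s] != 0.
Proof.
move=> Q0; have [Q1|Q1] := leqP (size Q) 1.
  exists 0; rewrite (size1_polyC Q1) hornerC.
  by apply: contraNneq Q0 => E; rewrite (size1_polyC Q1) E polyC0.
have sQ : size (Q - 1) = size Q.
  by rewrite size_polyDl // size_polyN size_poly1.
have /closed_rootP[s] : size (Q - 1) != 1%N by rewrite sQ neq_ltn Q1 orbT.
rewrite /root hornerD hornerN hornerC subr_eq0 => /eqP Qs.
by exists s; rewrite Qs oner_neq0.
Qed.

Section Products.
Variables (A : comNzRingType) (r r' : nat) (V : 'I_r -> A) (F : 'I_r' -> A).

(* The ideal (V) (F)^d. *)
Definition imul_pow d z := exists s : 'I_r -> A,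
  (forall i, ipow F d (s i)) /\ z = \sum_i V i * s i.

Lemma imul_pow_ideal d : idealP (imul_pow d).
Proof.
split.
- exists (fun=> 0); split=> [i|]; first by case: (ipow_ideal F d).
  by rewrite big1 // => i _; rewrite mulr0.
- move=> _ _ [s [Hs ->]] [t [Ht ->]]; exists (fun i => s i + t i).
  split=> [i|]; first by apply: idealPD (ipow_ideal F d) _ _.
  by rewrite -big_split; apply: eq_bigr => i _; rewrite mulrDr.
- move=> a _ [s [Hs ->]]; exists (fun i => a * s i).
  split=> [i|]; first by apply: idealPM (ipow_ideal F d) _.
  by rewrite mulr_sumr; apply: eq_bigr => i _; rewrite mulrCA.
Qed.

Lemma imul_pow_gen d i y : ipow F d y -> imul_pow d (V i * y).
Proof.
move=> Hy; exists (fun j => if j == i then y else 0); split=> [j|].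
  by case: eqP => // _; case: (ipow_ideal F d).
by rewrite (bigD1 i) //= eqxx big1 ?addr0 // => j /negPf ->; rewrite mulr0.
Qed.

Lemma imul_powM d e z y : imul_pow d z -> ipow F e y -> imul_pow (d + e) (y * z).
Proof.
move=> [s [Hs ->]] Hy; exists (fun i => y * s i); split=> [i|].
  by rewrite addnC; exact: ipowM.
by rewrite mulr_sumr; apply: eq_bigr => i _; rewrite mulrCA.
Qed.

End Products.

Lemma box_spans (k : fieldType) n K :
  spans (ordge K) (fun a : {ffun 'I_n -> 'I_K} =>
    fmon [multinom (a i : nat) | i < n] : {fps k[n]}).
Proof.
move=> z; exists (fun a : {ffun 'I_n -> 'I_K} => z [multinom (a i : nat) | i < n]) => m mK.
have mi i : (m i < K)%N.
  by apply: leq_ltn_trans mK; rewrite mdegE (bigD1 i) //= leq_addr.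
pose a : {ffun 'I_n -> 'I_K} := [ffun i => Ordinal (mi i)].
have aE : [multinom (a i : nat) | i < n] = m.
  by apply/mnmP => i; rewrite mnmE ffunE.
rewrite fpsB fps_sumE (bigD1 a) //= aE eqxx mulr1 big1 ?addr0 ?subrr // => a' a'a.
case: eqP => [mE|]; rewrite ?mulr0 //; case/eqP: a'a; apply/ffunP => i.
by apply/val_inj; rewrite /= ffunE /= mE mnmE.
Qed.

Definition tj_gen (k : comNzRingType) (g : {fps k[3]}) (t : 'I_4) : {fps k[3]} :=
  if unlift ord0 t is Some i then fps_deriv i g else g.

Lemma tj_gen0 (k : comNzRingType) (g : {fps k[3]}) : tj_gen g ord0 = g.
Proof. by rewrite /tj_gen unlift_none. Qed.
Lemma tj_genS (k : comNzRingType) (g : {fps k[3]}) i : tj_gen g (lift ord0 i) = fps_deriv i g.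
Proof. by rewrite /tj_gen liftK. Qed.

Section Generic.
Variables (k : closedFieldType) (f : {fps k[3]}) (K0 : nat).
Local Notation R := {fps k[3]}.
Hypothesis f2 : ordge 2 f.
Local Notation F := (tj_gen f).
Hypothesis HK0 : forall z, ordge K0 z -> ipow F 1 z.

Definition unit_mul (c : 'I_3 -> k) : R := 1 - \sum_i c i *: fpsX k i.

Lemma F_ord t : ordge 1 (F t).
Proof.
rewrite /tj_gen; case: unliftP => [i _|_]; first exact: ordge_deriv.
exact: ordge_leq f2.
Qed.

Local Notation mJ := (imul_pow (@fpsX 3 k) F).

Lemma mJ_S d z : ipow F d.+1 z -> mJ d z.
Proof.
move=> [s [Hs ->]]; apply: (idealP_sum _ (imul_pow_ideal _ _ _)) => t _.
have [u [_ ->]] := ordge_ipow _ _ (F_ord t).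
rewrite mulr_suml; apply: (idealP_sum _ (imul_pow_ideal _ _ _)) => i _.
rewrite -mulrA; apply: imul_pow_gen.
exact: (idealPM _ (ipow_ideal F d) (Hs t)).
Qed.

Lemma ordge_F d z : ordge (K0 * d) z -> ipow F d z.
Proof.
move=> /ordge_ipow; elim: d z => [|d IHd] z //; rewrite mulnS => Hz.
have [L0 LD LM] := ipow_ideal F d.+1.
apply: (ipow_prod_ind (L := ipow F d.+1) L0 LD _ Hz) => s t Hs Ht.
rewrite -(add1n d); apply: ipowM (IHd _ Ht).
exact/HK0/(ipow_ordge fpsX_ord Hs).
Qed.

Lemma ordge_mJ d z : ordge (K0 * d).+1 z -> mJ d z.
Proof.
move=> /ordge_ipow [s [Hs ->]]; apply: (idealP_sum _ (imul_pow_ideal _ _ _)) => i _.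
by apply/imul_pow_gen/ordge_F/(ipow_ordge fpsX_ord (Hs i)).
Qed.

Section FixC.
Variable c : 'I_3 -> k.
Let h := unit_mul c * f.
Let U i : R := fps_deriv i h.

Lemma UE i : U i = unit_mul c * fps_deriv i f - c i *: f.
Proof.
rewrite /U /h fps_derivM addrC; congr (_ + _).
rewrite /unit_mul raddfB raddf_sum /=.
have -> : fps_deriv i (1 : R) = 0.
  apply: (addIr (fps_deriv i (1 : R))).
  by rewrite add0r -{3}[1]mulr1 fps_derivM mul1r mulr1.
rewrite sub0r (bigD1 i) //= linearZ /= fps_derivX eqxx big1 ?addr0.
  by rewrite mulNr -scalerAl mul1r.
by move=> j ji; rewrite linearZ /= fps_derivX eq_sym (negPf ji) scaler0.
Qed.

(** Modulo [Ls 1] the generator [F t] is [kap t] times [f]: this is [Ls_red]. *)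
Definition kap (t : 'I_4) : k := if unlift ord0 t is Some i then c i else 1.

Lemma kap0 : kap ord0 = 1. Proof. by rewrite /kap unlift_none. Qed.
Lemma kapS i : kap (lift ord0 i) = c i. Proof. by rewrite /kap liftK. Qed.

(** The ideal [I F^(d-1) + m F^d]. Being zero for [d = 0], it makes the start of the induction in
    [Ls_all] an identity. *)
Definition Ls d z := if d is d'.+1 then iadd (imul_pow U F d') (mJ d) z else z = 0.

Lemma Ls_ideal d : idealP (Ls d).
Proof.
case: d => [|d]; last by apply: iadd_ideal; exact: imul_pow_ideal.
by split=> [//|x y -> ->|a x ->]; rewrite ?addr0 ?mulr0.
Qed.

Lemma Ls_mul t d z : Ls d z -> Ls d.+1 (F t * z).
Proof.
case: d => [->|d [x [y [Hx Hy ->]]]]; first by rewrite mulr0; case: (Ls_ideal 1).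
exists (F t * x), (F t * y); rewrite mulrDr; split=> //.
  by have := imul_powM Hx (ipow_gen1 F t); rewrite addn1.
by have := imul_powM Hy (ipow_gen1 F t); rewrite addn1.
Qed.

Lemma Ls_red t d y : ipow F d y -> Ls d.+1 ((F t - kap t *: f) * y).
Proof.
case: (unliftP ord0 t) => [i ->|->] Hy; last first.
  by rewrite kap0 tj_gen0 scale1r subrr mul0r; case: (Ls_ideal d.+1).
rewrite kapS tj_genS.
exists (U i * y), ((\sum_j c j *: fpsX k j) * (fps_deriv i f * y)); split.
- exact: imul_pow_gen.
- rewrite mulr_suml; apply: (idealP_sum _ (imul_pow_ideal _ _ _)) => j _.
  rewrite fps_scaleAl' -mulrA; apply: (idealPM _ (imul_pow_ideal _ _ _)).
  by apply: imul_pow_gen; rewrite -tj_genS; exact: ipow_gen.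
rewrite UE /unit_mul mulrA -mulrDl; congr (_ * _).
by rewrite mulrBl mul1r addrAC subrK.
Qed.

Lemma Ls_step t d y a : ipow F d y -> Ls d (y - a * f ^+ d) ->
  Ls d.+1 (F t * y - (kap t *: a) * f ^+ d.+1).
Proof.
move=> Hy Ha.
have -> : F t * y - (kap t *: a) * f ^+ d.+1 =
    (F t - kap t *: f) * y + kap t *: (F ord0 * (y - a * f ^+ d)).
  rewrite tj_gen0 mulrBl -[kap t *: f * y]scalerAl mulrBr scalerBr addrA subrK exprS.
  by congr (_ - _); rewrite -scalerAl mulrCA.
apply: (idealPD (Ls_ideal d.+1) (Ls_red _ Hy)).
rewrite fps_scaleAl'; apply: (idealPM _ (Ls_ideal d.+1)); exact: Ls_mul.
Qed.

Lemma Ls_all d y : ipow F d y -> exists a, Ls d (y - a * f ^+ d).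
Proof.
elim: d y => [|d IHd] y; first by move=> _; exists y; rewrite expr0 mulr1 /= subrr.
move=> [s [Hs ->]]; have [a Ha] := choice (fun t => IHd _ (Hs t)).
exists (\sum_t kap t *: a t); rewrite mulr_suml -sumrB.
by apply: (idealP_sum _ (Ls_ideal d.+1)) => t _; exact: (Ls_step t (Hs t) (Ha t)).
Qed.

Lemma Ls_pow t e d y (a : k) : ipow F d y -> Ls d (y - a *: f ^+ d) ->
  ipow F (e + d) (F t ^+ e * y) /\
  Ls (e + d) (F t ^+ e * y - (kap t ^+ e * a) *: f ^+ (e + d)).
Proof.
move=> Hy Ha; elim: e => [|e [IH1 IH2]]; first by rewrite !expr0 !mul1r.
rewrite exprS -mulrA addSn; split; first exact: ipow_gen.
have := @Ls_step t _ _ (fps_const 3 (kap t ^+ e * a)) IH1.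
rewrite -fps_scaleAl' => /(_ IH2).
rewrite [kap t *: _]fps_scaleAl' -rmorphM /= -fps_scaleAl' mulrA -exprS.
by rewrite [kap t * (_ * _)]mulrA -exprS.
Qed.

Definition mdeg4 (e : nat * nat * nat * nat) := (e.1.1.1 + (e.1.1.2 + (e.1.2 + (e.2 + 0))))%N.
Definition mono4 (e : nat * nat * nat * nat) : R :=
  F ord0 ^+ e.1.1.1 * (F (lift ord0 0) ^+ e.1.1.2 *
   (F (lift ord0 1) ^+ e.1.2 * (F (lift ord0 ord_max) ^+ e.2 * 1))).

Lemma mono4_Ls e : ipow F (mdeg4 e) (mono4 e) /\
  Ls (mdeg4 e) (mono4 e -
    (c 0 ^+ e.1.1.2 * (c 1 ^+ e.1.2 * c ord_max ^+ e.2)) *: f ^+ mdeg4 e).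
Proof.
have H0 : Ls 0 (1 - 1 *: f ^+ 0) by rewrite /= scale1r subrr.
have [A1 B1] := Ls_pow (lift ord0 ord_max) e.2 (I : ipow F 0 1) H0.
have [A2 B2] := Ls_pow (lift ord0 1) e.1.2 A1 B1.
have [A3 B3] := Ls_pow (lift ord0 0) e.1.1.2 A2 B2.
have [A4 B4] := Ls_pow ord0 e.1.1.1 A3 B3.
split=> //; move: B4; congr (Ls _ (_ - _ *: _)).
by rewrite kap0 !kapS expr1n mul1r mulr1.
Qed.

(** Modulo [Ls d.+1] the relation becomes a nonzero scalar times [f ^+ d.+1], and this power
    generates [F^(d+1)] there. So [F^(d+1)] is contained in [I F^d + m F^(d+1)], and Nakayama
    removes the second term. *)
Lemma reduction_of_relation (T : finType) (e : T -> nat * nat * nat * nat) (q : T -> k) d :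
  (forall t, q t != 0 -> mdeg4 (e t) = d.+1) ->
  mJ d.+1 (\sum_t q t *: mono4 (e t)) ->
  \sum_t q t * (c 0 ^+ (e t).1.1.2 * (c 1 ^+ (e t).1.2 * c ord_max ^+ (e t).2)) != 0 ->
  forall z, ipow F d.+1 z -> imul_pow U F d z.
Proof.
set Q : k := \sum_t _; move=> He Hrel Q0.
have LsF : Ls d.+1 (f ^+ d.+1).
  have iL := Ls_ideal d.+1.
  have : Ls d.+1 (Q *: (f ^+ d.+1 : R)).
    have -> : Q *: (f ^+ d.+1 : R) = \sum_t q t *: mono4 (e t) -
       \sum_t q t *: (mono4 (e t) - (c 0 ^+ (e t).1.1.2 * (c 1 ^+ (e t).1.2 * c ord_max ^+ (e t).2)) *: f ^+ d.+1).
      rewrite -sumrB scaler_suml; apply: eq_bigr => t _.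
      by rewrite -scalerBr opprB addrC subrK scalerA.
    apply: (idealPB iL); first exact: iaddr (imul_pow_ideal _ _ _) Hrel.
    apply: (idealP_sum _ iL) => t _.
    have [->|qt] := eqVneq (q t) 0; first by rewrite scale0r; case: iL.
    rewrite fps_scaleAl'; apply: (idealPM _ iL).
    by have [_] := mono4_Ls (e t); rewrite He.
  move=> /(idealPM (fps_const 3 Q^-1) iL).
  by rewrite -fps_scaleAl' scalerA mulVf // scale1r.
have [T' [Y [HY gY]]] := ipow_fg F d.+1.
have iI := imul_pow_ideal U F d.
suff HI t : imul_pow U F d (Y t).
  by move=> z /gY[s ->]; apply: (idealP_sum _ iI) => t _; exact: idealPM.
apply: (nakayama (Y := Y) iI) => {}t.
have [a] := Ls_all (HY t); move=> /(fun H => idealPD (Ls_ideal d.+1) H (idealPM a (Ls_ideal d.+1) LsF)).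
rewrite subrK => -[x [_ [Hx [s [Hs ->]] ->]]].
have [u Hu] := choice (fun i => gY _ (Hs i)).
exists (fun t' => \sum_i fpsX k i * u i t'); split=> [t'|].
  apply: (idealP_sum _ (ordge_idealP _)) => i _; rewrite mulrC.
  exact: (idealPM _ (ordge_idealP _) (fpsX_ord i)).
have -> : \sum_t' (\sum_i fpsX k i * u i t') * Y t' = \sum_i fpsX k i * s i.
  under eq_bigr do rewrite mulr_suml.
  rewrite exchange_big; apply: eq_bigr => i _; rewrite [in RHS](Hu i) mulr_sumr.
  by apply: eq_bigr => t' _; rewrite mulrA.
by rewrite addrK.
Qed.

End FixC.

(** Chosen so that the [nn ^ 4] monomials with exponents below [nn] outnumber the at most
    [((4 * K0 + 1) * nn) ^ 3] dimensions of the series modulo order [M] in [relation_ex]. *)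
Let nn := ((4 * K0 + 1) ^ 3).+1.

(** Four elements of a ring of dimension three are analytically dependent. Counting gives a linear
    relation between their monomials modulo high order; its part of lowest degree [d0] is the
    desired one, the rest falling into [m F^d0]. *)
Lemma relation_ex : exists (T : finType) (e : T -> nat * nat * nat * nat) (q : T -> k) d,
  [/\ (d < 4 * nn)%N,
     [/\ injective e, exists t, q t != 0 &
     forall t, [/\ (e t).1.1.2 < nn, (e t).1.2 < nn & (e t).2 < nn]%N],
     forall t, q t != 0 -> mdeg4 (e t) = d.+1 &
     mJ d.+1 (\sum_t q t *: mono4 (e t))].
Proof.
pose T := ('I_nn * 'I_nn * 'I_nn * 'I_nn)%type.
pose e (t : T) : nat * nat * nat * nat := (t.1.1.1 : nat, t.1.1.2 : nat, t.1.2 : nat, t.2 : nat).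
pose M := (4 * nn * K0).+1.
have nind : ~ indep (ordge M) (fun t : T => mono4 (e t)).
  move=> ind; have iM := idealP_submodP (ordge_idealP (n := 3) (R := k) M).
  have := indep_leq_spans iM ind (@box_spans k 3 M).
  rewrite card_ffun !card_prod !card_ord leqNgt => /negP; apply.
  apply: (@leq_ltn_trans ((4 * K0 + 1) ^ 3 * nn ^ 3)).
    by rewrite -expnMn leq_exp2r // /M; nia.
  have -> : (nn * nn * nn * nn = nn * nn ^ 3)%N by rewrite !expnS expn0 muln1 !mulnA.
  by rewrite ltn_pmul2r ?expn_gt0 // /nn.
have [q [Hq [t0 qt0]]] : exists q : T -> k,
    ordge M (\sum_t q t *: mono4 (e t)) /\ exists t, q t != 0.
  apply: contrapT => H; apply: nind => q Hq t; apply: contrapT => qt.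
  by apply: H; exists q; split=> //; exists t; apply/eqP.
have ex : exists d, [exists t, (q t != 0) && (mdeg4 (e t) == d)].
  by exists (mdeg4 (e t0)); apply/existsP; exists t0; rewrite qt0 eqxx.
case: (ex_minnP ex) => d0 /existsP[t1 /andP[qt1 /eqP dt1]] dmin.
have elt t : (mdeg4 (e t) < 4 * nn)%N.
  case: t => [[[a b] c] d] /=; rewrite /mdeg4 /=.
  by have := ltn_ord a; have := ltn_ord b; have := ltn_ord c; have := ltn_ord d; lia.
pose q' t := if mdeg4 (e t) == d0 then q t else 0.
have Hq' : mJ d0 (\sum_t q' t *: mono4 (e t)).
  have iJ := imul_pow_ideal (@fpsX 3 k) F d0.
  have -> : \sum_t q' t *: mono4 (e t) = \sum_t q t *: mono4 (e t) -
      \sum_t (q t - q' t) *: mono4 (e t).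
    by rewrite -sumrB; apply: eq_bigr => t _; rewrite -scalerBl opprB addrC subrK.
  apply: (idealPB iJ).
    apply: ordge_mJ; apply: ordge_leq Hq; rewrite /M ltnS mulnC leq_mul2r.
    by rewrite -dt1 (ltnW (elt t1)) orbT.
  apply: (idealP_sum _ iJ) => t _; rewrite /q'; case: eqP => [_|/eqP dt].
    by rewrite subrr scale0r; case: iJ.
  rewrite subr0; have [->|qt] := eqVneq (q t) 0; first by rewrite scale0r; case: iJ.
  rewrite fps_scaleAl'; apply: (idealPM _ iJ); apply: mJ_S.
  have [mt _] := mono4_Ls (fun=> 0) (e t); apply: ipow_leq mt.
  rewrite ltn_neqAle eq_sym dt /=; apply: dmin; apply/existsP; exists t.
  by rewrite qt eqxx.
have q't1 : q' t1 != 0 by rewrite /q' dt1 eqxx.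
(* A relation of degree 0 would put a nonzero constant into the maximal ideal. *)
have d0E : d0 = d0.-1.+1.
  case: d0 @q' Hq' q't1 dt1 {dmin} => // q' Hq' q't1 dt1; case/eqP: q't1.
  have /ordge1P : ordge 1 (\sum_t q' t *: mono4 (e t)).
    case: Hq' => s [_ ->]; apply: (idealP_sum _ (ordge_idealP 1)) => i _.
    by rewrite mulrC; apply: (idealPM _ (ordge_idealP 1)); exact: fpsX_ord.
  rewrite fps_sumE (bigD1 t1) // big1 => [|t tt1].
    rewrite fpsZ [X in _ * X](_ : _ = 1) ?mulr1; first by move=> E; rewrite -[q' t1]addr0.
    move: dt1; rewrite /mdeg4 => /eqP; rewrite !addn_eq0 /mono4.
    move=> /andP[/eqP -> /andP[/eqP -> /andP[/eqP -> /andP[/eqP -> _]]]].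
    by rewrite !expr0 !mulr1 fps1E eqxx.
  rewrite /q'; case: eqP => [|_]; last by rewrite scale0r fps0E.
  rewrite /mdeg4 => /eqP; rewrite !addn_eq0.
  move=> /andP[/eqP a0 /andP[/eqP b0 /andP[/eqP c0 /andP[/eqP e0 _]]]].
  move/eqP: dt1; rewrite /mdeg4 !addn_eq0.
  move=> /andP[/eqP a1 /andP[/eqP b1 /andP[/eqP c1 /andP[/eqP e1 _]]]].
  case/eqP: tt1; move: a0 b0 c0 e0 a1 b1 c1 e1.
  case: t => [[[a b] c] d]; case: t1 {qt1} => [[[a' b'] c'] d'] /=.
  move=> a0 b0 c0 e0 a1 b1 c1 e1.
  by congr (_, _, _, _); apply: val_inj => /=; rewrite ?a0 ?b0 ?c0 ?e0 ?a1 ?b1 ?c1 ?e1.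
exists T, e, q', d0.-1; rewrite -d0E; split=> //.
- by have := elt t1; rewrite dt1; lia.
- split=> [[[[a b] c] d] [[[a' b'] c'] d'] []||[[[a b] c] d]].
  + by move=> aE bE cE dE; congr (_, _, _, _); apply: val_inj.
  + by exists t1.
  + by rewrite !ltn_ord.
- by move=> t; rewrite /q'; case: (_ =P d0) => [//|_]; rewrite eqxx.
Qed.

(* Kronecker substitution separates the monomials of a fixed degree. *)
Lemma generic_reduction : exists (c : 'I_3 -> k) d, (d < 4 * nn)%N /\
  forall z, ipow F d.+1 z ->
    imul_pow (fun i => fps_deriv i (unit_mul c * f)) F d z.
Proof.
have [T [e [q [d [dn [einj [t0 qt0] elt] He Hrel]]]]] := relation_ex.
pose ex t := ((e t).1.1.2 + nn * ((e t).1.2 + nn * (e t).2))%N.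
pose Q : {poly k} := \sum_t q t *: 'X^(ex t).
have exinj t t' : q t != 0 -> q t' != 0 -> ex t = ex t' -> t = t'.
  move=> /He dt /He dt' E; apply: einj.
  have [] := elt t; have [] := elt t'; move: dt dt' E; rewrite /ex /mdeg4.
  case: (e t) => [[[a b] c] g]; case: (e t') => [[[a' b'] c'] g'] /=.
  move=> dt dt' E b'n c'n g'n bn cn gn.
  have [E1 E2] := base_digits_inj bn b'n E.
  have [E3 E4] := base_digits_inj cn c'n E2.
  by congr (_, _, _, _) => //; lia.
have Q0 : Q != 0.
  apply: contraNneq (qt0) => /(congr1 (fun P : {poly k} => P`_(ex t0))).
  rewrite coef0 coef_sum (bigD1 t0) //= coefZ coefXn eqxx mulr1 big1 ?addr0 => [->//|t tt0].
  rewrite coefZ coefXn; have [->|qt] := eqVneq (q t) 0; first by rewrite mul0r.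
  by case: eqP => [E|]; rewrite ?mulr0 //; case/eqP: tt0; exact: (esym (exinj _ _ qt0 qt E)).
have [s Qs] := closed_nonroot Q0.
exists (fun i => s ^+ (nn ^ i)), d; split=> //.
apply: (reduction_of_relation (e := e) (q := q) He Hrel).
move: Qs; rewrite /Q horner_sum; congr (_ != _); apply: eq_bigr => t _.
rewrite hornerZ hornerXn /ex /= -!exprM -!exprD; congr (_ * _ ^+ _).
by rewrite (_ : (1 %% 3 = 1)%N) // expn0 expn1 mul1n mulnDr mulnA -mulnn.
Qed.

End Generic.

(** * The inequality in positive characteristic *)

Lemma reindex_basis (K : fieldType) (V : lmodType K) (I : V -> Prop) (S : finType)
    (e : S -> V) N : #|S| = N -> spans I e -> indep I e ->
  exists b : 'I_N -> V, spans I b /\ indep I b.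
Proof.
move=> SN se ie; case: N / SN.
have sumE (c : 'I_#|S| -> K) :
    \sum_i c i *: e (enum_val i) = \sum_s c (enum_rank s) *: e s.
  rewrite [RHS](reindex _ (onW_bij _ (enum_val_bij S))) /=.
  by apply: eq_bigr => i _; rewrite enum_valK.
exists (fun i => e (enum_val i)); split=> [z|c Hc i].
  have [c Hc] := se z; exists (fun i => c (enum_val i)).
  rewrite sumE; congr (I (z - _)): Hc.
  by apply: eq_bigr => s _; rewrite enum_rankK.
by rewrite -(enum_valK i); apply: (ie (fun s => c (enum_rank s))); rewrite -sumE.
Qed.

Lemma card_low_box q :
  (#|[pred a : {ffun 'I_3 -> 'I_q} | (\sum_i a i < q)%N]| <= 'C(q + 2, 3))%N.
Proof.
case: q => [|r].
  by rewrite -[X in (_ <= X)%N]/0%N leqn0; apply/eqP/eq_card0 => a; rewrite inE ltn0.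
have -> : (r.+1 + 2 = 3 + r)%N by lia.
rewrite -card_partial_ord_partitions.
pose g (a : {ffun 'I_3 -> 'I_r.+1}) := [tuple a i | i < 3].
have gi : injective g.
  move=> a b ab; apply/ffunP => i.
  by have := congr1 (fun t : 3.-tuple _ => tnth t i) ab; rewrite !tnth_mktuple.
rewrite -(card_imset _ gi) subset_leq_card //; apply/fintype.subsetP => _ /imsetP[a Ha ->].
move: Ha; rewrite !inE ltnS; apply: leq_trans.
by rewrite big_tuple; apply/leq_sum => i _; rewrite tnth_mktuple.
Qed.

(** Replacing each [a i] by [q - 1 - a i] turns a sum of at least [2 q] into one of at most
    [q - 3]. *)
Lemma card_high_box q :
  (#|[pred a : {ffun 'I_3 -> 'I_q} | (2 * q <= \sum_i a i)%N]| <= 'C(q + 2, 3))%N.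
Proof.
apply: leq_trans (card_low_box q).
pose g (a : {ffun 'I_3 -> 'I_q}) : {ffun 'I_3 -> 'I_q} := [ffun i => rev_ord (a i)].
have gi : injective g.
  move=> a b /ffunP ab; apply/ffunP => i; apply/rev_ord_inj.
  by move: (ab i); rewrite !ffunE.
rewrite -(card_imset _ gi) subset_leq_card //; apply/fintype.subsetP => _ /imsetP[a Ha ->].
move: Ha; rewrite !inE => Ha.
have : (\sum_i (rev_ord (a i) + (a i).+1) = \sum_(i < 3) q)%N.
  by apply: eq_bigr => i _; rewrite /= subnK.
rewrite sum_nat_const card_ord => E.
rewrite (eq_bigr (fun i => rev_ord (a i) : nat)) => [|i _]; last by rewrite ffunE.
move: E; have -> : (\sum_i (rev_ord (a i) + (a i).+1) =
    \sum_i (rev_ord (a i) : nat) + \sum_i (a i : nat) + 3)%N.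
  rewrite (eq_bigr (fun i => (rev_ord (a i) + a i) + 1)%N) => [|i _]; last by rewrite addnS addn1.
  by rewrite !big_split /= sum_nat_const card_ord.
move: Ha; set x := (\sum_i (rev_ord (a i) : nat))%N; set y := (\sum_i (a i : nat))%N.
by move: x y => x y; lia.
Qed.

Lemma mmap1_factor (k : comNzRingType) n (U : 'I_n -> {fps k[n]}) (m : 'X_{1..n}) i r :
  (r <= m i)%N ->
  exists y, ipow U (mdeg m - r) y /\ mmap1 U m = U i ^+ r * y.
Proof.
move=> rm; rewrite mdegE (bigD1 i) //= -addnBAC //.
exists (U i ^+ (m i - r) * \prod_(j < n | j != i) U j ^+ m j); split; last first.
  by rewrite /mmap1 (bigD1 i) //= mulrA -exprD (subnKC rm).
apply: ipowM; first by have := @ipowX _ _ U 1 (U i) (m i - r) (ipow_gen1 U i); rewrite mul1n.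
elim/big_rec2: _ => // j d x _ Hx.
by apply: ipowM => //; have := @ipowX _ _ U 1 (U j) (m j) (ipow_gen1 U j); rewrite mul1n.
Qed.

(** * Dimension counts modulo [q]-th powers *)

Section Comparisons.
Variables (n p e : nat) (k : closedFieldType).
Hypothesis pP : p \in [pchar k].
Variables (U : 'I_n -> {fps k[n]}) (B : finType) (b : B -> {fps k[n]}).
Let q := (p ^ e)%N.
Local Notation R := {fps k[n]}.
Local Notation box := {ffun 'I_n -> 'I_q}.
Local Notation Iq := (ipow (fun i => U i ^+ q) 1).
Local Notation mb u := (mdeg (bm (p := p) (e := e) u)).
Hypothesis sb : spans (ipow U 1) b.
Hypothesis ib : indep (ipow U 1) b.

(* Modulo the [U i ^+ q], a combination of the [F t ^+ q] is a multiple of [H];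
   the multiples of [H] by monomials of degree at least [q] lie in [ipow U (2 * q)]. *)
Lemma tjurina_count r (F : 'I_r -> R) (H : R) (T : finType) (v : T -> R) :
  ipow U q H -> (forall t, iadd Iq (fun z => exists y, z = H * y) (F t ^+ q)) ->
  spans (ipow F 1) v ->
  (q ^ n * #|B| <= q ^ n * #|T| +
     (#|[pred a : box | (mb a < q)%N]| + #|[pred a : box | (2 * q <= mb a)%N]|) * #|B|)%N.
Proof.
move=> HH HF sv.
have iH : idealP (fun z : R => exists y, z = H * y).
  split; first by exists 0; rewrite mulr0.
    by move=> _ _ [y ->] [y' ->]; exists (y + y'); rewrite mulrDr.
  by move=> a _ [y ->]; exists (a * y); rewrite mulrCA.
have iI : idealP Iq := ipow_ideal _ 1.
have sI := idealP_submodP iI.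
pose A1 := {a : box | (mb a < q)%N}; pose A2 := {a : box | (2 * q <= mb a)%N}.
pose fam (u : (box * T) + ((A1 * B) + (A2 * B))) : R :=
  match u with
  | inl x => frob_fam v x
  | inr (inl x) => H * boxfam U b (val x.1, x.2)
  | inr (inr x) => boxfam U b (val x.1, x.2)
  end.
suff sf : spans Iq fam.
  have := indep_leq_spans sI (boxfam_indep pP sb ib (e := e)) sf.
  rewrite !card_sum (card_frob_fam n p e B) (card_frob_fam n p e T) !card_prod !card_sig -mulnDl.
  by [].
have fsE (c : box * T + (A1 * B + A2 * B) -> k) :
    \sum_u c u *: fam u = \sum_x c (inl x) *: frob_fam v x +
    (\sum_(x : A1 * B) c (inr (inl x)) *: (H * boxfam U b (val x.1, x.2)) +
     \sum_(x : A2 * B) c (inr (inr x)) *: boxfam U b (val x.1, x.2)).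
  by rewrite big_sumType /=; congr (_ + _); rewrite big_sumType.
have psum (Q : pred box) (G : box * B -> R) :
    \sum_(x : {a | Q a} * B) G (val x.1, x.2) = \sum_(u | Q u.1) G u.
  rewrite -(pair_bigA _ (fun (a : {a | Q a}) x => G (val a, x))) /=.
  transitivity (\sum_(a | Q a) \sum_x G (a, x)).
    by rewrite (big_sub Q (fun a => \sum_x G (a, x))).
  by rewrite pair_big_dep /=; apply: eq_big => [[a x]|[a x] _] /=; rewrite ?andbT.
move=> z; have [c0 Hc0] := @frob_spans n p e k pP _ _ _ sv z.
have [x [y' [Hx [y yE] zE]]] : iadd Iq (fun z => exists y, z = H * y)
    (z - \sum_u c0 u *: frob_fam v u).
  by apply: (ipow1_sub (iadd_ideal iI iH) HF); apply/frob_gen; exact: Hc0.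
have [c1 [_ Hc1]] := @ipow_boxspan n p k U B b sb e 0 y I.
pose low (u : box * B) := (mb u.1 < q)%N.
pose rest := \sum_(u | ~~ low u) c1 u *: boxfam U b u.
have Hrest : ipow U (2 * q) (H * rest).
  rewrite mul2n -addnn; apply: ipowM => //.
  have iq := ipow_ideal U q; apply: idealP_sum => // u.
  rewrite -leqNgt => qu; apply: (submodPZ (idealP_submodP iq)).
  rewrite /boxfam mulrC; apply: idealPM => //.
  exact: (ipow_leq qu (ipow_mmap1 U _)).
have [c2 [c20 Hc2]] := @ipow_boxspan n p k U B b sb e (2 * q) _ Hrest.
exists (fun w => match w with
  | inl x => c0 x
  | inr (inl x) => c1 (val x.1, x.2)
  | inr (inr x) => c2 (val x.1, x.2) end).
rewrite fsE.
rewrite (psum (fun a => (mb a < q)%N) (fun u => c1 u *: (H * boxfam U b u))).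
rewrite (psum (fun a => (2 * q <= mb a)%N) (fun u => c2 u *: boxfam U b u)).
rewrite opprD addrA zE yE opprD addrA.
have -> : \sum_(u | (2 * q <= mb u.1)%N) c2 u *: boxfam U b u = \sum_u c2 u *: boxfam U b u.
  rewrite [RHS](bigID (fun u : box * B => (2 * q <= mb u.1)%N)) /=.
  rewrite [X in _ + X]big1 ?addr0 // => u; rewrite -ltnNge => /c20 ->.
  by rewrite scale0r.
have -> : \sum_(u | low u) c1 u *: (H * boxfam U b u) =
    H * (\sum_u c1 u *: boxfam U b u) - H * rest.
  rewrite -mulrBr [X in H * (X - _)](bigID low) /= addrK mulr_sumr.
  by apply: eq_bigr => u _; rewrite scalerAr.
have -> : x + H * y - (H * (\sum_u c1 u *: boxfam U b u) - H * rest) -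
   \sum_u c2 u *: boxfam U b u = x + H * (y - \sum_u c1 u *: boxfam U b u) +
   (H * rest - \sum_u c2 u *: boxfam U b u).
  by rewrite mulrBr opprB !addrA; congr (_ - _); rewrite -!addrA; congr (_ + (_ + _)); rewrite addrC.
apply: (idealPD iI) => //; apply: (idealPD iI) => //.
exact: idealPM.
Qed.

(* Downward induction on the power of [(U)]: a monomial outside the box is
   divisible by some [U i ^+ q], hence lies in a higher power modulo [frob L0]. *)
Lemma milnor_count (L0 : R -> Prop) (S : finType) (w : S -> R) M :
  idealP L0 -> indep L0 w ->
  (forall z, ordge M z -> frob e pP L0 z) ->
  (forall i, ordge 1 (U i)) ->
  (forall i, iadd (frob e pP L0) (ipow U q.+1) (U i ^+ q)) ->
  (#|S| <= #|B|)%N.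
Proof.
move=> iL0 iw HM U1 HU; pose L := frob e pP L0.
have iL : idealP L := @frob_ideal n p e k pP _ iL0.
have sL := idealP_submodP iL.
suff sf : spans L (boxfam U b (p := p) (e := e)).
  have := indep_leq_spans sL (@frob_indep n p e k pP _ _ _ iw) sf.
  by rewrite card_frob_fam (card_frob_fam n p e B) leq_pmul2l // expn_gt0 (q_gt0 e pP).
suff main j z : ipow U (M - j) z -> exists c : box * B -> k,
    L (z - \sum_u c u *: boxfam U b u).
  by move=> z; apply: (main M); rewrite subnn.
elim: j z => [|j IHj] z.
  rewrite subn0 => Hz; exists (fun=> 0); rewrite big1 => [|u _]; last exact: scale0r.
  by rewrite subr0; apply/HM/(ipow_ordge U1 Hz).
have [jM|Mj] := leqP M j.
  have E : (M - j.+1 = M - j)%N by lia.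
  by rewrite E; exact: IHj.
have E : (M - j = (M - j.+1).+1)%N by lia.
rewrite {}E in IHj.
set d := (M - j.+1)%N in IHj *.
move=> /(ipow_step sb)[P [HP Hz]].
have iLd : idealP (iadd L (ipow U d.+1)) by apply: iadd_ideal => //; exact: ipow_ideal.
have Hbig m : (d <= mdeg m)%N -> (forall a : box, m <> bm a) ->
    iadd L (ipow U d.+1) (mmap1 U m).
  move=> dm Hm; have [i mi] : exists i, (q <= m i)%N.
    apply: contrapT => H.
    have lt i : (m i < q)%N by rewrite ltnNge; apply/negP => Hi; apply: H; exists i.
    by apply: (Hm [ffun i => Ordinal (lt i)]); apply/mnmP => i; rewrite bmE ffunE.
  have [y [Hy ->]] := mmap1_factor U mi.
  have [l [u [Ll Hu ->]]] := HU i.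
  rewrite mulrDl; apply: (idealPD iLd).
    by apply: (iaddl (ipow_ideal U d.+1)); rewrite mulrC; apply: (idealPM _ iL).
  apply: (iaddr iL).
  by apply: ipow_leq (ipowM Hu Hy); rewrite addSn ltnS; lia.
have [x [y [Lx Hy E]]] := ev_boxfam_gen b iLd Hbig HP.
have [c Hc] := IHj _ (idealPD (ipow_ideal U d.+1) Hz Hy).
exists (fun v => (P v.2)@_(bm v.1) + c v).
under eq_bigr do rewrite scalerDl.
rewrite big_split /= opprD addrA.
set Sb := \sum_u _ *: _ in E *; set Sc := \sum_u _ *: _ in Hc *.
set Se := \sum_t _ in E Hz Hc.
have -> : z - Sb - Sc = x + (z - Se + y - Sc).
  rewrite !addrA; congr (_ - _); rewrite [LHS](_ : _ = z - Se + (Se - Sb)); last by rewrite addrA subrK.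
  by rewrite E !addrA; congr (_ + _); rewrite addrC addrA.
exact: (idealPD iL).
Qed.

End Comparisons.

(** Beyond the reduction exponent [d], each further factor from [F] can be exchanged for one from
    [V]. *)
Lemma imul_pow_ipow (A : comNzRingType) r r' (V : 'I_r -> A) (F : 'I_r' -> A) d :
  (forall z, ipow F d.+1 z -> imul_pow V F d z) ->
  forall m z, ipow F (m + d) z -> ipow V m z.
Proof.
move=> HVF; elim=> [//|m IHm] z; rewrite addSn -addnS => Hz.
have [L0 LD LM] := ipow_ideal V m.+1.
apply: (@ipow_prod_ind _ _ F m d.+1 (ipow V m.+1)) Hz => // s t Hs /HVF[u [Hu ->]].
rewrite mulr_sumr; apply: (idealP_sum _ (ipow_ideal V m.+1)) => i _.
by rewrite mulrCA; apply: ipow_gen; apply: IHm; apply: ipowM.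
Qed.

(** With [c1 + c2] at most about [q^3 / 3] the hypothesis is [2 nu <= 3 tau] up to an error of at
    most [5 nu / q]. This is less than 1, so it cannot spoil an inequality of integers. *)
Lemma milnor_tjurina_arith nu tau q c1 c2 : (5 * nu < q)%N ->
  (c1 <= 'C(q + 2, 3))%N -> (c2 <= 'C(q + 2, 3))%N ->
  (q ^ 3 * nu <= q ^ 3 * tau + (c1 + c2) * nu)%N -> (2 * nu <= 3 * tau)%N.
Proof.
move=> nuq H1 H2 H.
have HC : ('C(q + 2, 3) * 6 = (q + 2) * (q + 1) * q)%N.
  by rewrite -[6%N]/(3`!)%N bin_ffact !ffactnS ffactn0 !addn2 addn1 muln1 /= mulnA.
rewrite leqNgt; apply/negP => H3.
have H4 : (6 * (c1 + c2) <= 2 * ((q + 2) * (q + 1) * q))%N by rewrite -HC; lia.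
have H5 : (6 * (c1 + c2) * nu <= 2 * ((q + 2) * (q + 1) * q) * nu)%N by rewrite leq_mul2r H4 orbT.
have H6 : (q ^ 3 * (3 * tau).+1 <= q ^ 3 * (2 * nu))%N by rewrite leq_mul2l H3 orbT.
have E : (q ^ 3 = q * q * q)%N by rewrite !expnS expn0 muln1 mulnA.
rewrite E in H H6.
have H7 : (q * q * q <= 3 * q * q * nu + 2 * q * nu)%N by nia.
have H8 : (2 * q * nu <= 2 * q * q * nu)%N by nia.
have H9 : (5 * nu * (q * q) < q * (q * q))%N by rewrite ltn_mul2r nuq andbT; nia.
nia.
Qed.

Section CharP.
Variables (p : nat) (k : closedFieldType).
Hypothesis pP : p \in [pchar k].
Variables (f : {fps k[3]}) (K0 : nat).
Hypothesis f2 : ordge 2 f.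
Hypothesis HK0 : forall z, ordge K0 z -> ipow (tj_gen f) 1 z.
Local Notation R := {fps k[3]}.
Local Notation F := (tj_gen f).
Local Notation J := (ipow (fun i => fps_deriv i f) 1).

(* Exceeds the codimension of the Jacobian ideal of the generic multiple, which
   contains [ordge (K0 * d.+1)] for the exponent [d] of [generic_reduction]. *)
Definition char_bound K0 := ((K0 * (4 * ((4 * K0 + 1) ^ 3).+1)) ^ 3).+1.

(** Independence modulo [J] plus order [K] concerns finitely many coefficients, so it is the form
    that specialization can deliver. In the proof [#|B|] is [nu], and the two counts give
    [#|S| <= nu] and [2 nu <= 3 #|T|]. *)
Lemma milnor_tjurina_pchar (T S : finType) (v : T -> R) (w : S -> R) K :
  (char_bound K0 < p)%N -> spans (ipow F 1) v ->
  indep (iadd J (ordge K)) w -> (2 * #|S| <= 3 * #|T|)%N.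
Proof.
move=> Hp sv iw.
have [c [d [dn Hcd]]] := generic_reduction f2 HK0.
set E := unit_mul c in Hcd; pose h := E * f.
pose U i : R := fps_deriv i h.
have [E' EE'] : exists E', E * E' = 1.
  rewrite /E /unit_mul; apply: fps_geom; apply: (idealP_sum _ (ordge_idealP 1)) => i _.
  exact/(submodPZ (idealP_submodP (ordge_idealP 1)))/fpsX_ord.
have UEi i : U i = E * fps_deriv i f - c i *: f := UE f c i.
have fE : f = E' * h by rewrite /h mulrA [E' * E]mulrC EE' mul1r.
have hF : ipow F 1 h.
  by apply: (idealPM _ (ipow_ideal F 1)); have := ipow_gen1 F ord0; rewrite tj_gen0.
have FU m z : ipow F (m + d) z -> ipow U m z by apply: imul_pow_ipow.
have Hh m : ipow U (m - d) (h ^+ m).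
  have [md|dm] := leqP m d; first by have -> : (m - d = 0)%N by apply/eqP; rewrite subn_eq0.
  by apply: FU; rewrite (subnK (ltnW dm)); have := ipowX m hF; rewrite mul1n.
have h2 : ordge 2 h by apply: (idealPM _ (ordge_idealP 2)).
have U1 i : ordge 1 (U i) by exact: ordge_deriv.
pose K' := (K0 * d.+1)%N.
have HK z : ordge K' z -> ipow U 1 z by move=> Hz; apply: FU; exact: (ordge_F HK0 Hz).
have sI := idealP_submodP (ipow_ideal U 1).
have [B [b0 [leB sb0 ib0]]] := spans_basis sI (spans_sub HK (@box_spans k 3 K')).
have BK : (#|B| <= K' ^ 3)%N by move: leB; rewrite card_ffun !card_ord.
have B0 : (0 < #|B|)%N.
  rewrite lt0n; apply/negP => /eqP B0; have [c0 Hc0] := sb0 1.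
  move: Hc0; rewrite big1 ?subr0 => [/(ipow_ordge U1)/ordge1P|t _].
    by move/eqP; rewrite fps1E eqxx oner_eq0.
  by have := fintype0 t B0.
have [b [sb ib]] := reindex_basis (N := #|B|.-1.+1) (esym (prednK B0)) sb0 ib0.
have Np : (#|B|.-1.+1 < p)%N.
  rewrite prednK //; apply: leq_ltn_trans Hp; apply: (leq_trans BK).
  by rewrite /char_bound leqW // leq_exp2r // leq_mul2l dn orbT.
have [e0 He0] := legendre_gain pP U1 HK sb ib Np Hh.
have p1 : (1 < p)%N by rewrite prime_gt1 // (pcharf_prime pP).
(* Large enough for [legendre_gain] and for the error term in [milnor_tjurina_arith]. *)
pose e := maxn e0 (5 * #|B|.-1.+1); pose q := (p ^ e)%N.
have qB : (5 * #|B|.-1.+1 < q)%N.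
  by rewrite (leq_ltn_trans _ (ltn_expl e p1)) // leq_maxr.
have Hq : ipow U q.+1 (h ^+ q) by apply: He0; rewrite leq_maxl.
have pR : p \in [pchar R] := fps_pchar 3 pP.
have fq : f ^+ q = E' ^+ q * h ^+ q by rewrite {1}fE exprMn.
have gq i : fps_deriv i f ^+ q = E' ^+ q * U i ^+ q + c i ^+ q *: (E' ^+ q * f ^+ q).
  have -> : fps_deriv i f = E' * U i + c i *: (E' * f).
    by rewrite UEi mulrBr mulrA [E' * E]mulrC EE' mul1r scalerAr subrK.
  by rewrite (@frobD p e k pP R _ _ pR) exprZn !exprMn.
have iq := ipow_ideal (fun i => U i ^+ q) 1.
have iL0 : idealP (iadd J (ordge K)).
  by apply: iadd_ideal; [exact: ipow_ideal|exact: ordge_idealP].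
have UqE i : U i ^+ q = E ^+ q * fps_deriv i f ^+ q - c i ^+ q *: f ^+ q.
  have : (E * fps_deriv i f) ^+ q = (U i + c i *: f) ^+ q by rewrite UEi subrK.
  by rewrite (@frobD p e k pP R _ _ pR) exprZn exprMn => ->; rewrite addrK.
have count2 : (#|S| <= #|'I_#|B|.-1.+1|)%N.
  have iL := @frob_ideal 3 p e k pP _ iL0.
  (* A series of order [K * q + 3 * q] has all its coordinates [delta a] of order [K]. *)
  apply: (@milnor_count 3 p e k pP U _ b sb _ S w (K * q + 3 * q) iL0 iw) => // [z Hz a|i].
    by apply: (iaddr (ipow_ideal _ 1)) => m; apply: (delta_ord pP a Hz).
  (* The first summand is a multiple of a [q]-th power from [J]; the second is a multiple of
     [f ^+ q], hence of [h ^+ q], and lies in [ipow U q.+1]. *)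
  exists (E ^+ q * fps_deriv i f ^+ q), (- (c i ^+ q *: f ^+ q)); split=> //.
    apply: (idealPM _ iL); apply: (frob_pow pP iL0).
    exact: (iaddl (ordge_idealP K) (ipow_gen1 _ i)).
  apply: (idealPN (ipow_ideal _ _)); apply: (submodPZ (idealP_submodP (ipow_ideal _ _))).
  by rewrite fq; apply: (idealPM _ (ipow_ideal _ _)).
have count1 : (2 * #|B|.-1.+1 <= 3 * #|T|)%N.
  have HF t : iadd (ipow (fun i => U i ^+ q) 1) (fun z => exists y, z = h ^+ q * y)
      (F t ^+ q).
    case: (unliftP ord0 t) => [i ->|->]; last first.
      by rewrite tj_gen0; apply: (iaddr iq); exists (E' ^+ q); rewrite fq mulrC.
    rewrite tj_genS; exists (E' ^+ q * U i ^+ q), (c i ^+ q *: (E' ^+ q * f ^+ q)).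
    split=> //; first exact: (idealPM _ iq (ipow_gen1 _ i)).
    by exists (c i ^+ q *: (E' ^+ q * E' ^+ q)); rewrite fq -scalerAr; congr (_ *: _); rewrite mulrA mulrC.
  have := @tjurina_count 3 p e k pP U _ b sb ib 4 F (h ^+ q) T v (ipowS Hq) HF sv.
  rewrite card_ord; apply: milnor_tjurina_arith => //.
    by apply: leq_trans (card_low_box q); apply/subset_leq_card/fintype.subsetP => a; rewrite !inE mdegE; under eq_bigr do rewrite bmE.
  by apply: leq_trans (card_high_box q); apply/subset_leq_card/fintype.subsetP => a; rewrite !inE mdegE; under eq_bigr do rewrite bmE.
by move: count2; rewrite card_ord; lia.
Qed.
End CharP.

(** * Specialization to positive characteristic *)

Section Specializations.
Variable C : fieldType.

(** A subring of [C] is represented by a ring [B] together with the kernel of [psi], so that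
    adjoining an element means passing to [{poly B}] and no quotient or ring of fractions has to be
    built. *)
Definition specializable (B : idomainType) (psi : {rmorphism B -> C}) :=
  forall d, psi d != 0 -> exists M, forall p, prime p -> (M < p)%N ->
    exists (k : closedFieldType) (phi : {rmorphism B -> k}),
      [/\ p \in [pchar k], forall b, psi b = 0 -> phi b = 0 & phi d != 0].

Definition evalm (B : comNzRingType) (L : comNzRingType) (psi : {rmorphism B -> L})
  (a : L) : {poly B} -> L := horner_eval a \o map_poly psi.
HB.instance Definition _ B L psi a := GRing.RMorphism.on (@evalm B L psi a).

Lemma evalmE (B L : comNzRingType) (psi : {rmorphism B -> L}) a P :
  evalm psi a P = (map_poly psi P).[a].
Proof. by []. Qed.

Lemma evC (B L : comNzRingType) (f : {rmorphism B -> L}) (x : L) c : evalm f x c%:P = f c.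
Proof. by rewrite evalmE map_polyC hornerC. Qed.
Lemma evM (B L : comNzRingType) (f : {rmorphism B -> L}) (x : L) P P' :
  evalm f x (P * P') = evalm f x P * evalm f x P'.
Proof. exact: rmorphM. Qed.
Lemma evD (B L : comNzRingType) (f : {rmorphism B -> L}) (x : L) P P' :
  evalm f x (P + P') = evalm f x P + evalm f x P'.
Proof. exact: rmorphD. Qed.
Lemma evN (B L : comNzRingType) (f : {rmorphism B -> L}) (x : L) P :
  evalm f x (- P) = - evalm f x P.
Proof. exact: rmorphN. Qed.
Lemma ev0 (B L : comNzRingType) (f : {rmorphism B -> L}) (x : L) : evalm f x 0 = 0.
Proof. exact: raddf0. Qed.
Lemma ev1 (B L : comNzRingType) (f : {rmorphism B -> L}) (x : L) : evalm f x 1 = 1.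
Proof. exact: rmorph1. Qed.

(** * Adjoining one element to a specializable ring *)

Section Adjoin.
Variables (B : idomainType) (psi : {rmorphism B -> C}) (a : C).
Hypothesis gB : specializable psi.
Local Notation mp := (map_poly psi).
Local Notation ev := (evalm psi a).

(** The leading coefficient of [mp D] survives at almost every prime; [D] then has a nonzero image,
    and any non-root of it can serve as the image of [a]. *)
Lemma transcendental_specializable :
  (forall P, ev P = 0 -> mp P = 0) -> specializable ev.
Proof.
move=> tr D D0; have Dn0 : mp D != 0.
  by apply: contraNneq D0 => E; rewrite -[X in X == 0]/((mp D).[a]) E horner0.
have d0 : psi D`_(size (mp D)).-1 != 0.
  by have := Dn0; rewrite -lead_coef_eq0 lead_coefE coef_map.
have [M HM] := gB d0; exists M => p pP Mp.
have [k [phi [kp kerphi phid]]] := HM p pP Mp.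
have [|s Hs] := @closed_nonroot k (map_poly phi D).
  by apply: contraNneq phid => E; rewrite -coef_map E coef0.
exists k, (evalm phi s); split=> // P /tr P0.
rewrite -[LHS]/((map_poly phi P).[s]) (_ : map_poly phi P = 0) ?horner0 //; apply/polyP => i.
by rewrite coef_map coef0; apply: kerphi; rewrite -coef_map P0 coef0.
Qed.

(** Top coefficients killed by [psi] can give [D] a larger degree than its image; they are cut off
    here, so that degrees over [B] agree with those over [C]. *)
Lemma trunc_lift D : exists D', mp D' = mp D /\ size D' = size (mp D).
Proof.
exists (take_poly (size (mp D)) D).
have E : mp (take_poly (size (mp D)) D) = mp D.
  apply/polyP => i; rewrite coef_map coef_take_poly; case: ltnP => [|le]; first by rewrite coef_map.
  by rewrite raddf0 nth_default.
split=> //; apply/eqP; rewrite eqn_leq size_take_poly /= -{1}E.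
exact: size_poly.
Qed.

Section Algebraic.
Variable Q : {poly B}.
Hypothesis Qa : ev Q = 0.
Hypothesis Q0 : psi (lead_coef Q) != 0.
Hypothesis Qmin : forall P : {poly B}, (size P < size Q)%N -> ev P = 0 -> mp P = 0.

Definition compatible (k : fieldType) (phi : {rmorphism B -> k}) (s : k) :=
  [/\ forall b, psi b = 0 -> phi b = 0, phi (lead_coef Q) != 0 & evalm phi s Q = 0].

Lemma compatible_ev k phi s P P' : @compatible k phi s -> mp P = mp P' ->
  evalm phi s P = evalm phi s P'.
Proof.
move=> [ker _ _] E; rewrite !evalmE; congr _.[_]; apply/polyP => i; rewrite !coef_map.
have := congr1 (fun P : {poly C} => P`_i) E; rewrite !coef_map => Ei.
apply/eqP; rewrite -subr_eq0 -rmorphB ker // rmorphB; apply/eqP; rewrite subr_eq0; exact/eqP.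
Qed.

Lemma lead_n0 : lead_coef Q != 0.
Proof. by apply: contraNneq Q0 => ->; rewrite rmorph0. Qed.

(** Pseudo-division by [Q] leaves a remainder vanishing at [a], whose coefficients are killed by
    [psi] because [Q] is minimal; the power of the leading coefficient that it introduces is nonzero
    under [phi]. *)
Lemma compatible_ker k phi s P : @compatible k phi s -> ev P = 0 -> evalm phi s P = 0.
Proof.
move=> cs P0; have [ker l0 Qs] := cs.
have Qn0 : Q != 0 by rewrite -lead_coef_eq0 lead_n0.
have E := Pdiv.Idomain.divp_eq P Q.
have R0 : mp (P %% Q) = 0.
  apply: Qmin; first by rewrite ltn_modp.
  have := congr1 ev E; rewrite -mul_polyC evM evD evM P0 Qa !mulr0 add0r.
  by move=> <-.
have Rs : evalm phi s (P %% Q) = 0 by rewrite (compatible_ev (P' := 0) cs) ?ev0 // R0 raddf0.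
have := congr1 (evalm phi s) E; rewrite -mul_polyC evM evD evM Qs mulr0 add0r Rs evC.
by move/eqP; rewrite mulf_eq0 rmorphXn expf_eq0 (negPf l0) andbF => /eqP.
Qed.

(* Euclid's algorithm, pseudo-dividing [Q] by [D]; the minimality of [Q] keeps the
   remainders nonzero at [a]. *)
Lemma bezout_red m (D : {poly B}) : (size D <= m)%N -> (size D < size Q)%N ->
  size (mp D) = size D -> ev D != 0 -> exists (S : {poly B}) d, psi d != 0 /\
  forall k phi s, @compatible k phi s -> phi d = evalm phi s S * evalm phi s D.
Proof.
elim: m D => [|m IHm] D leD ltQ sD D0.
  by case/eqP: D0; move: leD; rewrite leqn0 size_poly_eq0 => /eqP ->; rewrite raddf0.
have [D1|D1] := leqP (size D) 1.
  exists 1, D`_0; move: D0; rewrite [in ev D](size1_polyC D1) evC; split=> // k phi s _.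
  by rewrite ev1 mul1r [in RHS](size1_polyC D1) evC.
have Dn0 : D != 0 by rewrite -size_poly_gt0 ltnW.
have lD : psi (lead_coef D) != 0.
  by rewrite lead_coefE -sD -coef_map -lead_coefE lead_coef_eq0 -size_poly_gt0 sD ltnW.
have E := Pdiv.Idomain.divp_eq Q D; move: E; set e := scalp Q D => E.
have evE (L : comNzRingType) (f : {rmorphism B -> L}) (x : L) : evalm f x Q = 0 ->
    evalm f x (Q %% D) = - (evalm f x (Q %/ D) * evalm f x D).
  move=> Q00; have := congr1 (evalm f x) E.
  rewrite -mul_polyC evM Q00 mulr0 evD evM => /esym/eqP.
  by rewrite addrC addr_eq0 => /eqP.
have ltR : (size (Q %% D)%R < size D)%N by rewrite ltn_modp.
have R0 : ev (Q %% D) != 0.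
  rewrite evE // oppr_eq0 mulf_neq0 //; apply/eqP => A0.
  have mA : mp (Q %/ D) = 0.
    apply: Qmin => //; rewrite Pdiv.Idomain.size_divp //; lia.
  have R0 : mp (Q %% D) = 0.
    by apply: Qmin; rewrite ?(ltn_trans ltR) // evE // A0 mul0r oppr0.
  have mE : mp (Q %/ D * D + Q %% D) = mp (Q %/ D) * mp D + mp (Q %% D).
    by rewrite rmorphD rmorphM.
  have := congr1 (fun P : {poly C} => P`_(size Q).-1) (congr1 mp E).
  rewrite mE mA R0 mul0r addr0 coef0 coef_map coefZ -lead_coefE => /eqP.
  rewrite -[X in X == 0]/(psi (lead_coef D ^+ e * lead_coef Q)) rmorphM.
  by rewrite mulf_eq0 rmorphXn expf_eq0 (negPf lD) andbF (negPf Q0).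
have [D' [mD' sD']] := trunc_lift (Q %% D).
have sR : (size D' < size D)%N by rewrite sD' (leq_ltn_trans (size_poly _ _)).
have D'0 : ev D' != 0 by rewrite evalmE mD' -evalmE.
have [||||S [d [d0 Hd]]] := IHm D' => //.
- by rewrite -ltnS (leq_trans sR).
- exact: ltn_trans ltQ.
- by rewrite mD'.
exists (- (S * (Q %/ D))), d; split=> // k phi s cs.
rewrite (Hd _ _ _ cs) (compatible_ev (P := D') (P' := Q %% D) cs) // evE; last by case: cs.
by rewrite evN evM mulNr mulrN mulrA.
Qed.

Lemma bezout D : ev D != 0 -> exists (S : {poly B}) d, psi d != 0 /\
  forall k phi s, @compatible k phi s -> phi d = evalm phi s S * evalm phi s D.
Proof.
move=> D0; have Qn0 : Q != 0 by rewrite -lead_coef_eq0 lead_n0.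
have E := Pdiv.Idomain.divp_eq D Q; move: E; set e := scalp D Q => E.
have evE (L : comNzRingType) (f : {rmorphism B -> L}) (x : L) : evalm f x Q = 0 ->
    evalm f x (D %% Q) = f (lead_coef Q ^+ e) * evalm f x D.
  move=> Q00; have := congr1 (evalm f x) E.
  by rewrite -mul_polyC evM evC evD evM Q00 mulr0 add0r.
have [D' [mD' sD']] := trunc_lift (D %% Q).
have ltR : (size (D %% Q)%R < size Q)%N by rewrite ltn_modp.
have D'0 : ev D' != 0.
  by rewrite evalmE mD' -evalmE evE // mulf_neq0 // rmorphXn expf_neq0.
have [||S [d [d0 Hd]]] := bezout_red (leqnn (size D')) _ _ D'0.
- by rewrite sD' (leq_ltn_trans (size_poly _ _)).
- by rewrite mD'.
exists (S * (lead_coef Q ^+ e)%:P), d; split=> // k phi s cs.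
rewrite (Hd _ _ _ cs) (compatible_ev (P := D') (P' := D %% Q) cs) // evE; last by case: cs.
by rewrite evM evC mulrA.
Qed.

Lemma algebraic_specializable : specializable ev.
Proof.
move=> D D0; have [S [d [d0 Hd]]] := bezout D0.
(* The factor [d] keeps the image of [D] away from zero through the Bezout identity, and the leading
   coefficient keeps the image of [Q] from being constant. *)
have [|M HM] := gB (d := d * lead_coef Q); first by rewrite rmorphM mulf_neq0.
exists M => p pP Mp; have [k [phi [kp kerphi phid]]] := HM p pP Mp.
move: phid; rewrite rmorphM mulf_eq0 negb_or => /andP[phid phil].
have [s Hs] : exists s, root (map_poly phi Q) s.
  apply/closed_rootP; apply: contraNneq phil => s1.
  have Q1 : (1 < size Q)%N.
    rewrite ltnNge; apply: contra Q0 => /size1_polyC Q1.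
    by move: Qa; rewrite Q1 evC lead_coefC => ->.
  rewrite lead_coefE -[X in X == 0]/((phi : {additive B -> k}) _) -coef_map nth_default //.
  by rewrite s1 -ltnS prednK // ltnW.
have cs : compatible phi s by split=> //; apply/eqP.
exists k, (evalm phi s); split=> //; first by move=> P; exact: compatible_ker.
by apply: contraNneq phid => E; rewrite (Hd k phi s) // [X in _ * X]E mulr0.
Qed.

End Algebraic.

Lemma adjoin_specializable : specializable ev.
Proof.
have [|] := pselect (forall P, ev P = 0 -> mp P = 0); first exact: transcendental_specializable.
move=> H.
have ex : exists n, `[< exists P : {poly B}, [/\ ev P = 0, mp P != 0 & size P = n] >].
  apply: contrapT => H'; apply: H => P P0; apply: contrapT => /eqP mP.
  by apply: H'; exists (size P); apply/asboolP; exists P.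
case: (ex_minnP ex) => n /asboolP[P [P0 mP sP]] nmin.
have [Q [mQ sQ]] := trunc_lift P.
have Qn : (size Q <= n)%N by rewrite sQ -sP size_poly.
apply: (algebraic_specializable (Q := Q)).
- by rewrite evalmE mQ -evalmE.
- by rewrite lead_coefE -coef_map mQ sQ -lead_coefE lead_coef_eq0.
move=> T ltT T0; apply: contrapT => /eqP mT.
have : (n <= size T)%N by apply: nmin; apply/asboolP; exists T.
by rewrite leqNgt (leq_trans ltT).
Qed.

End Adjoin.

Lemma int_specializable : [pchar C] =i pred0 -> specializable (intr : {rmorphism int -> C}).
Proof.
move=> C0 d d0; exists `|d|%N => p pP dp.
have [k [FtoK _]] := countable_algebraic_closure 'F_p.
exists k, (intr : {rmorphism int -> k}).
have kp : p \in [pchar k] by apply: (rmorph_pchar FtoK); rewrite pchar_Fp.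
have nat0 (n : nat) : (n%:R == 0 :> C) = (n == 0)%N by move: n; apply/GRing.pcharf0P.
have absE (L : fieldType) (b : int) : (b%:~R == 0 :> L) = (`|b|%N%:R == 0 :> L).
  by case: b => n //; rewrite NegzE mulrNz oppr_eq0 abszN.
split=> // [b /eqP|].
  by rewrite -[X in X == 0]/(b%:~R) absE nat0 absz_eq0 => /eqP ->.
rewrite -[X in X == 0]/(d%:~R) absE -(dvdn_pcharf kp) gtnNdvd //.
by rewrite lt0n absz_eq0; apply: contraNneq d0 => ->.
Qed.

Lemma specializable_lift (s : seq C) : [pchar C] =i pred0 ->
  exists (B : idomainType) (psi : {rmorphism B -> C}),
    specializable psi /\ forall x, x \in s -> exists b, psi b = x.
Proof.
move=> C0; elim: s => [|a s [B [psi [gB Hs]]]].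
  by exists int, intr; split=> //; exact: int_specializable.
exists {poly B}, (evalm psi a); split; first exact: adjoin_specializable.
move=> x; rewrite inE => /orP[/eqP ->|/Hs[b bx]].
  by exists 'X; rewrite -[LHS]/((map_poly psi 'X).[a]) map_polyX hornerX.
by exists b%:P; rewrite -[LHS]/((map_poly psi b%:P).[a]) map_polyC hornerC.
Qed.

End Specializations.

(** * The inequality in characteristic zero *)

Section Dual.
Variables (K : fieldType) (V : lmodType K) (I : V -> Prop) (Isub : submodP I).

Lemma indep_adjoin (S : finType) (w : S -> V) z : indep I w ->
  (forall c : S -> K, ~ I (z - \sum_s c s *: w s)) ->
  indep I (fun o : S + 'I_1 => if o is inl s then w s else z).
Proof.
move=> iw Hz c; rewrite big_sumType /= big_ord1 => Hc.
have c0 : c (inr ord0) = 0.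
  apply/eqP/negPn/negP => c0; apply: (Hz (fun s => - (c (inr ord0))^-1 * c (inl s))).
  have := submodPZ Isub (c (inr ord0))^-1 Hc.
  rewrite scalerDr scalerA mulVf // scale1r addrC; congr (I (_ + _)).
  rewrite scaler_sumr -sumrN; apply: eq_bigr => s _.
  by rewrite mulNr scaleNr opprK scalerA.
move: Hc; rewrite c0 scale0r addr0 => Hc [s|i]; last by rewrite (ord1 i).
exact: (iw (fun s => c (inl s))).
Qed.

Lemma indep_extend (S T : finType) (w : S -> V) (v : T -> V) :
  indep I w -> spans I v -> exists (U : finType) (e : U -> V) (i : S -> U),
    [/\ injective i, forall s, e (i s) = w s, spans I e & indep I e].
Proof.
move=> iw sv; have [n] := ubnP (#|T| - #|S|); elim: n => // n IHn in S w iw *.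
rewrite ltnS => leTS; have [sw|nsw] := pselect (spans I w); first by exists S, w, id; split=> //; exact: inj_id.
have [z Hz] : exists z, forall c : S -> K, ~ I (z - \sum_s c s *: w s).
  apply: contrapT => H; apply: nsw => z; apply: contrapT => H'; apply: H.
  by exists z => c Hc; apply: H'; exists c.
have iw' := indep_adjoin iw Hz.
have leT := indep_leq_spans Isub iw' sv; rewrite card_sum card_ord addn1 in leT.
have lt : (#|T| - #|{: S + 'I_1}| < n)%N by rewrite card_sum card_ord; lia.
have [U [e [i [ii ei se ie]]]] := IHn _ _ iw' lt.
by exists U, e, (fun s => i (inl s)); split=> // [s t /ii[]|s]; rewrite ?ei.
Qed.

(** Coordinates in a basis modulo [I] that extends [w]. They turn independence into equations, which
    can be specialized. *)
Lemma dual_functionals (S T : finType) (w : S -> V) (v : T -> V) :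
  indep I w -> spans I v -> exists lam : S -> V -> K,
    [/\ forall s a x y, lam s (a *: x + y) = a * lam s x + lam s y,
        forall s x, I x -> lam s x = 0 &
        forall s t, lam s (w t) = (s == t)%:R].
Proof.
move=> iw sv; have [U [e [i [ii ei se ie]]]] := indep_extend iw sv.
have [c Hc] := choice se.
have cE z b : I (z - \sum_u b u *: e u) -> c z =1 b.
  move=> Hb u; apply/eqP; rewrite -subr_eq0; apply/eqP; move: u; apply: ie.
  under eq_bigr do rewrite scalerBl.
  rewrite sumrB; have := submodPB Isub Hb (Hc z).
  by congr (I _); rewrite opprB addrC addrA subrK.
exists (fun s z => c z (i s)); split=> [s a x y|s x Ix|s t].
- apply: (cE _ (fun u => a * c x u + c y u)).
  have := submodPD Isub (submodPZ Isub a (Hc x)) (Hc y); congr (I _).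
  rewrite scalerBr addrACA -opprD; congr (_ - _); rewrite scaler_sumr -big_split.
  by apply: eq_bigr => u _; rewrite scalerDl scalerA.
- by apply: (cE _ (fun=> 0)); rewrite big1 ?subr0 // => u _; rewrite scale0r.
- rewrite (cE _ (fun u => (u == i t)%:R)); first by rewrite (inj_eq ii).
  rewrite (bigD1 (i t)) //= eqxx scale1r ei big1 ?addr0 ?subrr; first exact: (submodP0 Isub).
  by move=> u /negPf ->; rewrite scale0r.
Qed.

End Dual.

Section FiniteCodim.
Variables (k : fieldType) (n : nat) (L : {fps k[n]} -> Prop).
Hypothesis iL : idealP L.

(* Otherwise, elements of orders 0, 1, 2, etc that are nonzero in the
   successive graded pieces of the quotient would be independent. *)
Lemma spans_ordge (T : finType) (v : T -> {fps k[n]}) : spans L v ->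
  exists K, (K <= #|T|)%N /\ forall z, ordge K z -> L z.
Proof.
move=> sv; have sL := idealP_submodP iL.
suff [K [KT HK]] : exists K, (K <= #|T|)%N /\
    forall z, ordge K z -> exists y, L (z - y) /\ ordge K.+1 y.
  by exists K; split=> // z; apply: ord_nakayama.
apply: contrapT => H.
have /choice[y Hy] (i : 'I_#|T|.+1) : exists z : {fps k[n]}, ordge i z /\
    forall y, L (z - y) -> ordge i.+1 y -> False.
  apply: contrapT => H'; apply: H; exists i; split; first by rewrite -ltnS.
  move=> z Hz; apply: contrapT => H''; apply: H'; exists z; split=> // y Ly Hy.
  by apply: H''; exists y.
suff iy : indep L y by have := indep_leq_spans sL iy sv; rewrite card_ord ltnn.
move=> c Hc; suff main m (i : 'I_#|T|.+1) : (i < m)%N -> c i = 0.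
  by move=> i; apply: (main #|T|.+1).
elim: m i => // m IHm i; rewrite ltnS leq_eqVlt => /orP[/eqP im|]; last exact: IHm.
apply/eqP/negPn/negP => ci; have [Hi Hn] := Hy i.
apply: (Hn (- (c i)^-1 *: \sum_(j | j != i) c j *: y j)).
  have := submodPZ sL (c i)^-1 Hc; congr (L _).
  by rewrite (bigD1 i) //= scalerDr scalerA mulVf // scale1r scaleNr opprK.
apply: (submodPZ (idealP_submodP (ordge_idealP _))).
apply: (submodP_sum (idealP_submodP (ordge_idealP _))) => j ji.
have [ltj|lej] := ltnP j m; first by rewrite IHm // scale0r; exact: ordge0.
apply: (submodPZ (idealP_submodP (ordge_idealP _))).
have [Hj _] := Hy j; apply: ordge_leq Hj; rewrite im ltn_neqAle lej andbT.
by apply: contra ji => /eqP E; apply/eqP/val_inj; rewrite /= -E im.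
Qed.
End FiniteCodim.

Section FpsMap.
Variables (n : nat) (A B : comNzRingType) (phi : {rmorphism A -> B}).
Definition fps_map (f : {fps A[n]}) : {fps B[n]} := FPS (fun m => phi (f m)).
Fact fps_map_additive : additive fps_map.
Proof. by move=> f g; apply: fpsP => m; rewrite fpsB /= -rmorphB. Qed.
HB.instance Definition _ := GRing.isAdditive.Build {fps A[n]} {fps B[n]} fps_map
  fps_map_additive.
Fact fps_map_multiplicative : multiplicative fps_map.
Proof.
split=> [f g|]; apply: fpsP => m; last by rewrite fps1E -[LHS]/(phi ((1 : {fps A[n]}) m)) fps1E rmorph_nat.
rewrite fps_cauchy -[LHS]/(phi ((f * g) m)) fps_cauchy rmorph_sum.
by apply: eq_bigr => k _; rewrite rmorphM.
Qed.
HB.instance Definition _ := GRing.isMultiplicative.Build {fps A[n]} {fps B[n]} fps_map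
  fps_map_multiplicative.
Lemma fps_mapM f g : fps_map (f * g) = fps_map f * fps_map g. Proof. exact: rmorphM. Qed.
Lemma fps_mapB f g : fps_map (f - g) = fps_map f - fps_map g. Proof. exact: rmorphB. Qed.
Lemma fps_map_sum (I : Type) (r : seq I) (P : pred I) F :
  fps_map (\sum_(i <- r | P i) F i) = \sum_(i <- r | P i) fps_map (F i).
Proof. exact: raddf_sum. Qed.
Lemma fps_mapZ a f : fps_map (a *: f) = phi a *: fps_map f.
Proof. by apply: fpsP => m; rewrite fpsZ /= rmorphM. Qed.
Lemma fps_map_mon m : fps_map (fmon m) = fmon m.
Proof. by apply: fpsP => l; rewrite /= rmorph_nat. Qed.
Lemma fps_map_deriv i f : fps_map (fps_deriv i f) = fps_deriv i (fps_map f).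
Proof. by apply: fpsP => l; rewrite /= rmorphMn. Qed.
End FpsMap.

Section Functionals.
Variables (A : comNzRingType) (n K : nat) (l : 'X_{1..n} -> A).
Definition lowfun (z : {fps A[n]}) := \sum_(m : 'X_{1..n < K}) l m * z m.
Lemma lowfunD x y : lowfun (x + y) = lowfun x + lowfun y.
Proof. by rewrite -big_split; apply: eq_bigr => m _; rewrite fpsD mulrDr. Qed.
Lemma lowfunZ a x : lowfun (a *: x) = a * lowfun x.
Proof. by rewrite mulr_sumr; apply: eq_bigr => m _; rewrite fpsZ mulrCA. Qed.
Lemma lowfun_ord x : ordge K x -> lowfun x = 0.
Proof. by move=> Hx; apply: big1 => m _; rewrite Hx ?mulr0 // bmdeg. Qed.
Lemma lowfun_congr x y : ordge K (x - y) -> lowfun x = lowfun y.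
Proof. by move=> /lowfun_ord E; rewrite -[x](subrK y) lowfunD E add0r. Qed.
Lemma lowfun_sum (I : finType) (c : I -> A) (F : I -> {fps A[n]}) :
  lowfun (\sum_i c i *: F i) = \sum_i c i * lowfun (F i).
Proof.
have H0 : lowfun 0 = 0 by apply: lowfun_ord; exact: ordge0.
by rewrite (big_morph lowfun lowfunD H0); apply: eq_bigr => i _; rewrite lowfunZ.
Qed.
End Functionals.

Lemma lowfun_map (A B : comNzRingType) (phi : {rmorphism A -> B}) n K (l : 'X_{1..n} -> A) z :
  phi (lowfun K l z) = lowfun K (fun m => phi (l m)) (fps_map phi z).
Proof. by rewrite rmorph_sum; apply: eq_bigr => m _; rewrite rmorphM. Qed.

Lemma spans_of_monomials (k : fieldType) n K (L : {fps k[n]} -> Prop) (T : finType)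
    (v : T -> {fps k[n]}) : idealP L -> (forall z, ordge K z -> L z) ->
  (forall m, (mdeg m < K)%N -> exists a : T -> k, L (fmon m - \sum_t a t *: v t)) ->
  spans L v.
Proof.
move=> iL HK Hm z; have sL := idealP_submodP iL.
have [a Ha] := choice (fun m : 'X_{1..n < K} => Hm m (bmdeg m)).
exists (fun t => \sum_(m : 'X_{1..n < K}) z m * a m t).
apply: (submodP_congr sL (y := \sum_(m : 'X_{1..n < K}) z m *: (fmon m - \sum_t a m t *: v t))).
  have := HK _ (@fps_taylor n k K z); congr (L _).
  rewrite -addrA -opprD; congr (_ - _).
  rewrite [X in _ = X + _](_ : _ = \sum_(m : 'X_{1..n < K}) z m *: (\sum_t a m t *: v t)).
    by rewrite -big_split; apply: eq_bigr => m _; rewrite /= -scalerDr addrC subrK.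
  under eq_bigr do rewrite scaler_suml.
  rewrite exchange_big; apply: eq_bigr => m _; rewrite scaler_sumr.
  by apply: eq_bigr => t _; rewrite scalerA.
by apply: (submodP_sum sL) => m _; apply: (submodPZ sL).
Qed.

Lemma mul_diff (A : comNzRingType) (x y x' y' : A) :
  x * y - x' * y' = - ((y' - y) * x + y' * (x' - x)).
Proof. by rewrite mulrBl mulrBr [y' * x']mulrC [y * x]mulrC [X in _ = - X]addrC addrA subrK opprB. Qed.

(** Both hypotheses are certified by finitely many equations between coefficients: spanning by an
    expression of each monomial modulo the Tjurina ideal, independence by functionals dual to [w]
    that vanish on [J] and on order [K]. The certificates are lifted to a specializable ring and
    mapped to characteristic [p]. *)
Theorem milnor_tjurina_pchar0 (C : fieldType) (f : {fps C[3]}) (T S : finType)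
    (v : T -> {fps C[3]}) (w : S -> {fps C[3]}) K :
  [pchar C] =i pred0 -> ordge 2 f -> spans (ipow (tj_gen f) 1) v ->
  indep (iadd (ipow (fun i => fps_deriv i f) 1) (ordge K)) w ->
  (2 * #|S| <= 3 * #|T|)%N.
Proof.
move=> C0 f2 sv iw.
have iF := ipow_ideal (tj_gen f) 1.
have [K0 [_ HK0]] := spans_ordge iF sv.
(* Lifting through degree [D] leaves order [D] after one derivative, which has to cover [K0.+1] and
   [K]; the 1 also secures order 2 for the specialized [f]. *)
pose D := (K0 + K + 1)%N.
(* Monomials of degree [K0] lie in the Tjurina ideal and are written without the [v t], so that this
   inclusion can be recovered after specialization. *)
have /choice[ab Hab] (m : 'X_{1..3}) : exists ab : (T -> C) * ('I_4 -> {fps C[3]}),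
    fmon m = \sum_t ab.1 t *: v t + \sum_s tj_gen f s * ab.2 s /\
    (mdeg m = K0 -> forall t, ab.1 t = 0).
  have [mK|/eqP mK] := eqVneq (mdeg m) K0.
    have [s [_ E]] : ipow (tj_gen f) 1 (fmon m) by apply: HK0; rewrite -mK; exact: fmon_ord.
    by exists (fun=> 0, s); split=> //; rewrite E [X in _ = X + _]big1 ?add0r // => t _; rewrite scale0r.
  have [a [s [_ E]]] := sv (fmon m).
  by exists (a, s); split=> //; rewrite -E addrC subrK.
pose I z := iadd (ipow (fun i => fps_deriv i f) 1) (ordge K) z.
have iI : idealP I by apply: iadd_ideal; [exact: ipow_ideal|exact: ordge_idealP].
have sI : spans I (fun a : {ffun 'I_3 -> 'I_K} =>
    fmon [multinom (a i : nat) | i < 3] : {fps C[3]}).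
  apply: spans_sub (@box_spans C 3 K) => z Hz.
  exact: (iaddr (ipow_ideal _ 1)).
have [lam [lamL lamI lamw]] := dual_functionals (idealP_submodP iI) iw sI.
pose l s m := lam s (fmon m).
have lamK s z : ordge K z -> lam s z = 0.
  by move=> Hz; apply: lamI; exact: (iaddr (ipow_ideal _ 1)).
have lam0 s : lam s 0 = 0 by apply: lamK; exact: ordge0.
have lamE s z : lam s z = lowfun K (l s) z.
  have lamD x y : lam s (x + y) = lam s x + lam s y.
    by have := lamL s 1 x y; rewrite scale1r mul1r.
  rewrite -[in LHS](subrK (\sum_(m : 'X_{1..3 < K}) z m *: fmon m) z) lamD.
  rewrite lamK ?add0r; last exact: fps_taylor.
  rewrite (big_morph (lam s) lamD (lam0 s)); apply: eq_bigr => m _.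
  by have := lamL s (z m) (fmon m) 0; rewrite !addr0 lam0 addr0 mulrC => ->.
pose mD := 'X_{1..3 < D.+1}%type.
pose co (J : finType) (F : J -> {fps C[3]}) := codom (fun x : J * mD => F x.1 x.2).
pose cs := co _ (fun _ : 'I_1 => f) ++ co _ v ++ co _ w ++
  co _ (fun x : mD * 'I_4 => (ab x.1).2 x.2) ++
  codom (fun x : mD * T => (ab x.1).1 x.2) ++ codom (fun x : S * mD => l x.1 x.2).
have [B [psi [gB Hcs]]] := specializable_lift cs C0.
have /choice[lft lftE] (x : C) : exists b, x \in cs -> psi b = x.
  by case: (boolP (x \in cs)) => [/Hcs[b bx]|_]; [exists b|exists 0].
(* Every condition to be transported is an equation, even the independence of [w] in the form
   [lam s (w t) = (s == t)]; hence the choice [d = 1]. *)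
have [|M HM] := gB 1; first by rewrite rmorph1 oner_neq0.
(* [char_bound] depends on [K0] alone, and [K0] is the same before and after specialization. *)
have [p Mp pP] := prime_above (M + char_bound K0).
have [|k [phi [kp ker _]]] := HM p pP; first by rewrite (leq_ltn_trans _ Mp) ?leq_addr.
pose L (z : {fps C[3]}) : {fps B[3]} := FPS (fun m => lft (z m)).
pose pB : {fps B[3]} -> {fps C[3]} := fps_map psi.
pose pk : {fps B[3]} -> {fps k[3]} := fps_map phi.
have transf d x : ordge d (pB x) -> ordge d (pk x) by move=> H m /H; exact: ker.
have coL (J : finType) (F : J -> {fps C[3]}) : {subset co J F <= cs} ->
    forall j, ordge D.+1 (pB (L (F j)) - F j).
  move=> sub j m mD'; rewrite fpsB /= lftE ?subrr //; apply: sub.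
  exact: (codom_f _ (j, BMultinom mD')).
have Lf : ordge D.+1 (pB (L f) - f).
  by apply: (coL _ (fun _ : 'I_1 => f) _ ord0) => x xf; rewrite !mem_cat xf.
have Lv t : ordge D.+1 (pB (L (v t)) - v t).
  by move: t; apply: coL => x xf; rewrite !mem_cat xf !orbT.
have Lw t : ordge D.+1 (pB (L (w t)) - w t).
  by move: t; apply: coL => x xf; rewrite !mem_cat xf !orbT.
have Lb (m : 'X_{1..3}) s : (mdeg m < D.+1)%N -> ordge D.+1 (pB (L ((ab m).2 s)) - (ab m).2 s).
  move=> mD'; apply: (coL _ (fun x : mD * 'I_4 => (ab x.1).2 x.2) _ (BMultinom mD', s)) => x xf.
  by rewrite !mem_cat xf !orbT.
have La (m : 'X_{1..3}) t : (mdeg m < D.+1)%N -> psi (lft ((ab m).1 t)) = (ab m).1 t.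
  move=> mD'; apply: lftE; rewrite !mem_cat.
  by rewrite (codom_f (fun x : mD * T => (ab x.1).1 x.2) (BMultinom mD', t)) !orbT.
have Ll s (m : 'X_{1..3}) : (mdeg m < D.+1)%N -> psi (lft (l s m)) = l s m.
  move=> mD'; apply: lftE; rewrite !mem_cat.
  by rewrite (codom_f (fun x : S * mD => l x.1 x.2) (s, BMultinom mD')) !orbT.
have Ltj s : ordge D (pB (tj_gen (L f) s) - tj_gen f s).
  case: (unliftP ord0 s) => [i ->|->]; last by rewrite !tj_gen0; apply: ordge_leq Lf.
  by rewrite !tj_genS /pB fps_map_deriv -raddfB; apply: ordge_deriv.
pose fk := pk (L f).
have tjk s : pk (tj_gen (L f) s) = tj_gen fk s.
  by case: (unliftP ord0 s) => [i ->|->]; rewrite ?tj_gen0 // !tj_genS /pk fps_map_deriv.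
have fk2 : ordge 2 fk.
  apply: transf; apply: (idealP_congr (ordge_idealP 2) _ f2).
  by apply: ordge_leq Lf; rewrite /D addn1.
have iD := ordge_idealP (R := C) (n := 3) D.
have sD := idealP_submodP iD.
have cert m : (mdeg m <= K0)%N ->
    ordge K0.+1 (fmon m - \sum_t phi (lft ((ab m).1 t)) *: pk (L (v t))
      - \sum_s tj_gen fk s * pk (L ((ab m).2 s))).
  move=> mK0; have mD' : (mdeg m < D.+1)%N by rewrite /D; lia.
  pose x : {fps B[3]} := fmon m - \sum_t lft ((ab m).1 t) *: L (v t)
      - \sum_s tj_gen (L f) s * L ((ab m).2 s).
  have mapE (A : comNzRingType) (g : {rmorphism B -> A}) : fps_map g x =
      fmon m - \sum_t g (lft ((ab m).1 t)) *: fps_map g (L (v t))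
      - \sum_s fps_map g (tj_gen (L f) s) * fps_map g (L ((ab m).2 s)).
    rewrite /x !fps_mapB fps_map_mon !fps_map_sum; congr (_ - _ - _).
      by apply: eq_bigr => t _; rewrite fps_mapZ.
    by apply: eq_bigr => s _; rewrite fps_mapM.
  have -> : fmon m - \sum_t phi (lft ((ab m).1 t)) *: pk (L (v t))
      - \sum_s tj_gen fk s * pk (L ((ab m).2 s)) = pk x.
    rewrite /pk mapE; congr (_ - _).
    by apply: eq_bigr => s _; rewrite -tjk.
  apply: transf; apply: (@ordge_leq _ _ _ D); first by rewrite /D; lia.
  have [E _] := Hab m; rewrite /pB mapE [X in ordge _ (X - _ - _)]E -addrA addrACA.
  apply: (submodPD sD); rewrite -sumrB.
    apply: (submodP_sum sD) => t _; rewrite La // -scalerBr.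
    apply: (submodPZ sD); rewrite -opprB; apply: (submodPN sD).
    exact: ordge_leq (Lv t).
  apply: (submodP_sum sD) => s _; rewrite mul_diff; apply: (submodPN sD).
  apply: (submodPD sD); last exact: (idealPM _ iD).
  by rewrite mulrC; apply: (idealPM _ iD); apply: ordge_leq (Lb m s mD').
pose r m := \sum_s tj_gen fk s * pk (L ((ab m).2 s)).
have iFk := ipow_ideal (tj_gen fk) 1.
have sFk := idealP_submodP iFk.
have rF m : ipow (tj_gen fk) 1 (r m).
  apply: (idealP_sum _ iFk) => s _; rewrite mulrC; apply: (idealPM _ iFk); exact: ipow_gen1.
have sK1 := idealP_submodP (ordge_idealP (R := k) (n := 3) K0.+1).
have rK m : mdeg m = K0 -> ordge K0.+1 (fmon m - r m).
  move=> mK0; have := cert m; rewrite mK0 leqnn => /(_ isT).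
  rewrite big1 ?subr0 // => t _; rewrite ker ?scale0r // La; last by rewrite mK0 /D; lia.
  by have [_ ->] := Hab m.
(* The transported expressions of the monomials of degree [K0] hold only up to order [K0.+1];
   Nakayama turns this into an inclusion. *)
have HKk z : ordge K0 z -> ipow (tj_gen fk) 1 z.
  apply: (ord_nakayama iFk) => {}z Hz.
  exists (z - \sum_(m : 'X_{1..3 < K0.+1}) z m *: r m); split.
    rewrite opprB addrC subrK; apply: (submodP_sum sFk) => m _.
    exact: (submodPZ sFk).
  have -> : z - \sum_(m : 'X_{1..3 < K0.+1}) z m *: r m =
     (z - \sum_(m : 'X_{1..3 < K0.+1}) z m *: fmon m) +
     \sum_(m : 'X_{1..3 < K0.+1}) z m *: (fmon m - r m).
    by under [X in _ = _ + X]eq_bigr do rewrite scalerBr; rewrite sumrB addrA subrK.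
  apply: (submodPD sK1); first exact: fps_taylor.
  apply: (submodP_sum sK1) => m _.
  have := bmdeg m; rewrite ltnS leq_eqVlt => /orP[/eqP mK|ltm].
    exact/(submodPZ sK1)/rK.
  by rewrite Hz // scale0r; exact: ordge0.
have svk : spans (ipow (tj_gen fk) 1) (fun t => pk (L (v t))).
  apply: (spans_of_monomials iFk HKk) => m mK0.
  exists (fun t => phi (lft ((ab m).1 t))); apply: (submodP_congr sFk _ (rF m)).
  by apply/HKk/ordge_leq/(cert m (ltnW mK0)).
pose lk s m := phi (lft (l s m)).
have lowpsi s x : psi (lowfun K (fun m => lft (l s m)) x) = lam s (pB x).
  rewrite lowfun_map lamE; apply: eq_bigr => m _; rewrite Ll //.
  by rewrite (leq_trans (bmdeg m)) // /D; lia.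
(* The functional sees only the terms of [y] of degree below [K], so [y] may be taken to be a
   monomial, for which the claim is an equation in [B]. *)
have lkJ s i y : lowfun K (lk s) (y * fps_deriv i fk) = 0.
  have Hm (m : 'X_{1..3}) : lowfun K (lk s) (fmon m * fps_deriv i fk) = 0.
    have -> : fmon m * fps_deriv i fk = pk (fmon m * fps_deriv i (L f)).
      by rewrite /pk fps_mapM fps_map_mon fps_map_deriv.
    rewrite -lowfun_map; apply: ker; rewrite lowpsi; apply: lamI.
    rewrite /pB fps_mapM; apply: (idealPM _ iI); rewrite fps_map_deriv.
    apply: (idealP_congr iI (y := fps_deriv i f)).
      apply: (iaddr (ipow_ideal _ 1)); rewrite -raddfB.
      by apply: ordge_deriv; apply: ordge_leq Lf; rewrite /D; lia.
    exact: (iaddl (ordge_idealP K) (ipow_gen1 (fun i => fps_deriv i f) i)).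
  rewrite (@lowfun_congr _ _ _ _ _ (\sum_(m : 'X_{1..3 < K}) y m *: (fmon m * fps_deriv i fk))).
    by rewrite lowfun_sum big1 // => m _; rewrite Hm mulr0.
  under eq_bigr do rewrite scalerAl.
  rewrite -mulr_suml -mulrBl mulrC; apply: (idealPM _ (ordge_idealP K)); exact: fps_taylor.
have lkw s t : lowfun K (lk s) (pk (L (w t))) = (s == t)%:R.
  rewrite -lowfun_map; apply/eqP; rewrite -subr_eq0 -(rmorph_nat phi) -rmorphB; apply/eqP/ker.
  rewrite rmorphB rmorph_nat lowpsi.
  have := lamL s 1 (pB (L (w t)) - w t) (w t); rewrite scale1r subrK mul1r lamw => ->.
  by rewrite lamK ?add0r ?subrr //; apply: ordge_leq (Lw t); rewrite /D; lia.
have iwk : indep (iadd (ipow (fun i => fps_deriv i fk) 1) (ordge K)) (fun t => pk (L (w t))).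
  move=> c [_ [y [[u [_ ->]] Hy E]]] s.
  have : c s = lowfun K (lk s) (\sum_t c t *: pk (L (w t))).
    rewrite lowfun_sum (bigD1 s) //= lkw eqxx mulr1 big1 ?addr0 // => t ts.
    by rewrite lkw eq_sym (negPf ts) mulr0.
  move=> ->; rewrite E lowfunD (lowfun_ord _ Hy) addr0.
  have H0 : lowfun K (lk s) 0 = 0 by apply: lowfun_ord; exact: ordge0.
  rewrite (big_morph _ (@lowfunD _ _ K (lk s)) H0) big1 // => i _.
  by rewrite mulrC lkJ.
apply: (milnor_tjurina_pchar kp fk2 HKk _ svk iwk).
by rewrite (leq_ltn_trans _ Mp) ?leq_addl.
Qed.

(** * Spans of ideals and dimensions of quotients *)

Lemma ideal_span_ipow (A : comNzRingType) (S : set A) r (G : 'I_r -> A) :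
  (forall x, S x -> exists i, x = G i) -> (forall i, S (G i)) ->
  forall z, ideal_span S z <-> ipow G 1 z.
Proof.
move=> SG GS z; split=> [[m [a [s [Ss ->]]]]|[s [_ ->]]].
  apply: (idealP_sum _ (ipow_ideal G 1)) => i _; apply: (idealPM _ (ipow_ideal G 1)).
  by have [j ->] := SG _ (Ss i); exact: ipow_gen1.
elim/big_ind: _ => [|x y|i _]; [exact: ideal_span0|exact: ideal_spanD|].
rewrite mulrC; apply: ideal_spanMl; exists 1%N, (fun=> 1), (fun=> G i).
by split=> //; rewrite big_ord1 mul1r.
Qed.

Section QuotientDimension.
Variables (K : fieldType) (V : lmodType K) (I : submodClosed V).
Local Open Scope quotient_scope.
Let IP z := z \in (I : {pred V}).

Lemma pi_eqP x y : \pi_(lmod_quot I) x = \pi_(lmod_quot I) y <-> IP (x - y).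
Proof.
rewrite /IP -[_ \in _]/((x - y) \in (submod_zmod I)) Quotient.idealrBE.
by split=> /eqP.
Qed.

Lemma submod_submodP : submodP IP.
Proof.
split; first exact: rpred0.
by move=> a x y Ix Iy; apply: rpredD => //; exact: rpredZ.
Qed.

Lemma pi_sumZ n (c : 'I_n -> K) (v : 'I_n -> V) :
  \pi_(lmod_quot I) (\sum_i c i *: v i) = \sum_i c i *: (\pi_(lmod_quot I) (v i)).
Proof.
have pi0 : \pi_(lmod_quot I) 0 = 0.
  by apply: (addrI (\pi_(lmod_quot I) 0)); rewrite Defs.pi_add !addr0.
rewrite (big_morph (fun x => \pi_(lmod_quot I) x) (fun x y => esym (Defs.pi_add I x y)) pi0).
by apply: eq_bigr => i _; rewrite -Defs.pi_scale.
Qed.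

Lemma has_dim_spans n : has_dim (lmod_quot I) n -> exists v : 'I_n -> V, spans IP v.
Proof.
move=> [[g glin [g' gK g'K]]].
have g'lin : linear g' by move=> a x y; apply: (can_inj gK); rewrite g'K glin !g'K.
pose G' := HB.pack_for {linear 'rV[K]_n -> lmod_quot I} g'
  (GRing.isLinear.Build _ _ _ _ g' g'lin).
exists (fun i => repr (g' (delta_mx 0 i))) => z.
exists (fun i => g (\pi_(lmod_quot I) z) 0 i); apply/pi_eqP.
rewrite pi_sumZ; under eq_bigr do rewrite reprK.
transitivity (G' (\sum_i g (\pi_(lmod_quot I) z) 0 i *: delta_mx 0 i)).
  by rewrite -row_sum_delta; exact: (esym (gK _)).
by rewrite linear_sum; apply: eq_bigr => i _; rewrite linearZ.
Qed.

Lemma basis_has_dim n (b : 'I_n -> V) : spans IP b -> indep IP b ->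
  has_dim (lmod_quot I) n.
Proof.
move=> sb ib; have [c Hc] := choice sb.
have cE z d : IP (z - \sum_i d i *: b i) -> c z =1 d.
  move=> Hd i; apply/eqP; rewrite -subr_eq0; apply/eqP; move: i; apply: ib.
  under eq_bigr do rewrite scalerBl.
  rewrite sumrB; have := submodPB submod_submodP Hd (Hc z).
  by congr (IP _); rewrite opprB addrC addrA subrK.
pose g (u : lmod_quot I) : 'rV[K]_n := \row_i c (repr u) i.
pose g' (r : 'rV[K]_n) : lmod_quot I := \pi_(lmod_quot I) (\sum_i r 0 i *: b i).
have gP z : g (\pi_(lmod_quot I) z) = \row_i c z i.
  apply/rowP => i; rewrite !mxE; apply: cE.
  have : IP (repr (\pi_(lmod_quot I) z) - z) by apply/pi_eqP; rewrite reprK.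
  move=> /(submodPD submod_submodP)/(_ (Hc z)).
  by congr (IP _); rewrite addrA subrK.
have gl : linear g.
  move=> a x y; rewrite -[x]reprK -[y]reprK.
  have -> : a *: (\pi_(lmod_quot I) (repr x)) + \pi_(lmod_quot I) (repr y) =
      \pi_(lmod_quot I) (a *: repr x + repr y).
    by rewrite -Defs.pi_add -Defs.pi_scale.
  rewrite !gP; apply/rowP => i; rewrite !mxE.
  apply: (cE _ (fun i => a * c (repr x) i + c (repr y) i)).
  have := submodPD submod_submodP (submodPZ submod_submodP a (Hc (repr x))) (Hc (repr y)).
  congr (IP _); rewrite scalerBr addrACA -opprD; congr (_ - _).
  rewrite scaler_sumr -big_split.
  by apply: eq_bigr => u _; rewrite /= scalerDl scalerA.
have gK : cancel g g'.
  move=> u; rewrite -[u in RHS]reprK; apply/pi_eqP.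
  have := submodPN submod_submodP (Hc (repr u)); rewrite opprB; congr (IP (_ - _)).
  by apply: eq_bigr => i _; rewrite mxE.
have g'K : cancel g' g.
  move=> r; rewrite /g' gP; apply/rowP => i; rewrite mxE; apply: (cE _ (fun i => r 0 i)).
  by rewrite subrr; exact: (submodP0 submod_submodP).
by constructor; exists g => //; exists g'.
Qed.
End QuotientDimension.

(** * The inequality over the complex numbers *)

Section Main.
Variables (R : realType) (f : {fps R[i][3]}).
Local Notation C := (R[i]).

Lemma singularity_ord2 : hypersurface_singularity f -> ordge 2 f.
Proof.
move=> [m [a [s [Ss ->]]]].
have m1 x : max_ideal x -> ordge 1 x.
  move=> [m' [a' [s' [Ss' ->]]]]; apply: (idealP_sum _ (ordge_idealP 1)) => i _.
  apply: (idealPM _ (ordge_idealP 1)); have [j _ <-] := Ss' i; exact: fpsX_ord.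
apply: (idealP_sum _ (ordge_idealP 2)) => i _; apply: (idealPM _ (ordge_idealP 2)).
by have [x /m1 Hx [y /m1 Hy <-]] := Ss i; exact: (ordgeM Hx Hy).
Qed.

Lemma tjurina_idealE z :
  ideal_span (f |` range (fun i => fps_deriv i f))%classic z <-> ipow (tj_gen f) 1 z.
Proof.
apply: ideal_span_ipow => [x [->|[i _ <-]]|s].
- by exists ord0; rewrite tj_gen0.
- by exists (lift ord0 i); rewrite tj_genS.
- by case: (unliftP ord0 s) => [i ->|->]; rewrite ?tj_genS ?tj_gen0; [right; exists i|left].
Qed.

Lemma milnor_idealE z :
  ideal_span (range (fun i => fps_deriv i f)) z <-> ipow (fun i => fps_deriv i f) 1 z.
Proof.
by apply: ideal_span_ipow => [x [i _ <-]|i]; exists i.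
Qed.

(** The finiteness of [mu] is part of the conclusion: the dimension modulo [J] plus order [K] is at
    most [3 tau / 2] for every [K], which with Nakayama forces [J] to contain all series of large
    order. *)
Lemma milnor_basis (T : finType) (v : T -> {fps C[3]}) : ordge 2 f ->
  spans (ipow (tj_gen f) 1) v ->
  exists m (b : 'I_m -> {fps C[3]}), [/\ (2 * m <= 3 * #|T|)%N,
    spans (ipow (fun i => fps_deriv i f) 1) b & indep (ipow (fun i => fps_deriv i f) 1) b].
Proof.
move=> f2 sv; set J := ipow _ 1; have iJ : idealP J := ipow_ideal _ 1.
have C0 : [pchar C] =i pred0 by exact: pchar_num.
have bound K (S : finType) (w : S -> {fps C[3]}) :
    indep (iadd J (ordge K)) w -> (2 * #|S| <= 3 * #|T|)%N.
  exact: (milnor_tjurina_pchar0 C0 f2 sv).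
have iJK K : idealP (iadd J (ordge K)) by apply: iadd_ideal => //; exact: ordge_idealP.
(* Modulo [J] plus order [B.+1] the dimension is at most [B], so by [spans_ordge] this ideal
   contains all series of order [B]. *)
pose B := (3 * #|T|)%N.
have HB : forall z, ordge B z -> J z.
  apply: ord_nakayama => // z Hz.
  have sK := idealP_submodP (iJK B.+1).
  have bs : spans (iadd J (ordge B.+1)) (fun a : {ffun 'I_3 -> 'I_B.+1} =>
      fmon [multinom (a i : nat) | i < 3] : {fps C[3]}).
    by apply: spans_sub (@box_spans C 3 B.+1) => y Hy; exact: iaddr.
  have [S [w [_ sw iw]]] := spans_basis sK bs.
  have [K [KS HK]] := spans_ordge (iJK B.+1) sw.
  have [|x [y [Jx Hy ->]]] := HK z.
    apply: ordge_leq Hz; apply: (leq_trans KS); have := bound _ _ _ iw; rewrite /B; lia.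
  by exists y; rewrite addrK.
have sJ := idealP_submodP iJ.
have [S [e [_ se ie]]] := spans_basis sJ (spans_sub HB (@box_spans C 3 B)).
have [b [sb ib]] := reindex_basis (erefl #|S|) se ie.
exists #|S|, b; split=> //; apply: (bound B _ e); apply: indep_sub ie.
by move=> z [x [y [Jx /HB Jy ->]]]; exact: idealPD.
Qed.

End Main.

Theorem corollary1p6 (R : realType) (f : {fps R[i][3]}) :
  hypersurface_singularity f -> isolated f ->
  (milnor f / tjurina f <= (3 / 2)%R%:E)%E.
Proof.
move=> /singularity_ord2 f2; rewrite /isolated /tjurina /quot_dim.
have [[n Hn] _|H] := pselect (exists n,
  has_dim (lmod_quot (ideal_pred (f |` range (fun i => fps_deriv i f))%classic)) n); last first.
  by rewrite edim_infty // => n Hn; apply: H; exists n.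
have [v sv] := has_dim_spans Hn.
have sv' : spans (ipow (tj_gen f) 1) v.
  by apply: spans_sub sv => z /asboolP /tjurina_idealE.
have [m [b [mn sb ib]]] := milnor_basis f2 sv'.
have Hm : has_dim (lmod_quot (ideal_pred (range (fun i => fps_deriv i f)))) m.
  apply: (basis_has_dim (b := b)).
    by apply: spans_sub sb => z /milnor_idealE Hz; apply/asboolP.
  by apply: indep_sub ib => z /asboolP /milnor_idealE.
(* The Tjurina ideal lies in the maximal ideal, so [tau] is positive and the extended real quotient
   is an ordinary one. *)
have n0 : (0 < n)%N.
  case: n v sv sv' {Hn mn} => // v sv sv'; have [c] := sv' 1.
  rewrite big_ord0 subr0 => /ipow_ordge H.
  have /H/ordge1P : forall t, ordge 1 (tj_gen f t).
    move=> t; case: (unliftP ord0 t) => [i ->|->]; rewrite ?tj_genS ?tj_gen0.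
      exact: ordge_deriv.
    exact: ordge_leq f2.
  by move/eqP; rewrite fps1E eqxx oner_eq0.
rewrite /milnor /quot_dim (edimE _ Hm) (edimE _ Hn).
rewrite inver pnatr_eq0 gtn_eqF // -EFinM lee_fin.
rewrite ler_pdivrMr ?ltr0n // mulrAC ler_pdivlMr ?ltr0n //.
by rewrite -!natrM ler_nat mulnC; move: mn; rewrite card_ord.
Qed.
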